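(* Let $k\ge 2$. There exists a biholomorphic image of $\mathbb{C}\times(\mathbb{C}^* )^{k-1}$ in $\mathbb{C}^k$ which is Runge; that is, there is a domain $D\subset\mathbb{C}^k$ which is biholomorphic to $\mathbb{C}\times(\mathbb{C}^* )^{k-1}$ and is Runge in $\mathbb{C}^k$.
   Context: $\mathbb{C}^*=\mathbb{C}\setminus\{0\}$. A domain $D\subset\mathbb{C}^k$ is Runge (in $\mathbb{C}^k$) if every holomorphic function on $D$ can be approximated, uniformly on compact subsets of $D$, by holomorphic polynomials on $\mathbb{C}^k$. *)

(* Defs.v *)
From HB Require Import structures.
From mathcomp Require Import all_boot all_order all_algebra.
From mathcomp Require Import all_classical all_reals all_analysis.
From mathcomp Require Import complex.
From mathcomp.multinomials Require mpoly.
Set Implicit Arguments.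
Unset Strict Implicit.
Unset Printing Implicit Defensive.
Import Order.TTheory GRing.Theory Num.Theory.
Import numFieldNormedType.Exports.
Local Open Scope ring_scope.
Local Open Scope classical_set_scope.

(* [R[i]] as a normed space over itself, with the topology of the modulus.  The
   library's instances for abstract numeric fields are keyed on the structure
   and do not fire on [complex R]. *)
HB.instance Definition _ (R : realType) := PseudoPointedMetric.copy R[i] R[i]^o.
HB.instance Definition _ (R : realType) := GRing.ComAlgebra.copy R[i] R[i]^o.
HB.instance Definition _ (R : realType) := Vector.copy R[i] R[i]^o.
HB.instance Definition _ (R : realType) := NormedModule.copy R[i] R[i]^o.

Definition holomorphic_on (R : realType) (V W : normedModType R[i])
  (A : set V) (f : V -> W) : Prop :=
  forall z, A z -> differentiable f z.

(* A domain is open, connected and nonempty; [connected] alone allows [set0]. *)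
Definition domain (R : realType) (k : nat) (D : set 'rV[R[i]]_k) : Prop :=
  [/\ open D, connected D & D !=set0].

Definition biholomorphic (R : realType) (V W : normedModType R[i])
  (A : set V) (B : set W) : Prop :=
  exists (F : V -> W) (G : W -> V),
    [/\ holomorphic_on A F, holomorphic_on B G,
        F @` A `<=` B, G @` B `<=` A &
        {in A, cancel F G} /\ {in B, cancel G F}].

Definition runge (R : realType) (k : nat) (D : set 'rV[R[i]]_k) : Prop :=
  forall f : 'rV[R[i]]_k -> R[i], holomorphic_on D f ->
  forall K : set 'rV[R[i]]_k, compact K -> K `<=` D ->
  forall e : R, 0 < e ->
  exists p : mpoly.mpoly k R[i],
    forall z, K z -> `|f z - mpoly.meval (fun i => z 0 i) p| < e%:C%C.

Definition C_times_Cstar (R : realType) (k : nat) : set 'rV[R[i]]_k :=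
  [set z | forall i : 'I_k, (i : nat) != 0%N -> z 0 i != 0].
Arguments C_times_Cstar R k : clear implicits.

(* Main.v *)
Require Import Defs.
From HB Require Import structures.
From mathcomp Require Import all_boot all_order all_algebra.
From mathcomp Require Import all_classical all_reals all_analysis.
From mathcomp Require Import complex ring lra.

(** The domain is the basin of a sequence of automorphisms of C^k, seen in charts
    that are themselves polynomial maps.

    Write a point of C^k as [(y, x, z')], let [q] be the product of the
    coordinates of [z'] and [pi = q x y] the product of all coordinates. On the
    hypersurface [pi = 1] the coordinates other than [y] are nonzero and free, so
    it is a power of the punctured plane. The vector field
    [W = (1 - pi) (x d/dx + y d/dy)] vanishes on it and attracts towards it, since
    [W pi = 2 pi (1 - pi)]: the basin of [pi = 1] ought to be a bundle of complex
    lines over it. The field is not complete, but it is a sum of complete ones,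
    because
      [pi (x d/dx + y d/dy) = (V - V') / 2 + q y^3 d/dx + q x^3 d/dy]
    with the overshear fields
      [V = q (x + y)^2 (x - y) (d/dx - d/dy)] and
      [V' = q (x - y)^2 (x + y) (d/dx + d/dy)].
    The composite [flow_step e] of the flows of these pieces for time [e] is an
    automorphism with [flow_step e = id + e W + O(e^2)] on bounded sets.

    The steps [rate n] are close to [1 / (4 n)], so that [1 - pi] decays like
    [1 / scale n] with [scale n] the square root of [n + 1]. In the charts
    [(y, x, z') |-> (scale n (1 - pi), x, z')] the [n]-th step becomes a map that
    differs from the identity, on each compact subset of the product of C and the
    punctured planes, by a multiple of [tail n - tail n.+1], where
    [tail n = 1 / scale n] ([chart_step_est], [chart_step_inv_est]). These errors
    telescope. Hence the iterates read in the charts converge, their inverses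
    converge too, and the limits are inverse biholomorphic maps between the set
    [basin] of convergence and the product ([basin_biholomorphic]).

    The basin is Runge because the charts are entire. The coordinates of the limit
    [G] are locally uniform limits of entire functions, and so are the inverses of
    those that do not vanish: the product of all coordinates of the [n]-th iterate
    is [1 - u / scale n], with [u] the coordinate of index 0 in the chart, and tends
    to [1], so [1 / G_i] is the limit of the product of the coordinates other than
    the [i]-th. Since a holomorphic function on the product is a limit of Laurent
    polynomials ([laurent_approx]), its composite with [G] is a limit of entire
    functions, which are limits of polynomials ([runge_basin]).

    The complex analysis rests on Goursat's bisection, applied to Riemann sums
    rather than to integrals ([goursat]). It makes the means of a holomorphic
    function over circles independent of the circle ([cmean_indep]); this gives
    Cauchy's estimate, hence the theorem of Weierstrass on limits, and, through
    Fejer summation over roots of unity, the approximation by Laurent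
    polynomials. *)

Set Implicit Arguments.
Unset Strict Implicit.
Unset Printing Implicit Defensive.
Import Order.TTheory GRing.Theory Num.Theory.
Import numFieldNormedType.Exports.
Local Open Scope ring_scope.
Local Open Scope classical_set_scope.
Local Open Scope complex_scope.

(** * Norms as real numbers *)

Section Norm.
Context {R : realType}.
Local Notation C := R[i].

Lemma RCD (x y : R) : (x + y)%:C = x%:C + y%:C :> C.
Proof. exact: rmorphD. Qed.
Lemma RCM (x y : R) : (x * y)%:C = x%:C * y%:C :> C.
Proof. exact: rmorphM. Qed.

(** Norms with values in [R[i]] are not totally ordered; estimates are carried out
    with the same norm as an element of [R]. *)
Definition nr (V : normedModType C) (v : V) : R := complex.Re `|v|.

Section NrV.
Variable V : normedModType C.
Implicit Types v w : V.

Lemma nrE v : `|v| = (nr v)%:C.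
Proof.
by rewrite /nr; apply/esym; apply: RRe_real; apply: ger0_real; exact: normr_ge0.
Qed.

Lemma nr_ge0 v : 0 <= nr v.
Proof. by rewrite -ler0c -nrE normr_ge0. Qed.

Lemma nrD v w : nr (v + w) <= nr v + nr w.
Proof. by rewrite -lecR RCD -!nrE ler_normD. Qed.

Lemma nrN v : nr (- v) = nr v.
Proof. by rewrite /nr normrN. Qed.

Lemma nrB v w : nr (v - w) = nr (w - v).
Proof. by rewrite -nrN opprB. Qed.

Lemma nr0 : nr (0 : V) = 0.
Proof. by rewrite /nr normr0. Qed.

Lemma nr_eq0 v : (nr v == 0) = (v == 0).
Proof. rewrite -(inj_eq (@complexI R)) -nrE; exact: normr_eq0. Qed.

Lemma nr_gt0 v : (0 < nr v) = (v != 0).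
Proof. by rewrite lt_def nr_ge0 nr_eq0 andbT. Qed.

Lemma nrZ (a : C) v : nr (a *: v) = nr a * nr v.
Proof. by apply: (@complexI R); rewrite RCM -!nrE normrZ. Qed.

Lemma nr_dist v w u : nr (v - w) <= nr (v - u) + nr (u - w).
Proof. by have -> : v - w = (v - u) + (u - w) by [rewrite addrA subrK]; exact: nrD. Qed.

Lemma nr_distl v w : nr v <= nr w + nr (v - w).
Proof. by rewrite -{1}[v](subrK w) addrC nrD. Qed.

Lemma nr_sum (I : Type) (r : seq I) (P : pred I) (F : I -> V) :
  nr (\sum_(i <- r | P i) F i) <= \sum_(i <- r | P i) nr (F i).
Proof.
elim/big_ind2: _ => //; first by rewrite nr0.
by move=> x a y b xa yb; apply: (le_trans (nrD _ _)); apply: lerD.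
Qed.

Lemma nr_ltP v (e : R) : (`|v| < e%:C) = (nr v < e).
Proof. by rewrite nrE ltcR. Qed.
Lemma nr_leP v (e : R) : (`|v| <= e%:C) = (nr v <= e).
Proof. by rewrite nrE lecR. Qed.
End NrV.

Implicit Types z w : C.

Lemma nrM z w : nr (z * w) = nr z * nr w.
Proof. by rewrite -nrZ. Qed.

Lemma nr1 : nr (1 : C) = 1.
Proof. by apply: (@complexI R); rewrite -nrE normr1. Qed.

Lemma nrX z n : nr (z ^+ n) = nr z ^+ n.
Proof. by elim: n => [|n IH]; rewrite ?expr0 ?nr1 // !exprS nrM IH. Qed.

Lemma nrV z : nr z^-1 = (nr z)^-1.
Proof.
have [->|z0] := eqVneq z 0; first by rewrite invr0 nr0 invr0.
apply: (mulfI (x := nr z)); first by rewrite nr_eq0.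
by rewrite -nrM !mulfV ?nr1 // nr_eq0.
Qed.

Lemma nr_real (x : R) : nr x%:C = `|x|.
Proof.
rewrite /nr normc_def /=.
by rewrite expr0n /= addr0 sqrtr_sqr.
Qed.

Lemma nr_nat n : nr (n%:R : C) = n%:R.
Proof. by rewrite -(rmorph_nat (@real_complex R)) nr_real ger0_norm. Qed.

Lemma nrE2 z : nr z ^+ 2 = complex.Re z ^+ 2 + complex.Im z ^+ 2.
Proof.
rewrite /nr normc_def /= sqr_sqrtr //.
by rewrite addr_ge0 // sqr_ge0.
Qed.

Lemma Re_le_nr z : `|complex.Re z| <= nr z.
Proof.
rewrite -(@ler_pXn2r _ 2) // ?nnegrE ?nr_ge0 //.
by rewrite nrE2 real_normK ?num_real // lerDl sqr_ge0.
Qed.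

Lemma Im_le_nr z : `|complex.Im z| <= nr z.
Proof.
rewrite -(@ler_pXn2r _ 2) // ?nnegrE ?nr_ge0 //.
by rewrite nrE2 real_normK ?num_real // lerDr sqr_ge0.
Qed.

Lemma nr_le_ReIm z : nr z <= `|complex.Re z| + `|complex.Im z|.
Proof.
rewrite -(@ler_pXn2r _ 2) // ?nnegrE ?nr_ge0 ?addr_ge0 //.
rewrite nrE2 sqrrD !real_normK ?num_real //.
have : 0 <= `|complex.Re z| * `|complex.Im z| by rewrite mulr_ge0.
lra.
Qed.

End Norm.

(** * The complex exponential *)

Section RealBounds.
Context {R : realType}.
Implicit Types x : R.

(** [1 + x <= expR x] bounds the difference from below, and applied to [- x] it gives
    [expR x <= 1 / (1 - x)]. *)
Lemma expR_quad x : `|x| <= 2^-1 -> `|expR x - 1 - x| <= 2 * `|x| ^+ 2.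
Proof.
move=> xh; have xh2 : -2^-1 <= x <= 2^-1 by rewrite -ler_norml.
have h1 := expR_ge1Dx x; have h2 := expR_ge1Dx (- x).
rewrite ger0_norm; last by lra.
have e0 := expR_gt0 x.
have : expR x * (1 - x) <= 1.
  by rewrite -[leRHS](expRxMexpNx_1 x) ler_pM2l //; lra.
rewrite real_normK ?num_real // => h3.
have : expR x <= 1 + x + 2 * x ^+ 2; last lra.
have x1 : 0 < 1 - x by lra.
rewrite -(ler_pM2r x1); apply: (le_trans h3).
have -> : (1 + x + 2 * x ^+ 2) * (1 - x) = 1 + x ^+ 2 * (1 - 2 * x) by ring.
by rewrite lerDl mulr_ge0 ?sqr_ge0 //; lra.
Qed.

Lemma abs_sin_le x : `|sin x| <= `|x|.
Proof.
wlog x0 : x / 0 < x => [H|].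
  have [xn||->] := ltgtP x 0; [|exact: H|by rewrite sin0].
  by rewrite -normrN -sinN -[leRHS]normrN H // oppr_gt0.
have [c _] := @MVT R sin cos 0 x x0 (fun y _ => is_derive_sin y)
  (continuous_subspaceT (@continuous_sin R)).
rewrite sin0 !subr0 => ->; rewrite normrM ler_piMl //; exact: cos_max.
Qed.

Lemma cos_quad x : `|cos x - 1| <= `|x| ^+ 2 / 2.
Proof.
have := cos_mulr2n (x / 2); have -> : x / 2 *+ 2 = x by rewrite mulr2n; lra.
move=> ->.
have := cos2Dsin2 (x / 2) => h.
have -> : cos (x / 2) ^+ 2 *+ 2 - 1 - 1 = - (2 * sin (x / 2) ^+ 2).
  by rewrite mulr2n; lra.
rewrite normrN normrM (ger0_norm (_ : 0 <= 2)) // normrX.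
have h2 := abs_sin_le (x / 2).
have : `|sin (x / 2)| ^+ 2 <= `|x / 2| ^+ 2 by rewrite ler_pXn2r ?nnegrE.
rewrite normrM (ger0_norm (_ : 0 <= 2^-1)) //; nra.
Qed.

Lemma sin_quad x : `|x| <= 2^-1 -> `|sin x - x| <= `|x| ^+ 2 / 4.
Proof.
wlog x0 : x / 0 < x => [H xh|xh].
  have [xn|x0|->] := ltgtP x 0; [|exact: H|]; last first.
    by rewrite sin0 subr0 normr0 expr0n mul0r.
  rewrite -normrN opprD -sinN -[`|x|]normrN H // ?oppr_gt0 //; by rewrite normrN.
have [c c0x] := @MVT R sin cos 0 x x0 (fun y _ => is_derive_sin y)
  (continuous_subspaceT (@continuous_sin R)).
rewrite sin0 !subr0 => ->.
move: c0x; rewrite in_itv /= => /andP[c0 cx].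
have -> : cos c * x - x = (cos c - 1) * x by ring.
rewrite normrM.
have h1 := cos_quad c; move: xh; rewrite (gtr0_norm x0) => xh.
rewrite (gtr0_norm c0) in h1.
have h2 : c ^+ 2 <= x ^+ 2 by rewrite ler_pXn2r ?nnegrE //; lra.
nra.
Qed.
End RealBounds.

Section Cexp.
Context {R : realType}.
Local Notation C := R[i].
Implicit Types z w : C.

Definition cexp (z : C) : C :=
  (expR (complex.Re z))%:C * (cos (complex.Im z) +i* sin (complex.Im z)).

Lemma cexp0 : cexp 0 = 1.
Proof. by rewrite /cexp /= expR0 cos0 sin0 mul1r. Qed.

Lemma cexpD z w : cexp (z + w) = cexp z * cexp w.
Proof.
case: z => a b; case: w => c d; rewrite /cexp /=.
rewrite expRD sinD cosD RCM; simpc; congr (_ +i* _); ring.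
Qed.

Lemma nr_cexp z : nr (cexp z) = expR (complex.Re z).
Proof.
rewrite /cexp nrM nr_real (ger0_norm (expR_ge0 _)).
rewrite -[RHS]mulr1; congr (_ * _); apply/eqP.
by rewrite -(@pexpr_eq1 _ _ 2) ?nr_ge0 // nrE2 /= cos2Dsin2.
Qed.

Lemma cexp_neq0 z : cexp z != 0.
Proof. by rewrite -nr_eq0 nr_cexp gt_eqF // expR_gt0. Qed.

Lemma cexpN z : cexp (- z) = (cexp z)^-1.
Proof.
by apply: (mulIf (cexp_neq0 z)); rewrite -cexpD addNr cexp0 mulVf ?cexp_neq0.
Qed.

Lemma cexpMn z n : cexp (n%:R * z) = cexp z ^+ n.
Proof.
elim: n => [|n IH]; first by rewrite mul0r cexp0.
by rewrite -natr1 mulrDl mul1r cexpD IH exprSr.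
Qed.

(** The derivative, the expansions of the flows and the polynomial approximation of
    the exponential all come from this bound and from [cexpD]. *)
Lemma cexp_quad z : nr z <= 2^-1 -> nr (cexp z - 1 - z) <= 5 * nr z ^+ 2.
Proof.
move=> zh; set n := nr z in zh *; have n0 : 0 <= n := nr_ge0 z.
have a_le : `|complex.Re z| <= n := Re_le_nr z.
have b_le : `|complex.Im z| <= n.
  rewrite -(@ler_pXn2r _ 2) // ?nnegrE // nrE2 real_normK ?num_real //.
  by rewrite lerDr sqr_ge0.
rewrite /cexp; move: a_le b_le; case: z @n zh n0 => a b n zh n0 /= a_le b_le.
pose r1 := expR a - 1 - a; pose r2 : C := (cos b - 1) +i* (sin b - b).
pose u : C := cos b +i* sin b.
have -> : (expR a)%:C * (cos b +i* sin b) - 1 - (a +i* b) =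
   a%:C * (0 +i* b) + (1 + a%:C) * r2 + r1%:C * u.
  by rewrite /r1 /r2 /u; simpc; congr (_ +i* _); ring.
have nu : nr u = 1.
  by apply/eqP; rewrite -(@pexpr_eq1 _ _ 2) ?nr_ge0 // nrE2 /= cos2Dsin2.
have h1 : nr (a%:C * (0 +i* b) : C) <= n ^+ 2.
  have hb : nr (0 +i* b : C) <= n.
    by apply: (le_trans (nr_le_ReIm _)); rewrite /= normr0 add0r.
  by rewrite nrM nr_real expr2 (ler_pM (normr_ge0 _) (nr_ge0 _) a_le hb).
have sq_le (t : R) : `|t| <= n -> `|t| ^+ 2 <= n ^+ 2.
  by move=> tn; rewrite ler_pXn2r ?nnegrE.
have h2 : nr r2 <= 3 / 4 * n ^+ 2.
  apply: (le_trans (nr_le_ReIm _)) => /=.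
  have c := cos_quad b; have s := sin_quad (le_trans b_le zh).
  have := sq_le b b_le; lra.
have h3 : `|r1| <= 2 * n ^+ 2.
  have := expR_quad (le_trans a_le zh); have := sq_le a a_le; rewrite /r1; lra.
have h4 : nr (1 + a%:C : C) <= 3 / 2.
  by apply: (le_trans (nrD _ _)); rewrite nr1 nr_real; lra.
apply: (le_trans (nrD _ _)); rewrite [nr (r1%:C * u)]nrM nu mulr1 nr_real.
have h5 : nr ((1 + a%:C) * r2) <= 9 / 8 * n ^+ 2.
  rewrite nrM; have := ler_pM (nr_ge0 _) (nr_ge0 _) h4 h2; lra.
have := nrD (a%:C * (0 +i* b) : C) ((1 + a%:C) * r2).
have : 0 <= n ^+ 2 by rewrite sqr_ge0.
lra.
Qed.

Lemma polar (c s : R) : c ^+ 2 + s ^+ 2 = 1 -> exists t, cos t = c /\ sin t = s.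
Proof.
move=> cs1.
have c1 : -1 <= c <= 1.
  by rewrite -ler_norml -(@ler_pXn2r _ 2) ?nnegrE // real_normK ?num_real // expr1n;
     have := sqr_ge0 s; lra.
have sE : Num.sqrt (1 - c ^+ 2) = `|s|.
  by rewrite -sqrtr_sqr; congr Num.sqrt; lra.
have ca : cos (acos c) = c by apply: acosK; rewrite in_itv.
have [s0|s0] := leP 0 s.
  by exists (acos c); rewrite sin_acos // sE ger0_norm.
by exists (- acos c); rewrite cosN sinN sin_acos // sE ltr0_norm // opprK.
Qed.

Lemma cexp_surj z : z != 0 -> exists w, cexp w = z.
Proof.
move=> z0; have n0 : 0 < nr z by rewrite nr_gt0.
have [a ea] := expR_total n0.
have := nrE2 z; case: z z0 n0 ea => x y z0; set n := nr _ => n0 ea /= nE.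
have [|t [ct st]] := @polar (x / n) (y / n).
  by rewrite !expr_div_n -mulrDl -nE divff // expf_neq0 // gt_eqF.
exists (a +i* t); rewrite /cexp /= ea ct st; simpc.
by congr (_ +i* _); rewrite mulrC divfK // gt_eqF.
Qed.

Definition two_pi_i : C := 0 +i* (pi *+ 2).

Lemma cexp_two_pi_i : cexp two_pi_i = 1.
Proof. by rewrite /cexp /= expR0 cos2pi sin2pi mul1r. Qed.

Lemma cexp_neq1 (t : R) : 0 < t < 1 -> cexp (t%:C * two_pi_i) != 1.
Proof.
move=> /andP[t0 t1]; apply/eqP; rewrite /cexp /two_pi_i /=.
rewrite !mul0r !mulr0 subrr addr0 expR0 mul1r => -[c1 _].
have : 0 < sin (t * pi).
  apply: sin_gt0_pi; rewrite mulr_gt0 ?pi_gt0 //=.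
  by rewrite gtr_pMl ?pi_gt0.
move: c1; rewrite mulrnAr cos_mulr2n => c1 s0.
have := cos2Dsin2 (t * pi); move: c1; rewrite mulr2n; nra.
Qed.
End Cexp.

(** * Bisection, the mean value inequality and the theorem of Goursat *)

Section Bisection.
Context {R : realType}.
Local Notation h n := ((2^-1 : R) ^+ n).

Lemma half_small (L d : R) : 0 < d -> exists n0, forall n, (n0 <= n)%N -> h n * L < d.
Proof.
move=> d0; have [n0 Hn0] : exists n, `|L| / d < n%:R.
  by exists (Num.bound (`|L| / d)); apply: archi_boundP; rewrite divr_ge0 // ltW.
exists n0 => n nn; apply: (le_lt_trans (ler_norm _)).
rewrite normrM (@ger0_norm _ (h n)) ?exprn_ge0 // exprVn mulrC ltr_pdivrMr ?exprn_gt0 //.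
rewrite mulrC -ltr_pdivrMr //; apply: (lt_trans Hn0).
by rewrite -natrX ltr_nat; apply: (leq_ltn_trans nn); apply: ltn_expl.
Qed.

Lemma half_pow_split n : h n = h n.+1 + h n.+1.
Proof. by rewrite exprS; lra. Qed.

Lemma half_pow_ge0 n : 0 <= h n. Proof. by rewrite exprn_ge0. Qed.

Lemma nested_point (s : nat -> R) : s 0%N = 0 ->
  (forall n, s n.+1 = s n \/ s n.+1 = s n + h n.+1) ->
  exists2 s', 0 <= s' <= 1 & forall n, s n <= s' <= s n + h n.
Proof.
move=> s0 Hs.
have s_le n k : s n <= s (n + k)%N.
  elim: k => [|k IH]; first by rewrite addn0.
  by apply: (le_trans IH); rewrite addnS; case: (Hs (n + k)%N) => ->;
    have := half_pow_ge0 (n + k).+1; lra.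
have s_ge n k : s (n + k)%N + h (n + k)%N <= s n + h n.
  elim: k => [|k IH]; first by rewrite addn0.
  by apply: le_trans IH; rewrite addnS; case: (Hs (n + k)%N) => ->;
    have := half_pow_split (n + k)%N; have := half_pow_ge0 (n + k).+1; lra.
pose E := [set x | exists n, x = s n].
have ubE n : ubound E (s n + h n).
  move=> _ [m ->]; have [/subnKC <-|/ltnW /subnKC <-] := leqP m n.
    by apply: (le_trans (s_le m (n - m)%N)); rewrite lerDl half_pow_ge0.
  by apply: le_trans (s_ge n (m - n)%N); rewrite lerDl half_pow_ge0.
have supE : has_sup E by split; [exists (s 0%N), 0%N|exists (s 0%N + h 0)].
have H n : s n <= sup E <= s n + h n.
  apply/andP; split; first by apply: ub_le_sup; [case: supE|exists n].
  by apply: ge_sup; [case: supE|exact: ubE].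
by exists (sup E) => //; have := H 0%N; rewrite s0 expr0 add0r.
Qed.

(** Compactness of the unit square, phrased for arguments by repeated quartering.
    One-dimensional arguments use it with [t] idle. *)
Lemma bisection (P : R -> R -> nat -> Prop) :
  (forall s t n, P s t n.+1 -> P (s + h n.+1) t n.+1 -> P s (t + h n.+1) n.+1 ->
     P (s + h n.+1) (t + h n.+1) n.+1 -> P s t n) ->
  (forall s' t', 0 <= s' <= 1 -> 0 <= t' <= 1 -> exists n0, forall n, (n0 <= n)%N ->
     forall s t, s <= s' <= s + h n -> t <= t' <= t + h n -> P s t n) ->
  P 0 0 0%N.
Proof.
move=> Pstep Ploc; apply: contrapT => nP.
pose nxt (x : nat * (R * R)) (y : R * R) :=
  [/\ y.1 = x.2.1 \/ y.1 = x.2.1 + h x.1.+1,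
      y.2 = x.2.2 \/ y.2 = x.2.2 + h x.1.+1
    & ~ P x.2.1 x.2.2 x.1 -> ~ P y.1 y.2 x.1.+1].
have /choice[f Hf] x : exists y, nxt x y.
  case: x => n [s t]; pose u := s + h n.+1; pose v := t + h n.+1.
  have [p1|p1] := pselect (P s t n.+1); last by exists (s, t); split; [left|left|].
  have [p2|p2] := pselect (P u t n.+1); last by exists (u, t); split; [right|left|].
  have [p3|p3] := pselect (P s v n.+1); last by exists (s, v); split; [left|right|].
  exists (u, v); split; [by right|by right|] => /= np p4; apply: np.
  exact: Pstep.
pose x := fix x n := if n is m.+1 then f (m, x m) else (0, 0).
have nPx n : ~ P (x n).1 (x n).2 n.
  by elim: n => [//|n IH]; have [_ _] := Hf (n, x n); apply.
have [s' s01 Hs'] := @nested_point (fun n => (x n).1) erefl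
  (fun n => let: And3 a _ _ := Hf (n, x n) in a).
have [t' t01 Ht'] := @nested_point (fun n => (x n).2) erefl
  (fun n => let: And3 _ a _ := Hf (n, x n) in a).
have [n0 /(_ n0 (leqnn _) _ _ (Hs' _) (Ht' _))] := Ploc _ _ s01 t01.
exact: nPx.
Qed.
End Bisection.

Section OneVariable.
Context {R : realType}.
Local Notation C := R[i].
Local Notation h n := ((2^-1 : R) ^+ n).

(** Differentiability on the line in a form that avoids filters. *)
Definition has_deriv (phi : C -> C) (z a : C) := forall e : R, 0 < e ->
  exists2 d : R, 0 < d & forall v, nr v < d ->
    nr (phi (z + v) - phi z - a * v) <= e * nr v.

(** Bisection also gives the mean value inequality without continuity of the
    derivative. *)
Lemma mean_value (phi : C -> C) (x v : C) (L : R) :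
  (forall s : R, 0 <= s <= 1 ->
     exists2 a, has_deriv phi (x + s%:C * v) a & nr a <= L) ->
  nr (phi (x + v) - phi x) <= L * nr v.
Proof.
move=> Hd; apply/ler_addgt0Pr => e e0.
have [v0|v0] := eqVneq v 0; first by rewrite v0 addr0 subrr nr0 mulr0 add0r ltW.
have nv : 0 < nr v by rewrite nr_gt0.
pose e' := e / nr v; have e'0 : 0 < e' by rewrite divr_gt0.
pose P (s t : R) n : Prop := nr (phi (x + (s + h n)%:C * v) - phi (x + s%:C * v))
   <= (L + e') * nr v * h n.
suff : P 0 0 0%N.
  rewrite /P add0r expr0 mul1r mul0r addr0 mulr1 mulrDl /e'.
  by rewrite divfK // gt_eqF.
apply: (bisection (P := P)) => [s t n H1 H2 _ _|s' t' s01 _].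
  apply: le_trans (nr_dist _ _ (phi (x + (s + h n.+1)%:C * v))) _.
  rewrite (half_pow_split n) addrA mulrDr [leRHS]addrC; exact: lerD.
have [a da La] := Hd _ s01.
have [d d0 Hdd] := da _ e'0.
have [n0 Hn0] := half_small (nr v) d0.
exists n0 => n nn s t /andP[ss s's] _; rewrite /P.
have hn := half_pow_ge0 (R := R) n.
have K r : s <= r <= s + h n -> nr (phi (x + r%:C * v) - phi (x + s'%:C * v))
    <= (L + e') * nr v * `|r - s'|.
  move=> /andP[sr rs].
  have -> : x + r%:C * v = x + s'%:C * v + (r - s')%:C * v.
    by rewrite -addrA -mulrDl -RCD; congr (_ + _%:C * _); ring.
  have small : nr ((r - s')%:C * v) < d.
    apply: le_lt_trans (Hn0 _ nn); rewrite nrM nr_real ler_pM2r // ler_norml.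
    by apply/andP; split; lra.
  have := nr_distl (phi (x + s'%:C * v + (r - s')%:C * v) - phi (x + s'%:C * v))
    (a * ((r - s')%:C * v)).
  have := Hdd _ small; rewrite [nr (a * _)]nrM !nrM !nr_real.
  have : nr a * (`|r - s'| * nr v) <= L * (`|r - s'| * nr v).
    by rewrite ler_wpM2r // mulr_ge0 // ltW.
  lra.
apply: le_trans (nr_dist _ _ (phi (x + s'%:C * v))) _.
rewrite [X in _ + X]nrB.
have := K (s + h n); have := K s.
rewrite (ger0_norm (_ : 0 <= s + h n - s')) ?subr_ge0 //.
rewrite (ler0_norm (_ : s - s' <= 0)) ?subr_le0 // !lexx !lerDl hn /=.
move=> /(_ isT) K1 /(_ isT) K2; apply: (le_trans (lerD K2 K1)).
by rewrite -mulrDr ler_wpM2l //; [|lra]; rewrite mulr_ge0 ?(ltW nv) //;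
  have := nr_ge0 a; lra.
Qed.

(** The left Riemann sum of [psi] on the segment from [u] to [u + a] with [2 ^ N]
    nodes, divided by [a]; the recursion makes halving a segment a computation. *)
Fixpoint rmean (psi : C -> C) (N : nat) (u a : C) : C :=
  if N is M.+1 then (rmean psi M u (a / 2) + rmean psi M (u + a / 2) (a / 2)) / 2
  else psi u.

Lemma nr_half (z : C) : nr (z / 2) = nr z / 2.
Proof. by rewrite nrM nrV nr_nat. Qed.

Lemma rmean_bound psi N u a (B : R) :
  (forall s : R, 0 <= s <= 1 -> nr (psi (u + s%:C * a)) <= B) ->
  nr (rmean psi N u a) <= B.
Proof.
elim: N u a => [|N IH] u a H /=.
  by have := H 0; rewrite mul0r addr0; apply; rewrite lexx ler01.
rewrite nr_half ler_pdivrMr // mulr_natr mulr2n.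
apply: (le_trans (nrD _ _)); apply: lerD; apply: IH => s s01.
  have -> : s%:C * (a / 2) = (s / 2)%:C * a.
    by rewrite RCM fmorphV rmorph_nat; ring.
  by apply: H; lra.
have -> : u + a / 2 + s%:C * (a / 2) = u + ((s + 1) / 2)%:C * a.
  by rewrite RCM RCD rmorph1 fmorphV rmorph_nat; ring.
by apply: H; lra.
Qed.

Lemma rmeanB psi psi' N u a :
  rmean (fun z => psi z - psi' z) N u a = rmean psi N u a - rmean psi' N u a.
Proof. by elim: N u a => [//|N IH] u a /=; rewrite !IH; ring. Qed.

Lemma rmean_affine p q N u a b :
  rmean (fun z => p + q * z) N (u + b) a = rmean (fun z => p + q * z) N u a + q * b.
Proof.
elim: N u a => [|N IH] u a /=; first by ring.
by rewrite addrAC !IH; field.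
Qed.

Lemma rmean_shift psi N u a b p q (E : R) :
  (forall s : R, 0 <= s <= 1 ->
     nr (psi (u + s%:C * a) - (p + q * (u + s%:C * a))) <= E) ->
  (forall s : R, 0 <= s <= 1 ->
     nr (psi (u + b + s%:C * a) - (p + q * (u + b + s%:C * a))) <= E) ->
  nr (rmean psi N (u + b) a - rmean psi N u a - q * b) <= E + E.
Proof.
move=> H1 H2; pose f z := p + q * z.
have -> : rmean psi N (u + b) a - rmean psi N u a - q * b =
  rmean (fun z => psi z - f z) N (u + b) a - rmean (fun z => psi z - f z) N u a.
  by rewrite !rmeanB rmean_affine; ring.
apply: (le_trans (nrD _ _)); rewrite nrN.
by apply: lerD; apply: rmean_bound.
Qed.

(** The Riemann sum of [psi] around the parallelogram with corner [w] and sides [a]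
    and [b]. *)
Definition contour psi N w a b : C :=
  a * (rmean psi N w a - rmean psi N (w + b) a)
  + b * (rmean psi N (w + a) b - rmean psi N w b).

Lemma contourS psi N w a b : contour psi N.+1 w a b =
  contour psi N w (a / 2) (b / 2) + contour psi N (w + a / 2) (a / 2) (b / 2)
  + (contour psi N (w + b / 2) (a / 2) (b / 2)
     + contour psi N (w + a / 2 + b / 2) (a / 2) (b / 2)).
Proof.
rewrite /contour /=.
have -> : w + a / 2 + a / 2 = w + a by field.
have -> : w + b / 2 + b / 2 = w + b by field.
have -> : w + a / 2 + b / 2 + b / 2 = w + b + a / 2 by field.
have -> : w + b / 2 + a / 2 = w + a / 2 + b / 2 by rewrite addrAC.
have -> : w + a / 2 + b / 2 + a / 2 = w + a + b / 2 by field.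
by field.
Qed.

(** Goursat's argument: the sums around the four quarters add up to the sum around
    the whole, and near a point of differentiability [psi] is affine up to a small
    error. Left Riemann sums are not exact on affine functions, but their errors on
    opposite sides cancel. *)
Lemma goursat psi w a b :
  (forall s t : R, 0 <= s <= 1 -> 0 <= t <= 1 ->
     exists c, has_deriv psi (w + s%:C * a + t%:C * b) c) ->
  forall e : R, 0 < e -> exists N0, forall N, (N0 <= N)%N ->
    nr (contour psi N w a b) <= e.
Proof.
move=> Hd e e0.
pose P (s t : R) n : Prop := exists N0, forall N, (N0 <= N)%N ->
  nr (contour psi N (w + s%:C * a + t%:C * b) ((h n)%:C * a) ((h n)%:C * b))
    <= e * (h n) ^+ 2.
suff [N0 HN0] : P 0 0 0%N.
  exists N0 => N NN; have := HN0 _ NN.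
  by rewrite expr0 !mul0r !addr0 !mul1r expr1n mulr1.
have half2 n : (h n)%:C / 2 = (h n.+1)%:C :> C.
  by rewrite exprSr RCM fmorphV rmorph_nat.
apply: (bisection (P := P)) => [s t n [N1 H1] [N2 H2] [N3 H3] [N4 H4]|s' t' s01 t01].
  exists (maxn (maxn N1 N2) (maxn N3 N4)).+1 => -[//|N]; rewrite ltnS !geq_max.
  move=> /andP[/andP[/H1{}H1 /H2{}H2] /andP[/H3{}H3 /H4{}H4]].
  rewrite contourS -![_ * _ / 2]mulrAC half2.
  move: H2 H3 H4; rewrite !RCD.
  have -> : w + (s%:C + (h n.+1)%:C) * a + t%:C * b = w + s%:C * a + t%:C * b + (h n.+1)%:C * a.
    by ring.
  have -> : w + s%:C * a + (t%:C + (h n.+1)%:C) * b = w + s%:C * a + t%:C * b + (h n.+1)%:C * b.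
    by ring.
  have -> : w + (s%:C + (h n.+1)%:C) * a + (t%:C + (h n.+1)%:C) * b =
     w + s%:C * a + t%:C * b + (h n.+1)%:C * a + (h n.+1)%:C * b by ring.
  move=> H2 H3 H4.
  apply: (le_trans (nrD _ _)); have := lerD (le_trans (nrD _ _) (lerD H1 H2))
    (le_trans (nrD _ _) (lerD H3 H4)).
  by move/le_trans; apply; rewrite (half_pow_split n); lra.
have [c dc] := Hd _ _ s01 t01.
set z' := _ + _ in dc.
pose L := nr a + nr b; have L0 : 0 <= L by rewrite addr_ge0 ?nr_ge0.
pose e' := e / (2 * L ^+ 2 + 1).
have den0 : 0 < 2 * L ^+ 2 + 1 by have := sqr_ge0 L; lra.
have e'0 : 0 < e' by rewrite divr_gt0.
have [d d0 Hdd] := dc _ e'0.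
have [n0 Hn0] := half_small L d0.
exists n0 => n nn s t /andP[ss s's] /andP[tt t't]; exists 0%N => N _.
have hn := half_pow_ge0 (R := R) n.
have K s1 t1 : s <= s1 <= s + h n -> t <= t1 <= t + h n ->
    nr (psi (w + s1%:C * a + t1%:C * b) -
      ((psi z' - c * z') + c * (w + s1%:C * a + t1%:C * b))) <= e' * (h n * L).
  move=> /andP[sa sb] /andP[ta tb].
  pose v := (s1 - s')%:C * a + (t1 - t')%:C * b.
  have zE : w + s1%:C * a + t1%:C * b = z' + v.
    by rewrite /v /z' !rmorphB /=; ring.
  have vn : nr v <= h n * L.
    apply: (le_trans (nrD _ _)); rewrite !nrM !nr_real mulrDr.
    by apply: lerD; apply: ler_wpM2r; rewrite ?nr_ge0 // ler_norml; lra.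
  rewrite zE.
  have -> : psi (z' + v) - (psi z' - c * z' + c * (z' + v)) = psi (z' + v) - psi z' - c * v.
    by ring.
  apply: (le_trans (Hdd _ (le_lt_trans vn (Hn0 _ nn)))).
  by rewrite ler_wpM2l // ltW.
pose u := w + s%:C * a + t%:C * b; rewrite -/u.
have pt r1 r2 : u + (r1 * h n)%:C * a + (r2 * h n)%:C * b =
    w + (s + r1 * h n)%:C * a + (t + r2 * h n)%:C * b.
  by rewrite /u !RCD; ring.
have K' r1 r2 : 0 <= r1 <= 1 -> 0 <= r2 <= 1 ->
    nr (psi (u + (r1 * h n)%:C * a + (r2 * h n)%:C * b) -
      ((psi z' - c * z') + c * (u + (r1 * h n)%:C * a + (r2 * h n)%:C * b)))
     <= e' * (h n * L).
  by move=> r11 r22; rewrite pt; apply: K; nra.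
have eqm r1 x : r1%:C * ((h n)%:C * x) = (r1 * h n)%:C * x by rewrite RCM mulrA.
have zC x : (0 : R)%:C * x = 0 :> C by rewrite rmorph0 mul0r.
have HA : nr (rmean psi N (u + (h n)%:C * b) ((h n)%:C * a)
    - rmean psi N u ((h n)%:C * a) - c * ((h n)%:C * b)) <= e' * (h n * L) + e' * (h n * L).
  apply: (@rmean_shift psi N u _ _ (psi z' - c * z') c (e' * (h n * L))) => r r01.
    rewrite eqm; have := K' r 0 r01; rewrite [0 * h n]mul0r zC addr0; apply.
    by rewrite lexx ler01.
  rewrite eqm; have := K' r 1 r01; rewrite [1 * h n]mul1r [u + _ + _]addrAC; apply.
  by rewrite lexx ler01.
have HB : nr (rmean psi N (u + (h n)%:C * a) ((h n)%:C * b)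
    - rmean psi N u ((h n)%:C * b) - c * ((h n)%:C * a)) <= e' * (h n * L) + e' * (h n * L).
  apply: (@rmean_shift psi N u _ _ (psi z' - c * z') c (e' * (h n * L))) => r r01.
    rewrite eqm; have := K' 0 r; rewrite [0 * h n]mul0r zC addr0; apply => //.
    by rewrite lexx ler01.
  rewrite eqm; have := K' 1 r; rewrite [1 * h n]mul1r; apply => //.
  by rewrite lexx ler01.
rewrite /contour.
set X := rmean _ _ (u + (h n)%:C * b) _ in HA *; set Y := rmean _ _ u _ in HA *.
set X' := rmean _ _ (u + (h n)%:C * a) _ in HB *; set Y' := rmean _ _ u _ in HB *.
have -> : (h n)%:C * a * (Y - X) + (h n)%:C * b * (X' - Y') =
  (h n)%:C * b * (X' - Y' - c * ((h n)%:C * a))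
   - (h n)%:C * a * (X - Y - c * ((h n)%:C * b)) by ring.
apply: (le_trans (nrD _ _)); rewrite nrN [nr (_ * (X' - _ - _))]nrM [nr (_ * (X - _ - _))]nrM.
have HB' := ler_wpM2l (nr_ge0 ((h n)%:C * b : C)) HB.
have HA' := ler_wpM2l (nr_ge0 ((h n)%:C * a : C)) HA.
apply: (le_trans (lerD HB' HA')).
rewrite !nrM nr_real (ger0_norm hn).
have -> : h n * nr b * (e' * (h n * L) + e' * (h n * L)) +
  h n * nr a * (e' * (h n * L) + e' * (h n * L)) = e' * (2 * L ^+ 2) * h n ^+ 2.
  by rewrite /L; ring.
rewrite ler_wpM2r ?sqr_ge0 // /e' mulrAC ler_pdivrMr // ler_pM2l //; lra.
Qed.
End OneVariable.

(** * Rules for complex derivatives *)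

Section DerivRules.
Context {R : realType}.
Local Notation C := R[i].
Implicit Types (phi psi : C -> C) (z a b : C).

Lemma has_deriv_lip phi z a : has_deriv phi z a ->
  exists2 d : R, 0 < d & forall v, nr v < d -> nr (phi (z + v) - phi z) <= (nr a + 1) * nr v.
Proof.
move=> /(_ 1 ltr01)[d d0 H]; exists d => // v vd.
have := nr_distl (phi (z + v) - phi z) (a * v).
by have := H v vd; rewrite [nr (a * v)]nrM; lra.
Qed.

Lemma has_derivM phi psi z a b : has_deriv phi z a -> has_deriv psi z b ->
  has_deriv (fun x => phi x * psi x) z (a * psi z + phi z * b).
Proof.
move=> da db e e0.
have [d1 d10 H1] := has_deriv_lip da.
pose M := nr a + nr b + nr (phi z) + nr (psi z) + 2.
have [a0 b0 p0 q0] := And4 (nr_ge0 a) (nr_ge0 b) (nr_ge0 (phi z)) (nr_ge0 (psi z)).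
have M0 : 0 < M by rewrite /M; lra.
pose e' := e / (3 * M); have e'0 : 0 < e' by rewrite divr_gt0 // mulr_gt0.
have [d2 d20 H2] := da _ e'0.
have [d3 d30 H3] := db _ e'0.
have [d5 d50 H5] := has_deriv_lip db.
pose d4 := e / (3 * M ^+ 2).
have d40 : 0 < d4 by rewrite divr_gt0 // mulr_gt0 // exprn_gt0.
exists (Num.min (Num.min d1 d2) (Num.min (Num.min d3 d5) d4)).
  by rewrite !lt_min d10 d20 d30 d40 d50.
move=> v; rewrite !lt_min => /andP[/andP[v1 v2] /andP[/andP[v3 v5] v4]].
set u := phi (z + v) - phi z; set w := psi (z + v) - psi z.
have -> : phi (z + v) * psi (z + v) - phi z * psi z - (a * psi z + phi z * b) * v =
  (u - a * v) * psi z + phi z * (w - b * v) + u * w by rewrite /u /w; ring.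
have n0 := nr_ge0 v.
have hu := H1 v v1; have hw := H5 v v5.
rewrite -/u in hu; rewrite -/w in hw.
have huw : nr u * nr w <= e / 3 * nr v.
  apply: (le_trans (ler_pM (nr_ge0 _) (nr_ge0 _) hu hw)).
  have h1 : (nr a + 1) * (nr b + 1) <= M ^+ 2 by rewrite /M; nra.
  have h2 : nr v * M ^+ 2 <= e / 3.
    rewrite -ler_pdivlMr ?exprn_gt0 // -mulrA -invfM; exact: ltW.
  have -> : (nr a + 1) * nr v * ((nr b + 1) * nr v) = (nr a + 1) * (nr b + 1) * nr v * nr v.
    by ring.
  rewrite ler_wpM2r //; apply: le_trans h2; rewrite [leRHS]mulrC ler_wpM2r //.
have h3 : e' * M = e / 3 by rewrite /e' invfM mulrA divfK // gt_eqF.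
apply: (le_trans (nrD _ _)); rewrite [nr (u * w)]nrM.
have := nrD ((u - a * v) * psi z) (phi z * (w - b * v)).
rewrite [nr ((u - a * v) * _)]nrM [nr (phi z * (_ - _))]nrM.
have k1 := ler_wpM2r q0 (H2 v v2).
have k2 := ler_wpM2l p0 (H3 v v3).
have h4 : e' * nr (psi z) <= e / 3 by rewrite -h3 ler_pM2l // /M; lra.
have h5 : e' * nr (phi z) <= e / 3 by rewrite -h3 ler_pM2l // /M; lra.
have h6 := ler_wpM2r n0 h4; have h7 := ler_wpM2r n0 h5.
rewrite -/u in k1; rewrite -/w in k2; lra.
Qed.

Lemma has_deriv_id z : has_deriv (fun x => x) z 1.
Proof.
by move=> e e0; exists 1 => // v _; have -> : z + v - z - 1 * v = 0 by [ring]; rewrite nr0 mulr_ge0 ?nr_ge0 // ltW.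
Qed.

Lemma has_deriv_cst c z : has_deriv (fun=> c) z 0.
Proof.
by move=> e e0; exists 1 => // v _; rewrite subrr mul0r subr0 nr0 mulr_ge0 ?nr_ge0 // ltW.
Qed.

Lemma has_derivX z n : exists b, has_deriv (fun x => x ^+ n) z b.
Proof.
elim: n => [|n [b IH]]; first by exists 0; apply: has_deriv_cst.
eexists; under eq_fun do rewrite exprS.
exact: has_derivM (@has_deriv_id z) IH.
Qed.

Lemma has_derivV z : z != 0 -> has_deriv (fun x => x^-1) z (- z ^- 2).
Proof.
move=> z0 e e0; have nz : 0 < nr z by rewrite nr_gt0.
pose d2 := e * nr z ^+ 3 / 2.
have d20 : 0 < d2 by rewrite divr_gt0 // mulr_gt0 // exprn_gt0.
exists (Num.min (nr z / 2) d2); first by rewrite lt_min d20 divr_gt0.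
move=> v; rewrite lt_min => /andP[v1 v2].
have n1 : nr z / 2 <= nr (z + v).
  by have := nr_distl z (z + v); rewrite opprD addNKr nrN; lra.
have nzv : 0 < nr (z + v) by lra.
have zv0 : z + v != 0 by rewrite -nr_gt0.
have -> : (z + v)^-1 - z^-1 - - z ^- 2 * v = v ^+ 2 * ((z + v)^-1 * z ^- 2).
  by field; rewrite z0 zv0.
rewrite nrM [nr ((z + v)^-1 * _)]nrM nrX !nrV nrX expr2 -mulrA [leRHS]mulrC.
apply: ler_wpM2l; first exact: nr_ge0.
rewrite -invfM ler_pdivrMr ?mulr_gt0 ?exprn_gt0 //.
have : e * nr z ^+ 2 * (nr z / 2) <= e * nr z ^+ 2 * nr (z + v).
  by rewrite ler_pM2l // mulr_gt0 // exprn_gt0.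
move: v2; rewrite /d2.
have -> : e * nr z ^+ 2 * (nr z / 2) = e * nr z ^+ 3 / 2 by ring.
by have -> : e * (nr (z + v) * nr z ^+ 2) = e * nr z ^+ 2 * nr (z + v) by [ring]; lra.
Qed.

Lemma has_deriv_comp_cexp phi w a c : has_deriv phi (c * cexp w) a ->
  has_deriv (fun x => phi (c * cexp x)) w (a * (c * cexp w)).
Proof.
move=> da e e0; set z := c * cexp w in da *.
have nz : 0 <= nr z := nr_ge0 z; have na := nr_ge0 a.
pose e' := e / 2 / (4 * nr z + 1).
have e'0 : 0 < e' by rewrite !divr_gt0 //; lra.
have [d d0 Hd] := da _ e'0.
pose d2 := d / (4 * nr z + 1); pose d3 := e / 2 / (5 * nr a * nr z + 1).
have d20 : 0 < d2 by rewrite !divr_gt0 //; lra.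
have d30 : 0 < d3 by rewrite !divr_gt0 //; have := mulr_ge0 na nz; lra.
exists (Num.min (2^-1) (Num.min d2 d3)); first by rewrite !lt_min d20 d30 invr_gt0 ltr0n.
move=> v; rewrite !lt_min => /andP[v1 /andP[v2 v3]].
have n0 := nr_ge0 v.
pose r := cexp v - 1 - v.
have hr : nr r <= 5 * nr v ^+ 2 by apply: cexp_quad; exact: ltW.
pose k := z * (v + r).
have -> : c * cexp (w + v) = z + k.
  by rewrite cexpD mulrA -/z /k /r; ring.
have hk : nr k <= 4 * nr z * nr v.
  rewrite nrM -mulrA mulrCA ler_wpM2l //.
  apply: (le_trans (nrD _ _)); apply: (le_trans (lerD (lexx _) hr)); nra.
have kd : nr k < d.
  apply: (le_lt_trans hk); move: v2; rewrite /d2 ltr_pdivlMr; last by lra.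
  by rewrite mulrC; lra.
have -> : phi (z + k) - phi z - a * z * v = (phi (z + k) - phi z - a * k) + a * z * r.
  by rewrite /k; ring.
apply: (le_trans (nrD _ _)); rewrite [nr (a * z * r)]nrM [nr (a * z)]nrM.
have h1 : e' * nr k <= e / 2 * nr v.
  apply: (le_trans (ler_wpM2l (ltW e'0) hk)); rewrite mulrA ler_wpM2r // /e'.
  by rewrite mulrAC ler_pdivrMr; [rewrite ler_pM2l ?divr_gt0 //|]; lra.
have h2 : nr a * nr z * nr r <= e / 2 * nr v.
  apply: (le_trans (ler_wpM2l (mulr_ge0 na nz) hr)).
  move: v3; rewrite /d3 ltr_pdivlMr; last by have := mulr_ge0 na nz; lra.
  have -> : nr a * nr z * (5 * nr v ^+ 2) = nr v * (5 * nr a * nr z) * nr v by ring.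
  by move=> v3; apply: ler_wpM2r => //; lra.
have := Hd _ kd; lra.
Qed.

Lemma has_deriv_cexp w : has_deriv (@cexp R) w (cexp w).
Proof.
have := has_deriv_comp_cexp (w := w) (c := 1) (@has_deriv_id _).
by under eq_fun do rewrite mul1r; rewrite !mul1r.
Qed.
End DerivRules.

(** * Means over circles *)

Section CircleMeans.
Context {R : realType}.
Local Notation C := R[i].
Implicit Types (phi psi : C -> C) (z : C).

Definition omega N : C := cexp (two_pi_i / (2 ^ N)%:R).

Definition cmean phi z N : C :=
  (\sum_(j < 2 ^ N) phi (z * omega N ^+ j)) / (2 ^ N)%:R.

Lemma pow2_neq0 N : (2 ^ N)%:R != 0 :> C.
Proof. by rewrite pnatr_eq0 -lt0n expn_gt0. Qed.

Lemma nr_two_pi_i : nr (two_pi_i : C) = pi *+ 2.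
Proof.
by rewrite /two_pi_i /nr normc_def /= expr0n add0r sqrtr_sqr ger0_norm // mulrn_wge0 // pi_ge0.
Qed.

Lemma nr_omegaX N j : nr (omega N ^+ j) = 1.
Proof.
rewrite nrX nr_cexp -(rmorph_nat (@real_complex R)) -fmorphV mulrC /two_pi_i /=.
by rewrite mul0r mulr0 subrr expR0 expr1n.
Qed.

Lemma omega_neq0 N j : omega N ^+ j != 0.
Proof. by rewrite -nr_gt0 nr_omegaX. Qed.

Lemma omegaP N : omega N ^+ (2 ^ N) = 1.
Proof. by rewrite -cexpMn mulrC divfK ?pow2_neq0 // cexp_two_pi_i. Qed.

Lemma omega_neq1 N m : (0 < m < 2 ^ N)%N -> omega N ^+ m != 1.
Proof.
move=> /andP[m0 mN]; rewrite -cexpMn.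
have -> : m%:R * (two_pi_i / (2 ^ N)%:R) = (m%:R / (2 ^ N)%:R : R)%:C * two_pi_i.
  by rewrite RCM fmorphV !rmorph_nat; ring.
apply: cexp_neq1; rewrite divr_gt0 ?ltr0n ?expn_gt0 //=.
by rewrite ltr_pdivrMr ?ltr0n ?expn_gt0 // mul1r ltr_nat.
Qed.

Lemma sum_root_unity (x : C) n : x != 1 -> x ^+ n = 1 -> \sum_(j < n) x ^+ j = 0.
Proof.
move=> x1 xn; apply/eqP; have := subrX1 x n; rewrite xn subrr => /esym/eqP.
by rewrite mulf_eq0 subr_eq0 (negbTE x1).
Qed.

Lemma sum_omega N m : (0 < m < 2 ^ N)%N -> \sum_(j < 2 ^ N) (omega N ^+ j) ^+ m = 0.
Proof.
move=> mN; under eq_bigr do rewrite exprAC.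
by apply: sum_root_unity; [exact: omega_neq1|rewrite exprAC omegaP expr1n].
Qed.

Lemma sum_omegaV N m : (0 < m < 2 ^ N)%N -> \sum_(j < 2 ^ N) (omega N ^+ j) ^- m = 0.
Proof.
move=> mN; under eq_bigr do rewrite exprAC -exprVn.
apply: sum_root_unity; first by rewrite invr_eq1 omega_neq1.
by rewrite exprVn exprAC omegaP expr1n invr1.
Qed.

Lemma cmean_bound phi z N (B : R) :
  (forall x : C, nr x = 1 -> nr (phi (z * x)) <= B) -> nr (cmean phi z N) <= B.
Proof.
move=> H; rewrite /cmean nrM nrV nr_nat ler_pdivrMr ?ltr0n ?expn_gt0 //.
apply: (le_trans (nr_sum _ _ _)).
apply: (@le_trans _ _ (\sum_(j < 2 ^ N) B)).
  by apply: ler_sum => j _; apply: H; exact: nr_omegaX.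
by rewrite sumr_const card_ord mulr_natr.
Qed.

Lemma rmeanE psi N u a : rmean psi N u a =
  (\sum_(j < 2 ^ N) psi (u + j%:R * (a / (2 ^ N)%:R))) / (2 ^ N)%:R.
Proof.
elim: N u a => [|N IH] u a.
  by rewrite /= expn0 big_ord1 mul0r addr0 divr1.
have e2 : (2 ^ N.+1)%:R = 2 * (2 ^ N)%:R :> C by rewrite expnS natrM.
have P0 := pow2_neq0 N.
have aE : a / (2 ^ N.+1)%:R = a / 2 / (2 ^ N)%:R by rewrite e2 invfM mulrA.
rewrite /= !IH aE -!mulrDl e2 invfM mulrA [in RHS]mulrAC; congr (_ / _ / _).
rewrite expnS mul2n -addnn big_split_ord /=; congr (_ + _).
apply: eq_bigr => j _; congr psi; rewrite natrD; field; exact: P0.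
Qed.

Lemma rmean_cexp phi z N :
  rmean (fun w => phi (z * cexp w)) N 0 two_pi_i = cmean phi z N.
Proof.
rewrite rmeanE /cmean; congr (_ / _); apply: eq_bigr => j _.
by rewrite add0r cexpMn.
Qed.

Lemma rmean_shift_arg psi N u c a :
  rmean psi N (c + u) a = rmean (fun w => psi (c + w)) N u a.
Proof. by elim: N u a => [//|N IH] u a /=; rewrite -addrA !IH. Qed.

(** Refining the mesh changes a mean by at most the oscillation over one mesh; thanks
    to this, limits of means need no name. *)
Lemma rmean_osc psi N M u a (eta : R) :
  (forall s t : R, 0 <= s <= 1 -> 0 <= t <= 1 -> `|s - t| <= 2^-1 ^+ N ->
     nr (psi (u + s%:C * a) - psi (u + t%:C * a)) <= eta) ->
  nr (rmean psi (N + M) u a - rmean psi N u a) <= eta.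
Proof.
elim: N u a => [|N IH] u a H.
  have -> : rmean psi (0 + M) u a - rmean psi 0 u a =
     rmean (fun z => psi z - (fun=> psi u) z) M u a.
    by rewrite rmeanB add0n /=; congr (_ - _); move: (psi u) => c; elim: M (u) (a) => //= M IH v b; rewrite -!IH; field.
  apply: rmean_bound => s s01; have := H s 0; rewrite mul0r addr0; apply => //.
    by rewrite lexx ler01.
  by rewrite subr0 expr0 ler_norml; lra.
rewrite addSn /= -mulrBl nr_half ler_pdivrMr // mulr_natr mulr2n.
rewrite opprD addrACA; apply: (le_trans (nrD _ _)).
have h2 (s : R) : s%:C * (a / 2) = (s / 2)%:C * a.
  by rewrite RCM fmorphV rmorph_nat; ring.
have h3 (s : R) : u + a / 2 + s%:C * (a / 2) = u + ((s + 1) / 2)%:C * a.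
  by rewrite RCM RCD rmorph1 fmorphV rmorph_nat; ring.
have hS' : (2^-1 : R) ^+ N.+1 = 2^-1 ^+ N / 2 by rewrite exprSr.
apply: lerD; apply: IH => s t s01 t01; rewrite ler_norml => /andP[st1 st2].
  by rewrite !h2; apply: H; rewrite ?ler_norml ?hS'; lra.
by rewrite !h3; apply: H; rewrite ?ler_norml ?hS'; lra.
Qed.

Lemma cmean_osc phi z N M (eta : R) :
  (forall x y : C, nr x = 1 -> nr y = 1 -> nr (x - y) <= 8 * 2^-1 ^+ N ->
     nr (phi (z * x) - phi (z * y)) <= eta) ->
  nr (cmean phi z (N + M) - cmean phi z N) <= eta.
Proof.
move=> H; rewrite -!rmean_cexp; apply: rmean_osc => s t s01 t01 st.
have nr1s (r : R) : nr (cexp (r%:C * (two_pi_i : C))) = 1.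
  by rewrite nr_cexp /two_pi_i /= mul0r mulr0 subrr expR0.
rewrite !add0r; apply: H => //.
have -> : s%:C * two_pi_i = t%:C * two_pi_i + (s - t)%:C * two_pi_i :> C.
  by rewrite -mulrDl -RCD; congr (_%:C * _); ring.
apply: (@le_trans _ _ (1 * nr ((s - t)%:C * (two_pi_i : C)))).
  apply: mean_value => r _; exists (cexp (t%:C * two_pi_i + r%:C * ((s - t)%:C * two_pi_i))).
    exact: has_deriv_cexp.
  by rewrite mulrA -RCM -mulrDl -RCD nr1s.
rewrite mul1r nrM nr_real nr_two_pi_i.
have p4 : (pi : R) *+ 2 <= 8.
  have /andP[_] := @pihalf_02 R; rewrite [pi *+ 2]mulr2n; lra.
rewrite mulrC; apply: ler_pM => //; by rewrite mulrn_wge0 ?pi_ge0.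
Qed.

(** [cexp] opens the annulus between the circles of [z] and [z'] into a parallelogram
    with one side [two_pi_i]. By periodicity the two sides joining the circles
    cancel, and [goursat] compares the two circles. *)
Lemma cmean_indep phi z z' : z != 0 -> z' != 0 ->
  (forall x : C, 0 < nr x <= Num.max (nr z) (nr z') -> exists a, has_deriv phi x a) ->
  forall e : R, 0 < e -> exists N0, forall N, (N0 <= N)%N ->
    nr (cmean phi z' N - cmean phi z N) <= e.
Proof.
move=> z0 z'0 Hd e e0.
have [w wE] := cexp_surj z0; have [w' w'E] := cexp_surj z'0.
pose psi v := phi (1 * cexp v).
have [|N0 HN0] := @goursat R psi w (w' - w) two_pi_i _ _ e0.
  move=> s t s01 t01.
  have [|a da] := Hd (1 * cexp (w + s%:C * (w' - w) + t%:C * two_pi_i)); last first.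
    by eexists; exact: has_deriv_comp_cexp da.
  rewrite mul1r nr_cexp expR_gt0 /= -wE -w'E !nr_cexp le_max !ler_expR.
  move: s01 => /andP[s0 s1].
  case: (w) (w') => [a b] [a' b'] /=; rewrite !mul0r !mulr0 !subr0 !addr0.
  by have [aa|aa] := leP a' a; apply/orP; [left|right]; nra.
exists N0 => N NN; apply: le_trans (HN0 _ NN).
have per v : psi (v + two_pi_i) = psi v by rewrite /psi cexpD cexp_two_pi_i mulr1.
rewrite /contour addrCA subrr addr0.
have -> : rmean psi N (w + two_pi_i) (w' - w) = rmean psi N w (w' - w).
  elim: {HN0 N0 NN} N (w) (w' - w) => [|N IH] u a /=; first exact: per.
  by rewrite [u + two_pi_i + _]addrAC !IH.
rewrite subrr mulr0 add0r nrM nr_two_pi_i.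
have E v N' : rmean psi N' v two_pi_i = cmean phi (cexp v) N'.
  rewrite -[v in LHS]addr0 rmean_shift_arg -rmean_cexp /psi.
  by congr (rmean _ _ _ _); apply/funext => u; rewrite mul1r cexpD.
rewrite !E wE w'E ler_peMl ?nr_ge0 //.
by have := @pi_ge2 R; rewrite [pi *+ 2]mulr2n; lra.
Qed.

(** The derivative [a] is nearly the mean of [phi x / x] over a small circle; that mean
    is nearly the same over the circle of radius [rho], where it is at most
    [B / rho]. *)
Lemma cauchy_estimate phi (rho B : R) a : 0 < rho ->
  (forall x : C, nr x <= rho -> exists c, has_deriv phi x c) ->
  (forall x : C, nr x <= rho -> nr (phi x) <= B) ->
  has_deriv phi 0 a -> nr a <= B / rho.
Proof.
move=> rho0 Hd HB da; apply/ler_addgt0Pr => e e0.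
have e20 : 0 < e / 2 by rewrite divr_gt0.
have [d d0 Hdd] := da _ e20.
pose t := Num.min (d / 2) rho.
have t0 : 0 < t by rewrite lt_min rho0 divr_gt0.
have td : t < d by rewrite gt_min; apply/orP; left; lra.
have trho : t <= rho by rewrite ge_min lexx orbT.
pose chi x := phi x * x^-1.
have [||x /andP[x0 xr]|N0 HN0] := @cmean_indep chi t%:C rho%:C _ _ _ _ e20.
- by rewrite -nr_gt0 nr_real gtr0_norm.
- by rewrite -nr_gt0 nr_real gtr0_norm.
- have [|c dc] := Hd x.
    by move: xr; rewrite !nr_real !gtr0_norm // le_max => /orP[/le_trans|]; first apply.
  eexists; apply: has_derivM dc (has_derivV _); by rewrite -nr_gt0.
(* with at least two nodes on the circle, the inverses of the nodes have mean zero *)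
have [N N1 XY] : exists2 N, (0 < 1 < 2 ^ N)%N &
    nr (cmean chi rho%:C N - cmean chi t%:C N) <= e / 2.
  by exists N0.+1; [rewrite /= (@ltn_exp2l 2 0)|apply: HN0; exact: leqnSn].
set X := cmean chi rho%:C N in XY; set Y := cmean chi t%:C N in XY.
have hX : nr X <= B / rho.
  apply: cmean_bound => x x1.
  have n1 : nr (rho%:C * x) = rho by rewrite nrM nr_real x1 mulr1 gtr0_norm.
  by rewrite /chi nrM nrV n1 ler_pM2r ?invr_gt0 // HB // n1.
have hY : nr (Y - a) <= e / 2.
  pose r x := phi x - phi 0 - a * x.
  have P0 := pow2_neq0 N.
  have tC0 : t%:C != 0 :> C by rewrite -nr_gt0 nr_real gtr0_norm.
  have -> : Y - a = cmean (fun x => r x * x^-1) t%:C N.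
    rewrite -[LHS]subr0.
    have <- : phi 0 * t%:C^-1 * ((\sum_(j < 2 ^ N) (omega N ^+ j) ^- 1) / (2 ^ N)%:R) = 0.
      by rewrite (sum_omegaV N1) mul0r mulr0.
    have aE : a = (\sum_(j < 2 ^ N) a) / (2 ^ N)%:R.
      by rewrite sumr_const card_ord -[a *+ _]mulr_natr mulfK.
    rewrite {1}aE /Y /cmean -mulrBl mulrA -mulrBl; congr (_ / _).
    rewrite mulr_sumr -!sumrB; apply: eq_bigr => j _.
    rewrite /chi /r expr1; have := omega_neq0 N j; set o := omega N ^+ j => o0.
    by field; rewrite tC0 o0.
  apply: cmean_bound => x x1.
  have n1 : nr (t%:C * x) = t by rewrite nrM nr_real x1 mulr1 gtr0_norm.
  have := Hdd (t%:C * x); rewrite add0r n1 => /(_ td) h.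
  by rewrite nrM nrV n1 ler_pdivrMr.
have := nr_distl a Y; rewrite nrB => h1.
have := nr_distl Y X; rewrite nrB => h2.
lra.
Qed.

Lemma conj_unit (x : C) : nr x = 1 -> x^-1 = x^*.
Proof. by move=> x1; rewrite invc_norm nrE x1 rmorph1 expr1n invr1 mul1r. Qed.

(** The mean of [phi (z * x)] against the Fejer kernel, over the roots of unity of
    order [2 ^ N], expanded into Fourier coefficients. *)
Definition fejer_sum phi z n N : C :=
  (\sum_(k < n) \sum_(l < n) cmean (fun x => phi (z * x) * (x ^+ k * x ^- l)) 1 N) / n%:R.

(** The Fejer kernel is nonnegative, its mean over the roots of unity of an order at
    least [n] is [1], and it is at most [4 / (n d ^ 2)] at distance [d] from [1]. *)
Lemma fejer phi z n N (eta d B : R) : (0 < n)%N -> (n <= 2 ^ N)%N -> 0 < d -> 0 <= eta ->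
  (forall x : C, nr x = 1 -> nr (x - 1) <= d -> nr (phi (z * x) - phi z) <= eta) ->
  (forall x : C, nr x = 1 -> nr (phi (z * x)) <= B) ->
  nr (fejer_sum phi z n N - phi z) <= eta + 8 * B / (n%:R * d ^+ 2).
Proof.
move=> n0 nP d0 eta0 Hnear HB.
pose D (x : C) := \sum_(k < n) x ^+ k.
pose F (x : C) : R := nr (D x) ^+ 2 / n%:R.
have nR0 : 0 < n%:R :> R by rewrite ltr0n.
have nC0 : n%:R != 0 :> C by rewrite pnatr_eq0 -lt0n.
have P0 := pow2_neq0 N.
have FE (x : C) : nr x = 1 -> (F x)%:C = (\sum_(k < n) \sum_(l < n) x ^+ k * x ^- l) / n%:R.
  move=> x1; rewrite /F RCM fmorphV rmorph_nat; congr (_ / _).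
  rewrite rmorphXn /= -nrE sqr_normc /D rmorph_sum mulr_suml; apply: eq_bigr => k _.
  rewrite mulr_sumr; apply: eq_bigr => l _; congr (_ * _).
  by rewrite rmorphXn /= -conj_unit // exprVn.
have F0 x : 0 <= F x by rewrite divr_ge0 ?sqr_ge0 // ltW.
have sumk (k : 'I_n) : \sum_(j < 2 ^ N) \sum_(l < n)
    (omega N ^+ j) ^+ k * (omega N ^+ j) ^- l = (2 ^ N)%:R :> C.
  rewrite exchange_big /= (bigD1 k) //= [X in _ + X]big1 ?addr0; last first.
    move=> l lk.
    have [kl|kl] : (k < l \/ l < k)%N.
      by move: lk; rewrite -val_eqE /= neq_ltn => /orP[]; [right|left].
      rewrite -[RHS](@sum_omegaV N (l - k)); last first.
        by rewrite subn_gt0 kl (leq_ltn_trans (leq_subr _ _)) // (leq_trans (ltn_ord l)).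
      apply: eq_bigr => j _; have o0 := omega_neq0 N j.
      by rewrite -{1}(subnKC (ltnW kl)) exprD invfM mulrA mulfV ?mul1r // expf_neq0.
    rewrite -[RHS](@sum_omega N (k - l)); last first.
      by rewrite subn_gt0 kl (leq_ltn_trans (leq_subr _ _)) // (leq_trans (ltn_ord k)).
    apply: eq_bigr => j _; have o0 := omega_neq0 N j.
    by rewrite -{1}(subnK (ltnW kl)) exprD mulfK // expf_neq0.
  rewrite -[RHS]mulr_natr mul1r -[RHS]mulr1 mulr_natl -[in RHS](card_ord (2 ^ N)) -sumr_const.
  by apply: eq_bigr => j _; rewrite mulfV // expf_neq0 // omega_neq0.
have sumF : \sum_(j < 2 ^ N) F (omega N ^+ j) = (2 ^ N)%:R.
  apply: (@complexI R); rewrite rmorph_sum rmorph_nat /=.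
  under eq_bigr do rewrite FE ?nr_omegaX //.
  rewrite -mulr_suml exchange_big /=; apply: (mulIf nC0); rewrite divfK //.
  under eq_bigr do rewrite sumk.
  by rewrite sumr_const card_ord mulr_natr.
have -> : fejer_sum phi z n N - phi z =
   (\sum_(j < 2 ^ N) (phi (z * omega N ^+ j) - phi z) * (F (omega N ^+ j))%:C) / (2 ^ N)%:R.
  have -> : \sum_(j < 2 ^ N) (phi (z * omega N ^+ j) - phi z) * (F (omega N ^+ j))%:C =
    \sum_(j < 2 ^ N) phi (z * omega N ^+ j) * (F (omega N ^+ j))%:C - phi z * (2 ^ N)%:R.
    rewrite -[in RHS](rmorph_nat (@real_complex R)) -sumF rmorph_sum mulr_sumr -sumrB.
    by apply: eq_bigr => j _; rewrite mulrBl.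
  rewrite mulrBl mulfK //; congr (_ - _).
  rewrite /fejer_sum /cmean.
  under eq_bigr => k _ do rewrite -mulr_suml exchange_big /=.
  rewrite -mulr_suml exchange_big mulrAC /=; congr (_ / _).
  rewrite mulr_suml; apply: eq_bigr => j _; rewrite mul1r FE ?nr_omegaX // mulrA; congr (_ / _).
  by rewrite mulr_sumr; apply: eq_bigr => k _; rewrite mulr_sumr.
set err := 8 * B / _.
rewrite nrM nrV nr_nat ler_pdivrMr ?ltr0n ?expn_gt0 //.
apply: (le_trans (nr_sum _ _ _)).
have -> : (eta + err) * (2 ^ N)%:R = \sum_(j < 2 ^ N) (eta * F (omega N ^+ j) + err).
  by rewrite big_split /= -mulr_sumr sumF sumr_const card_ord mulrDl -[err *+ _]mulr_natr.
apply: ler_sum => j _; set x := omega N ^+ j; have x1 : nr x = 1 := nr_omegaX N j.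
have B0 : 0 <= B by apply: le_trans (HB _ x1); exact: nr_ge0.
have err0 : 0 <= err by rewrite divr_ge0 ?mulr_ge0 ?sqr_ge0 // ltW.
rewrite nrM nr_real (ger0_norm (F0 _)).
have [xd|xd] := leP (nr (x - 1)) d.
  by rewrite -[leLHS]addr0; apply: lerD => //; apply: ler_wpM2r => //; exact: Hnear.
rewrite -[leLHS]add0r; apply: lerD; first by rewrite mulr_ge0.
have h1 : nr (phi (z * x) - phi z) <= 2 * B.
  apply: (le_trans (nrD _ _)); rewrite nrN; have := HB _ x1; have := HB 1 (@nr1 R).
  by rewrite mulr1; lra.
have h2 : F x <= 4 / (n%:R * d ^+ 2).
  rewrite /F ler_pdivrMr // [leRHS](_ : _ = 4 / d ^+ 2); last first.
    by field; rewrite !gt_eqF.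
  rewrite ler_pdivlMr ?exprn_gt0 // -exprMn.
  have -> : 4 = 2 ^+ 2 :> R by ring.
  rewrite ler_pXn2r ?nnegrE ?mulr_ge0 ?nr_ge0 ?(ltW d0) //.
  apply: (@le_trans _ _ (nr (D x) * nr (x - 1))); first by rewrite ler_wpM2l ?nr_ge0 // ltW.
  rewrite -nrM mulrC -subrX1; apply: (le_trans (nrD _ _)).
  by rewrite nrN nrX x1 nr1 expr1n.
apply: (le_trans (ler_pM (nr_ge0 _) (F0 _) h1 h2)).
by rewrite /err le_eqVlt; apply/orP; left; apply/eqP; ring.
Qed.
End CircleMeans.

(** * Differentiability in several variables *)

Section EpsDelta.
Context {R : realType}.
Local Notation C := R[i].

(** Balls have complex radii; every topological statement is brought to real estimates
    through this lemma. *)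
Lemma nbhs_nr (V : normedModType C) (a : V) (A : set V) :
  nbhs a A <-> exists2 d : R, 0 < d & forall x, nr (x - a) < d -> A x.
Proof.
split=> [/nbhs_normP[e /= e0 H]|[d d0 H]].
  have eE : e = (complex.Re e)%:C by rewrite RRe_real // ger0_real // ltW.
  exists (complex.Re e); first by rewrite -ltcR -eE.
  move=> x xa; apply: H => /=; rewrite eE -normrN opprB nr_ltP //.
apply/nbhs_normP; exists d%:C; first by rewrite /= ltcR.
by move=> x /= xa; apply: H; rewrite -nr_ltP -normrN opprB.
Qed.

Lemma diff_eps (V W : normedModType C) (F : V -> W) (a : V) : differentiable F a ->
  forall e : R, 0 < e -> exists2 d : R, 0 < d & forall v, nr v < d ->
    nr (F (a + v) - F a - 'd F a v) <= e * nr v.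
Proof.
move=> /diff_locallyP[_ /eqaddoP H] e e0.
have e0C : 0 < e%:C :> C by rewrite ltcR.
have /nbhs_nr[d d0 Hd] := H _ e0C; exists d => // v vd.
have := Hd v; rewrite subr0 => /(_ vd) /=.
rewrite !fctE /= [v + a]addrC (nrE v) -RCM nr_leP opprD addrA; exact.
Qed.

Lemma eps_diff (V W : normedModType C) (F : V -> W) (a : V) (L : {linear V -> W}) (M : R) :
  (forall v, nr (L v) <= M * nr v) ->
  (forall e : R, 0 < e -> exists2 d : R, 0 < d & forall v, nr v < d ->
    nr (F (a + v) - F a - L v) <= e * nr v) -> differentiable F a.
Proof.
move=> LM H.
have cL : continuous L.
  move=> x A /nbhs_nr[d d0 Hd]; apply/nbhs_nr.
  have M0 : 0 < `|M| + 1 by rewrite ltr_wpDl.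
  exists (d / (`|M| + 1)); first by rewrite divr_gt0.
  move=> y; rewrite ltr_pdivlMr // mulrC => yx; apply: Hd; rewrite -linearB.
  apply: (le_lt_trans (LM _)); apply: le_lt_trans yx.
  apply: ler_wpM2r; first exact: nr_ge0.
  by have := ler_norm M; lra.
have E : F \o shift a = cst (F a) + L +o_ 0 id.
  apply/eqaddoP => e e0.
  have eE : e = (complex.Re e)%:C by rewrite RRe_real // ger0_real // ltW.
  have [|d d0 Hd] := H (complex.Re e); first by rewrite -ltcR -eE.
  apply/nbhs_nr; exists d => // v; rewrite subr0 => /Hd; rewrite -nr_leP RCM -eE -nrE.
  by rewrite !fctE /= [v + a]addrC opprD addrA.
by apply/diff_locallyP; rewrite (diff_unique cL E).
Qed.

Lemma has_deriv_differentiable (phi : C -> C) z a : has_deriv phi z a ->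
  differentiable phi z.
Proof.
move=> H; pose f (x : C) : C := a * x.
have lf : linear f by move=> c x y; rewrite /f /GRing.scale /=; ring.
pose fM := GRing.isLinear.Build _ _ _ _ _ lf.
pose L : {linear C -> C} := HB.pack f fM.
apply: (@eps_diff _ _ _ _ L (nr a)); last exact: H.
by move=> v; rewrite /= /f nrM.
Qed.

End EpsDelta.

Section Completeness.
Context {R : realType}.
Local Notation C := R[i].

Lemma cauchy_real (u : nat -> R) :
  (forall e : R, 0 < e -> exists n0, forall n m, (n0 <= n)%N -> (n0 <= m)%N -> `|u n - u m| <= e) ->
  exists L, forall e : R, 0 < e -> exists n0, forall n, (n0 <= n)%N -> `|u n - L| <= e.
Proof.
move=> H; have cu : cvg (u @ \oo).
  apply/cauchy_cvgP/cauchy_exP => e e0; have [|n0 H0] := H (e / 2); first by rewrite divr_gt0.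
  exists (u n0); exists n0 => // n /= nn; rewrite -ball_normE /= distrC.
  by apply: le_lt_trans (H0 n n0 nn (leqnn _)) _; lra.
exists (lim (u @ \oo)) => e e0.
have /cvgrPdist_le /(_ e e0)[n0 _ Hn0] : u @ \oo --> lim (u @ \oo) by [].
by exists n0 => n /Hn0; rewrite distrC.
Qed.

Lemma cauchy_complex (u : nat -> C) :
  (forall e : R, 0 < e -> exists n0, forall n m, (n0 <= n)%N -> (n0 <= m)%N -> nr (u n - u m) <= e) ->
  exists L, forall e : R, 0 < e -> exists n0, forall n, (n0 <= n)%N -> nr (u n - L) <= e.
Proof.
move=> H.
have ImB (x y : C) : complex.Im (x - y) = complex.Im x - complex.Im y by case: x y => [? ?] [].
have ReB (x y : C) : complex.Re (x - y) = complex.Re x - complex.Re y by case: x y => [? ?] [].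
have [|a Ha] := @cauchy_real (fun n => complex.Re (u n)).
  move=> e /H[n0 H0]; exists n0 => n m nn mm.
  by rewrite -ReB; apply: le_trans (Re_le_nr _) (H0 _ _ nn mm).
have [|b Hb] := @cauchy_real (fun n => complex.Im (u n)).
  move=> e /H[n0 H0]; exists n0 => n m nn mm.
  by rewrite -ImB; apply: le_trans (Im_le_nr _) (H0 _ _ nn mm).
exists (a +i* b) => e e0; have e20 : 0 < e / 2 by rewrite divr_gt0.
have [n1 H1] := Ha _ e20; have [n2 H2] := Hb _ e20.
exists (maxn n1 n2) => n; rewrite geq_max => /andP[/H1{}H1 /H2{}H2].
by apply: (le_trans (nr_le_ReIm _)); rewrite ReB ImB /=; lra.
Qed.
End Completeness.

Section RowVectors.
Context {R : realType} {k : nat}.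
Local Notation C := R[i].
Local Notation V := 'rV[C]_k.
Implicit Types (F G : V -> C) (a x y v : V).

Lemma nr_coord v i : nr (v 0 i) <= nr v.
Proof.
rewrite -nr_leP -nrE [leRHS]/Num.Def.normr /= mx_normE -[leLHS]nngE num_le.
exact: (le_bigmax _ (fun ij => `|v ij.1 ij.2|%:nng) (0, i)).
Qed.

Lemma nr_rv_le v (B : R) : 0 <= B -> (forall i, nr (v 0 i) <= B) -> nr v <= B.
Proof.
move=> B0 H; rewrite -nr_leP [leLHS]/Num.Def.normr /= mx_normE.
have B0C : 0 <= B%:C :> C by rewrite lecR.
rewrite -[leRHS]/((NngNum B0C)%:num) num_le; apply/bigmax_leP; split.
  by rewrite -num_le.
by move=> [i j] _; rewrite -num_le /= ord1 nr_leP.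
Qed.

(** The differential of a scalar function, given by its partial derivatives [l]: limits
    of differentials are then limits of finitely many numbers. *)
Definition gderiv F a (l : 'I_k -> C) := forall e : R, 0 < e ->
  exists2 d : R, 0 < d & forall v, nr v < d ->
    nr (F (a + v) - F a - \sum_i v 0 i * l i) <= e * nr v.

Lemma nr_dot v (l : 'I_k -> C) : nr (\sum_i v 0 i * l i) <= (\sum_i nr (l i)) * nr v.
Proof.
apply: (le_trans (nr_sum _ _ _)); rewrite mulr_suml; apply: ler_sum => i _.
by rewrite nrM mulrC ler_wpM2l ?nr_ge0 ?nr_coord.
Qed.

Lemma rv_basis v : v = \sum_i v 0 i *: delta_mx 0 i.
Proof. exact: row_sum_delta. Qed.

Lemma diff_gderiv F a : differentiable F a -> exists l, gderiv F a l.
Proof.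
move=> H; exists (fun i => 'd F a (delta_mx 0 i)) => e /(diff_eps H)[d d0 Hd].
exists d => // v /Hd; rewrite [v in 'd F a v]rv_basis linear_sum.
by under eq_bigr do rewrite linearZ.
Qed.

Lemma gderiv_diff F a l : gderiv F a l -> differentiable F a.
Proof.
move=> H; pose f v := \sum_i v 0 i * l i.
have lf : linear f.
  move=> c x y; rewrite /f /GRing.scale /= mulr_sumr -big_split /=.
  by apply: eq_bigr => i _; rewrite !mxE mulrDl mulrA.
pose fM := GRing.isLinear.Build _ _ _ _ _ lf.
pose L : {linear V -> C} := HB.pack f fM.
exact: (@eps_diff _ _ _ _ _ L _ (fun v => nr_dot v l) H).
Qed.

Lemma diff_coord (W : normedModType C) (F : W -> V) (p : W) :
  differentiable F p -> forall i, differentiable (fun z => F z 0 i) p.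
Proof.
move=> H i; apply: (differentiable_comp (g := fun v : V => v 0 i)) => //.
exact: differentiable_coord.
Qed.
End RowVectors.

Lemma diff_rv {R : realType} {k m : nat} (F : 'rV[R[i]]_k -> 'rV[R[i]]_m) a :
  (forall j, differentiable (fun z => F z 0 j) a) -> differentiable F a.
Proof.
move=> H; have /choice[L HL] j := diff_gderiv (H j).
pose f (v : 'rV[R[i]]_k) := \row_j \sum_i v 0 i * L j i.
have lf : linear f.
  move=> c x y; apply/rowP => j; rewrite !mxE mulr_sumr -big_split /=.
  by apply: eq_bigr => i _; rewrite !mxE mulrDl mulrA.
pose fM := GRing.isLinear.Build _ _ _ _ _ lf.
pose Lf : {linear 'rV[R[i]]_k -> 'rV[R[i]]_m} := HB.pack f fM.
pose M : R := \sum_j \sum_i nr (L j i).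
have Mi j : \sum_i nr (L j i) <= M.
  rewrite /M (bigD1 j) //= lerDl; apply: sumr_ge0 => ? _; apply: sumr_ge0 => ? _; exact: nr_ge0.
have M0 : 0 <= M by apply: sumr_ge0 => ? _; apply: sumr_ge0 => ? _; exact: nr_ge0.
apply: (@eps_diff _ _ _ _ _ Lf M) => [v|e e0].
  apply: nr_rv_le => [|j]; first by rewrite mulr_ge0 ?nr_ge0.
  rewrite mxE; apply: (le_trans (nr_dot _ _)); apply: ler_wpM2r => //; exact: nr_ge0.
have /choice[d Hd] j : exists d : R, 0 < d /\ forall v, nr v < d ->
    nr (F (a + v) 0 j - F a 0 j - \sum_i v 0 i * L j i) <= e * nr v.
  by have [d d0 Hd] := HL j e e0; exists d.
exists (\big[Num.min/1]_j d j).
  by apply: lt_bigmin => // j _; have [] := Hd j.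
move=> v vd; apply: nr_rv_le => [|j]; first by rewrite mulr_ge0 ?nr_ge0 // ltW.
rewrite !mxE; apply: (Hd j).2; apply: (lt_le_trans vd); exact: bigmin_le_cond.
Qed.

(** * Lipschitz estimates and the theorem of Weierstrass *)

Section Weierstrass.
Context {R : realType} {k : nat}.
Local Notation C := R[i].
Local Notation V := 'rV[C]_k.
Implicit Types (F G : V -> C) (a x y v : V).

Lemma gderiv_line F x v (s : C) l : gderiv F (x + s *: v) l ->
  has_deriv (fun t => F (x + t *: v)) s (\sum_i v 0 i * l i).
Proof.
move=> H e e0; have v0 := nr_ge0 v.
have v1 : 0 < nr v + 1 by lra.
have e'0 : 0 < e / (nr v + 1) by rewrite divr_gt0.
have [d d0 Hd] := H _ e'0; exists (d / (nr v + 1)); first by rewrite divr_gt0.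
move=> t; rewrite ltr_pdivlMr // => td.
have tn : nr (t *: v) <= nr t * (nr v + 1).
  by rewrite nrZ ler_wpM2l ?nr_ge0 //; lra.
have -> : (\sum_i v 0 i * l i) * t = \sum_i (t *: v) 0 i * l i.
  by rewrite mulr_suml; apply: eq_bigr => i _; rewrite mxE; ring.
rewrite scalerDl addrA; apply: (le_trans (Hd _ (le_lt_trans tn td))).
rewrite mulrAC ler_pdivrMr // -mulrA ler_pM2l //.
Qed.

(** [cauchy_estimate] on the complex line through [a] in the direction of [v]. *)
Lemma cauchy_rv F a (r B : R) l v : 0 < r ->
  (forall x, nr (x - a) < r -> differentiable F x) ->
  (forall x, nr (x - a) < r -> nr (F x) <= B) ->
  gderiv F a l -> nr (\sum_i v 0 i * l i) <= 2 * B / r * nr v.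
Proof.
move=> r0 Hd HB Hl; have [->|v0] := eqVneq v 0.
  by rewrite big1 ?nr0 ?mulr0 // => i _; rewrite mxE mul0r.
have nv : 0 < nr v by rewrite nr_gt0.
pose rho := r / 2 / nr v; have rho0 : 0 < rho by rewrite !divr_gt0.
have inb (t : C) : nr t <= rho -> nr (a + t *: v - a) < r.
  rewrite addrAC subrr add0r nrZ /rho ler_pdivlMr // => h; apply: (le_lt_trans h); lra.
have -> : 2 * B / r * nr v = B / rho by rewrite /rho !invfM !invrK; ring.
apply: (@cauchy_estimate R (fun t => F (a + t *: v)) rho B) => //.
- move=> t /inb /Hd /diff_gderiv[l' Hl']; eexists; exact: gderiv_line Hl'.
- by move=> t /inb /HB.
- by apply: gderiv_line; rewrite scale0r addr0.
Qed.

(** [mean_value] on the segment from [x] to [y], with the derivatives bounded by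
    [cauchy_rv] on balls of half the radius. *)
Lemma lipschitz_rv F a (r B : R) x y : 0 < r ->
  (forall x, nr (x - a) < r -> differentiable F x) ->
  (forall x, nr (x - a) < r -> nr (F x) <= B) ->
  nr (x - a) < r / 2 -> nr (y - a) < r / 2 ->
  nr (F y - F x) <= 4 * B / r * nr (y - x).
Proof.
move=> r0 Hd HB xa ya; pose v := y - x.
have r20 : 0 < r / 2 by rewrite divr_gt0.
have xv : x + v = y by rewrite /v addrC subrK.
have := @mean_value R (fun t : C => F (x + t *: v)) 0 1 (4 * B / r * nr v).
rewrite add0r scale1r scale0r addr0 nr1 mulr1 xv; apply => s s01.
rewrite add0r mulr1; set p := x + s%:C *: v.
have pa : nr (p - a) < r / 2.
  have -> : p - a = (1 - s)%:C *: (x - a) + s%:C *: (y - a).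
    rewrite /p /v rmorphB rmorph1 !scalerBr !scalerBl !scale1r.
    apply/rowP => j; rewrite !mxE; ring.
  move: s01 => /andP[s0 s1].
  apply: (le_lt_trans (nrD _ _)); rewrite !nrZ !nr_real !ger0_norm; [|lra..].
  set A := nr _ in xa *; set B' := nr _ in ya *.
  by have [AB|/ltW AB] := leP A B'; nra.
have near_p z : nr (z - p) < r / 2 -> nr (z - a) < r.
  by move=> zp; apply: (le_lt_trans (nr_dist _ _ p)); lra.
have pp : nr (p - p) < r / 2 by rewrite subrr nr0.
have [l Hl] := diff_gderiv (Hd p (near_p p pp)).
  exists (\sum_i v 0 i * l i); first exact: gderiv_line.
  have := @cauchy_rv F p (r / 2) B l v r20 (fun z h => Hd z (near_p z h))
    (fun z h => HB z (near_p z h)) Hl.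
  by have -> : 2 * B / (r / 2) = 4 * B / r by field; rewrite gt_eqF.
Qed.

(** Cauchy's estimate makes the differentials of a locally uniformly convergent
    sequence converge, and makes the differences of its terms Lipschitz with small
    constants; so the limit of the differentials is the differential of the
    limit. *)
Lemma weierstrass (F_ : nat -> V -> C) F a (r : R) : 0 < r ->
  (forall n x, nr (x - a) < r -> differentiable (F_ n) x) ->
  (forall e : R, 0 < e -> exists n0, forall n, (n0 <= n)%N ->
     forall x, nr (x - a) < r -> nr (F_ n x - F x) <= e) ->
  differentiable F a.
Proof.
move=> r0 Hd Hc.
have a_in : nr (a - a) < r by rewrite subrr nr0.
have /choice[l Hl] n := diff_gderiv (Hd n a a_in).
have Hcc (e : R) : 0 < e -> exists n0, forall n m, (n0 <= n)%N -> (n0 <= m)%N ->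
    forall x, nr (x - a) < r -> nr (F_ n x - F_ m x) <= e.
  move=> e0; have [|n0 H0] := Hc (e / 2); first by rewrite divr_gt0.
  exists n0 => n m nn mm x xa; have h1 := H0 n nn x xa; have h2 := H0 m mm x xa.
  by have := nr_dist (F_ n x) (F_ m x) (F x); rewrite [nr (F x - _)]nrB; lra.
have dB n m x : nr (x - a) < r -> differentiable (fun z => F_ n z - F_ m z) x.
  by move=> xa; apply: differentiableB; apply: Hd.
have lB n m : gderiv (fun z => F_ n z - F_ m z) a (fun i => l n i - l m i).
  move=> e e0; have e20 : 0 < e / 2 by rewrite divr_gt0.
  have [d1 d10 H1] := Hl n _ e20; have [d2 d20 H2] := Hl m _ e20.
  exists (Num.min d1 d2); first by rewrite lt_min d10.
  move=> v; rewrite lt_min => /andP[/H1{}H1 /H2{}H2].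
  under eq_bigr do rewrite mulrBr; rewrite sumrB.
  set A := F_ n _ in H1 *; set B := F_ n _ in H1 *; set S := \sum_i _ in H1 *.
  set A' := F_ m _ in H2 *; set B' := F_ m _ in H2 *; set S' := \sum_i _ in H2 *.
  have -> : A - A' - (B - B') - (S - S') = (A - B - S) - (A' - B' - S') by ring.
  by apply: (le_trans (nrD _ _)); rewrite nrN; lra.
have lC i (e : R) : 0 < e -> exists n0, forall n m, (n0 <= n)%N -> (n0 <= m)%N ->
    nr (l n i - l m i) <= e.
  move=> e0; have [|n0 H0] := Hcc (e * r / 2).
    by rewrite divr_gt0 // mulr_gt0.
  exists n0 => n m nn mm.
  have := @cauchy_rv _ a r (e * r / 2) _ (delta_mx 0 i) r0 (dB n m) (H0 n m nn mm) (lB n m).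
  rewrite (bigD1 i) //= mxE !eqxx mul1r big1 ?addr0; last first.
    by move=> j /negbTE ji; rewrite mxE eqxx ji mul0r.
  move=> /le_trans; apply.
  have -> : 2 * (e * r / 2) / r = e by field; rewrite gt_eqF.
  rewrite ler_piMr ?(ltW e0) //; apply: nr_rv_le => // j; rewrite mxE.
  by case: (_ && _); rewrite ?nr1 ?nr0.
have /choice[L HL] i : exists L, forall e : R, 0 < e -> exists n0, forall n, (n0 <= n)%N ->
    nr (l n i - L) <= e.
  by apply: cauchy_complex => e; exact: lC.
apply: (@gderiv_diff _ _ _ _ L) => e e0.
pose e4 := e / 4; have e40 : 0 < e4 by rewrite divr_gt0.
have [|n0 H0] := Hcc (e4 * r / 4); first by rewrite divr_gt0 // mulr_gt0.
have k0 : 0 < k%:R + 1 :> R by rewrite ltr_wpDl.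
have /choice[n1 Hn1] i : exists n1, forall n, (n1 <= n)%N -> nr (l n i - L i) <= e4 / (k%:R + 1).
  by apply: HL; rewrite divr_gt0.
pose n := maxn n0 (\max_i n1 i).
have n0n : (n0 <= n)%N by rewrite leq_maxl.
have n1n i : (n1 i <= n)%N.
  by apply: (leq_trans (leq_bigmax i)); rewrite leq_maxr.
have [d d0 Hd2] := Hl n _ e40.
exists (Num.min d (r / 2)); first by rewrite lt_min d0 divr_gt0.
move=> v; rewrite lt_min => /andP[vd vr]; have nv := nr_ge0 v.
have h1 := Hd2 v vd.
have h2 : nr (\sum_i v 0 i * l n i - \sum_i v 0 i * L i) <= e4 * nr v.
  rewrite -sumrB; under eq_bigr do rewrite -mulrBr.
  apply: (le_trans (nr_dot _ _)); apply: ler_wpM2r => //.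
  apply: (@le_trans _ _ (\sum_(i < k) e4 / (k%:R + 1))).
    by apply: ler_sum => i _; apply: Hn1.
  rewrite sumr_const card_ord -[leLHS]mulr_natr mulrAC ler_pdivrMr // ler_pM2l //; lra.
have r20 : 0 < r / 2 by rewrite divr_gt0.
have h3 : nr ((F (a + v) - F a) - (F_ n (a + v) - F_ n a)) <= 2 * e4 * nr v.
  apply/ler_addgt0Pr => e' e'0; have e'20 : 0 < e' / 2 by rewrite divr_gt0.
  have [m0 Hm0] := Hc _ e'20; pose m := maxn n0 m0.
  have vin : nr (a + v - a) < r / 2 by rewrite addrAC subrr add0r.
  have vin' : nr (a + v - a) < r by apply: (lt_trans vin); lra.
  have ain : nr (a - a) < r / 2 by rewrite subrr nr0.
  have k1 := Hm0 m (leq_maxr _ _) _ vin'.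
  have k2 := Hm0 m (leq_maxr _ _) _ a_in.
  have := @lipschitz_rv _ a r (e4 * r / 4) a (a + v) r0 (dB m n)
    (H0 m n (leq_maxl _ _) n0n) ain vin.
  have -> : 4 * (e4 * r / 4) / r = e4 by field; rewrite gt_eqF.
  rewrite [a + v - a]addrAC subrr add0r => k3.
  have -> : F (a + v) - F a - (F_ n (a + v) - F_ n a) =
    (F_ m (a + v) - F_ n (a + v) - (F_ m a - F_ n a)) -
    (F_ m (a + v) - F (a + v)) + (F_ m a - F a) by ring.
  apply: (le_trans (nrD _ _)); have := nrD (F_ m (a + v) - F_ n (a + v) - (F_ m a - F_ n a))
     (- (F_ m (a + v) - F (a + v))); rewrite nrN.
  have : 0 <= e4 * nr v by rewrite mulr_ge0 // ltW.
  lra.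
have -> : F (a + v) - F a - \sum_i v 0 i * L i =
  ((F (a + v) - F a) - (F_ n (a + v) - F_ n a)) +
  (F_ n (a + v) - F_ n a - \sum_i v 0 i * l n i) +
  (\sum_i v 0 i * l n i - \sum_i v 0 i * L i) by ring.
apply: (le_trans (nrD _ _)).
have := nrD ((F (a + v) - F a) - (F_ n (a + v) - F_ n a))
  (F_ n (a + v) - F_ n a - \sum_i v 0 i * l n i).
have e4E : e = 4 * e4 by rewrite /e4; field.
by rewrite e4E; lra.
Qed.
End Weierstrass.

(** * Compactness and the exhaustion by polyannuli *)

Section Compactness.
Context {R : realType}.
Local Notation C := R[i].

Lemma nbhs_ball_nr (V : normedModType C) (a : V) (d : R) : 0 < d ->
  nbhs a [set x | nr (x - a) < d].
Proof. by move=> d0; apply/nbhs_nr; exists d. Qed.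

(** Every passage from local to uniform statements on a compact set goes through this
    form, with [n] a rank, the inverse of a radius, or a bound. *)
Lemma compact_eventually (V : normedModType C) (K : set V) (P : nat -> V -> Prop) :
  compact K ->
  (forall x, K x -> exists2 d : R, 0 < d & exists n0, forall y, K y -> nr (y - x) < d ->
     forall n, (n0 <= n)%N -> P n y) ->
  exists n0, forall n, (n0 <= n)%N -> forall x, K x -> P n x.
Proof.
move=> /compact_near_coveringP/near_covering_withinP cK H.
have [x Kx|n0 _ Hn0] := cK nat \oo P _; last by exists n0 => n nn x Kx; apply: Hn0.
have [d d0 [n0 Hn0]] := H x Kx.
exists ([set y | nr (y - x) < d], [set n | (n0 <= n)%N]) => /=.
  by split; [exact: nbhs_ball_nr|exists n0].
by move=> [y n] /= [yx nn] Ky; exact: Hn0.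
Qed.

Lemma inv_nat_small (d : R) : 0 < d -> exists n0, forall n, (n0 <= n)%N -> n.+1%:R^-1 < d.
Proof.
move=> d0; exists (Num.bound d^-1) => n nn.
rewrite invf_plt ?posrE // (lt_le_trans (archi_boundP _)) ?invr_ge0 ?(ltW d0) //.
by rewrite ler_nat (leq_trans nn).
Qed.

Lemma nat_large (B : R) : exists n0, forall n, (n0 <= n)%N -> B < n.+1%:R.
Proof.
exists (Num.bound `|B|) => n nn; apply: (le_lt_trans (ler_norm _)).
by rewrite (lt_le_trans (archi_boundP _)) // ler_nat (leq_trans nn).
Qed.

Lemma diff_cont_eps (V W : normedModType C) (F : V -> W) a : differentiable F a ->
  forall e : R, 0 < e -> exists2 d : R, 0 < d & forall x, nr (x - a) < d ->
    nr (F x - F a) < e.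
Proof.
move=> /differentiable_continuous Fc e e0.
by have /nbhs_nr := Fc _ (nbhs_ball_nr (F a) e0).
Qed.

Lemma compact_unif_cont (V W : normedModType C) (F : V -> W) (K : set V) : compact K ->
  (forall x, K x -> differentiable F x) ->
  forall e : R, 0 < e -> exists2 d : R, 0 < d & forall x y, K x -> K y -> nr (x - y) <= d ->
    nr (F x - F y) <= e.
Proof.
move=> cK dF e e0; pose P n x := forall y, K y -> nr (x - y) <= n.+1%:R^-1 -> nr (F x - F y) <= e.
have [|n0 Hn0] := @compact_eventually V K P cK; last first.
  by exists n0.+1%:R^-1 => [|x y Kx Ky]; [rewrite invr_gt0|exact: Hn0 (leqnn _) _ Kx y Ky].
move=> x Kx; have e20 : 0 < e / 2 by rewrite divr_gt0.
have [d d0 Hd] := diff_cont_eps (dF x Kx) e20.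
have d20 : 0 < d / 2 by rewrite divr_gt0.
exists (d / 2) => //; have [n0 Hn0] := inv_nat_small d20.
exists n0 => y Ky yx n /Hn0 nn z Kz yz.
apply: le_trans (nr_dist _ _ (F x)) _; rewrite [X in _ + X]nrB.
have h1 : nr (F y - F x) < e / 2 by apply: Hd; lra.
have h2 : nr (F z - F x) < e / 2.
  by apply: Hd; have := nr_dist z x y; rewrite [nr (z - y)]nrB; have := le_lt_trans yz nn; move: {nn yz}(nr (y - z)) => t; lra.
lra.
Qed.

Lemma compact_nr_bound (V W : normedModType C) (F : V -> W) (K : set V) : compact K ->
  (forall x, K x -> differentiable F x) ->
  exists2 B : R, 0 <= B & forall x, K x -> nr (F x) <= B.
Proof.
move=> cK dF; pose P n x := nr (F x) <= n.+1%:R.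
have [|n0 Hn0] := @compact_eventually V K P cK; last first.
  by exists n0.+1%:R => //; apply: Hn0.
move=> x Kx; have [d d0 Hd] := diff_cont_eps (dF x Kx) ltr01.
exists d => //; have [n0 Hn0] := nat_large (nr (F x) + 1).
exists n0 => y Ky yx n /Hn0 nn.
by rewrite /P; have := nr_distl (F y) (F x); have := Hd y yx; lra.
Qed.

Lemma square_compact (r : R) :
  compact [set z : C | `|complex.Re z| <= r /\ `|complex.Im z| <= r].
Proof.
pose f (p : R * R) : C := p.1 +i* p.2.
have -> : [set z : C | `|complex.Re z| <= r /\ `|complex.Im z| <= r] =
   f @` (`[- r, r]%classic `*` `[- r, r]%classic).
  apply/seteqP; split=> [[a b] /= [ar br]|_ [[a b] /= [ar br] <-]] /=.
    by exists (a, b) => //=; rewrite !in_itv /= -!ler_norml.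
  by move: ar br; rewrite !in_itv /= -!ler_norml.
apply: continuous_compact; last by apply: compact_setX; apply: segment_compact.
apply: continuous_subspaceT => -[a b]; apply/cvgrPdist_lt => e e0.
have eE : e = (complex.Re e)%:C by rewrite RRe_real // ger0_real // ltW.
set e' := complex.Re e in eE; have e'0 : 0 < e' by rewrite -ltcR -eE.
have e20 : 0 < e' / 2 by rewrite divr_gt0.
near=> p; rewrite eE nr_ltP; apply: (le_lt_trans (nr_le_ReIm _)).
have h1 : `|a - p.1| < e' / 2.
  near: p; exists (ball a (e' / 2), setT) => /=; first by split; [exact: nbhsx_ballx|exact: filterT].
  by move=> q [/= + _]; rewrite -ball_normE.
have h2 : `|b - p.2| < e' / 2.
  near: p; exists (setT, ball b (e' / 2)) => /=; first by split; [exact: filterT|exact: nbhsx_ballx].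
  by move=> q [/= _ +]; rewrite -ball_normE.
rewrite /f /=; lra.
Unshelve. all: by end_near. Qed.

Lemma annulus_compact (s r : R) : compact [set z : C | s <= nr z <= r].
Proof.
apply: (@subclosed_compact _ _ [set z : C | `|complex.Re z| <= r /\ `|complex.Im z| <= r]); [|exact: square_compact|]; last first.
  move=> z /= /andP[_ zr]; split; first exact: le_trans (Re_le_nr _) zr.
  exact: le_trans (Im_le_nr _) zr.
rewrite -[X in closed X]setCK; apply: open_closedC; rewrite openE => z /= zs.
apply/nbhs_nr; have [sz|sz] := ltP (nr z) s.
  exists (s - nr z); first by rewrite subr_gt0.
  move=> x xz /= /andP[sx _]; have := nr_distl x z; lra.
have rz : r < nr z by rewrite ltNge; apply/negP => zr; apply: zs; rewrite sz.
exists (nr z - r); first by rewrite subr_gt0.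
by move=> x xz /= /andP[_ xr]; have := nr_distl z x; rewrite nrB in xz; lra.
Qed.

End Compactness.

Section PolyAnnuli.
Context {R : realType} {k : nat}.
Local Notation C := R[i].
Local Notation V := 'rV[C]_k.
Local Notation M := (C_times_Cstar R k).

(** The compact sets on which estimates are uniform; the coordinate of index 0 may
    vanish. *)
Definition polyann (r : R) : set V :=
  [set z | forall i : 'I_k, nr (z 0 i) <= r /\ ((i : nat) != 0%N -> r^-1 <= nr (z 0 i))].

Lemma polyann_compact r : compact (polyann r).
Proof.
pose A (i : 'I_k) : set C := [set z | (if (i : nat) == 0%N then 0 else r^-1) <= nr z <= r].
have -> : polyann r = [set v : V | forall i, A i (v ord0 i)].
  apply/seteqP; split=> z Hz i; have := Hz i; rewrite /A /=.
    by case=> -> H; rewrite andbT; case: eqP H => [_ _|_]; [exact: nr_ge0|apply].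
  by move=> /andP[+ ->]; case: eqP.
by apply: rV_compact => i; apply: annulus_compact.
Qed.

Lemma polyann_sub r : 0 < r -> polyann r `<=` M.
Proof.
move=> r0 z Hz i /(Hz i).2; rewrite -nr_gt0; apply: lt_le_trans.
by rewrite invr_gt0.
Qed.

Lemma polyann_mono r s z : 0 < r -> r <= s -> polyann r z -> polyann s z.
Proof.
move=> r0 rs Hz i; have [h1 h2] := Hz i; split; first exact: le_trans h1 rs.
by move=> /h2; apply: le_trans; rewrite lef_pV2 ?posrE // (lt_le_trans r0).
Qed.

(** Room around [polyann r]: perturbations of size [1 / (2 r)] stay in a polyannulus. *)
Lemma polyann_thick r z x : 1 <= r -> polyann r z -> nr (x - z) <= (2 * r)^-1 ->
  polyann (2 * r) x.
Proof.
move=> r1 Hz xz i; have [h1 h2] := Hz i.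
have r0 : 0 < r by lra.
have hi : nr (x 0 i - z 0 i) <= (2 * r)^-1.
  by apply: le_trans xz; have := nr_coord (x - z) i; rewrite !mxE.
have e1 : (2 * r)^-1 <= 1 by rewrite invf_le1 //; lra.
split; first by have := nr_distl (x 0 i) (z 0 i); lra.
move=> /h2 h; have := nr_distl (z 0 i) (x 0 i); rewrite nrB in hi.
have -> : (2 * r)^-1 = r^-1 / 2 by rewrite invfM mulrC.
by move: hi; have -> : (2 * r)^-1 = r^-1 / 2 by [rewrite invfM mulrC]; lra.
Qed.

Lemma in_polyann z : M z -> exists2 r, 1 <= r & polyann r z.
Proof.
move=> Mz; pose f (i : 'I_k) := nr (z 0 i) + (nr (z 0 i))^-1.
have f0 i : 0 <= f i by rewrite addr_ge0 ?invr_ge0 ?nr_ge0.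
exists (1 + \sum_i f i); first by rewrite lerDl sumr_ge0.
have fi i : f i <= 1 + \sum_i f i.
  by rewrite (bigD1 i) //= addrCA lerDl addr_ge0 // sumr_ge0.
move=> i; split; first by apply: le_trans (fi i); rewrite lerDl invr_ge0 nr_ge0.
move=> /Mz z0; have nz : 0 < nr (z 0 i) by rewrite nr_gt0.
rewrite -[leRHS]invrK lef_pV2 ?posrE ?invr_gt0 //; last by rewrite (lt_le_trans _ (fi i)) // ltr_wpDl ?nr_ge0 ?invr_gt0.
by apply: le_trans (fi i); rewrite lerDr nr_ge0.
Qed.

End PolyAnnuli.

(** * Approximation by Laurent polynomials *)

Section FejerTerms.
Context {R : realType}.
Local Notation C := R[i].
Implicit Types (f : C -> C) (w x y : C).

Lemma unit_pow_lip x y n : nr x = 1 -> nr y = 1 -> nr (x ^+ n - y ^+ n) <= n%:R * nr (x - y).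
Proof.
move=> x1 y1; elim: n => [|n IH]; first by rewrite !expr0 subrr nr0 mul0r.
have -> : x ^+ n.+1 - y ^+ n.+1 = x * (x ^+ n - y ^+ n) + (x - y) * y ^+ n.
  by rewrite !exprS; ring.
apply: (le_trans (nrD _ _)); rewrite [nr (x * _)]nrM [nr (_ * y ^+ n)]nrM nrX x1 y1.
by rewrite expr1n mul1r mulr1 -natr1 mulrDl mul1r lerD2r.
Qed.

Lemma unit_powV_lip x y n : nr x = 1 -> nr y = 1 -> nr (x ^- n - y ^- n) <= n%:R * nr (x - y).
Proof.
move=> x1 y1; have x0 : x != 0 by rewrite -nr_gt0 x1.
have y0 : y != 0 by rewrite -nr_gt0 y1.
have -> : x ^- n - y ^- n = - ((x ^+ n - y ^+ n) * (x ^- n * y ^- n)).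
  by field; rewrite !expf_neq0.
rewrite nrN nrM [nr (x ^- n * _)]nrM !nrV !nrX x1 y1 !expr1n invr1 !mulr1.
exact: unit_pow_lip.
Qed.

(** The monomial of degree [l - k], positive or negative. Truncated subtraction keeps
    its value at [0] right when [k <= l], where it is a polynomial. *)
Definition mono (k l : nat) w : C := w ^+ (l - k) * w ^- (k - l).

Lemma monoE k l w : w != 0 -> mono k l w = w ^+ l * w ^- k.
Proof.
move=> w0; rewrite /mono; have [kl|/ltnW lk] := leqP k l.
  by rewrite (eqP kl) expr0 invr1 mulr1 -{2}(subnK kl) exprD mulfK // expf_neq0.
by rewrite (eqP lk) expr0 mul1r -{2}(subnKC lk) exprD invfM mulrA mulfV ?mul1r // expf_neq0.
Qed.

Definition osc_le (g : C -> C) N (eta : R) := forall x y, nr x = 1 -> nr y = 1 ->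
  nr (x - y) <= 8 * 2^-1 ^+ N -> nr (g x - g y) <= eta.

Lemma cmean1_osc (g : C -> C) N M eta : osc_le g N eta ->
  nr (cmean g 1 (N + M) - cmean g 1 N) <= eta.
Proof. by move=> H; apply: cmean_osc => x y x1 y1 xy; rewrite !mul1r; exact: H. Qed.

Definition fourier_term f w k l : C -> C := fun x => f (w * x) * (x ^+ k * x ^- l).

Lemma cmean_fourier_term f w k l N : w != 0 -> cmean (fourier_term f w k l) 1 N =
  mono k l w * cmean (fun x => f x * (x ^+ k * x ^- l)) w N.
Proof.
move=> w0; rewrite /cmean mulrA; congr (_ / _); rewrite mulr_sumr; apply: eq_bigr => j _.
rewrite mul1r /fourier_term monoE //; have := @omega_neq0 R N j; set o := omega N ^+ j => o0.
rewrite !exprMn; field.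
by rewrite (expf_neq0 _ o0) !(expf_neq0 _ w0).
Qed.

Lemma has_deriv_laurent f x c k l : x != 0 -> has_deriv f x c ->
  exists b, has_deriv (fun x => f x * (x ^+ k * x ^- l)) x b.
Proof.
move=> x0 dc; have [b1 h1] := has_derivX x k; have [b2 h2] := has_derivX x^-1 l.
have xl0 := expf_neq0 l x0.
have [b3 h3] : exists b, has_deriv (fun x : C => x ^- l) x b.
  elim: (l) => [|m [b IH]]; first by exists 0; under eq_fun do rewrite expr0 invr1; exact: has_deriv_cst.
  eexists; under eq_fun do rewrite exprSr invfM.
  exact: has_derivM IH (has_derivV x0).
by eexists; exact: has_derivM dc (has_derivM h1 h3).
Qed.

(** The Fourier coefficient of [f] on the circle of [w] is the one on the unit circle
    times a monomial in [w]: this is what turns Fejer sums into Laurent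
    polynomials. *)
Lemma fourier_term_indep f w k l N eta (c : R) : w != 0 -> nr (mono k l w) <= c ->
  (forall x, x != 0 -> exists a, has_deriv f x a) ->
  osc_le (fourier_term f w k l) N eta -> osc_le (fourier_term f 1 k l) N eta ->
  nr (cmean (fourier_term f w k l) 1 N - mono k l w * cmean (fourier_term f 1 k l) 1 N) <= (1 + c) * eta.
Proof.
move=> w0 mc Hd o1 o2; apply/ler_addgt0Pr => e e0.
have c0 : 0 <= c := le_trans (nr_ge0 _) mc.
have c1 : 0 < c + 1 by lra.
have e'0 : 0 < e / (c + 1) by rewrite divr_gt0.
pose chi x := f x * (x ^+ k * x ^- l).
have [x /andP[x0 _]|N0 HN0] := @cmean_indep R chi 1 w (oner_neq0 _) w0 _ _ e'0.
  rewrite nr_gt0 in x0; have [a da] := Hd x x0; exact: has_deriv_laurent da.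
have := HN0 (N + N0)%N (leq_addl _ _).
set X := cmean chi w _; set Y := cmean chi 1 _ => XY.
have h1 := cmean1_osc N0 o1; have h2 := cmean1_osc N0 o2.
have E1 : cmean (fourier_term f w k l) 1 (N + N0) = mono k l w * X by rewrite cmean_fourier_term.
have E2 : cmean (fourier_term f 1 k l) 1 (N + N0) = Y.
  by rewrite /Y /cmean; congr (_ / _); apply: eq_bigr => j _; rewrite /fourier_term /chi !mul1r.
rewrite E1 in h1; rewrite E2 in h2.
set A := cmean (fourier_term f w k l) 1 N in h1 *; set B := cmean (fourier_term f 1 k l) 1 N in h2 *.
set m := mono k l w in mc h1 *.
have -> : A - m * B = - (m * X - A) + m * (X - Y) + m * (Y - B) by ring.
apply: (le_trans (nrD _ _)).
have := nrD (- (m * X - A)) (m * (X - Y)).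
rewrite nrN [nr (m * (X - Y))]nrM [nr (m * (Y - B))]nrM.
have k1 : nr m * nr (X - Y) <= e.
  apply: (le_trans (ler_pM (nr_ge0 _) (nr_ge0 _) mc XY)).
  by rewrite mulrA ler_pdivrMr // mulrC ler_pM2l //; lra.
have k2 : nr m * nr (Y - B) <= c * eta by apply: ler_pM => //; exact: nr_ge0.
lra.
Qed.

(** The coefficients of negative degree of an entire function vanish, since their
    circle may be shrunk to the origin. *)
Lemma cmean_small_circle f w k l N eta :
  (forall x, exists a, has_deriv f x a) -> (l < k)%N -> (k < 2 ^ N)%N ->
  osc_le (fourier_term f w k l) N eta ->
  nr (cmean (fourier_term f w k l) 1 N) <= eta.
Proof.
move=> Hd lk kN o1; have eta0 : 0 <= eta.
  have := o1 1 1 (@nr1 R) (@nr1 R); rewrite !subrr nr0; apply.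
  by rewrite mulr_ge0 // exprn_ge0.
have [w0|w0] := eqVneq w 0.
  have -> : cmean (fourier_term f w k l) 1 N = 0.
    rewrite /cmean (_ : \sum_(j < _) _ = f 0 * \sum_(j < 2 ^ N) (omega N ^+ j) ^+ (k - l)).
      rewrite sum_omega ?mulr0 ?mul0r // subn_gt0 lk /=.
      exact: leq_ltn_trans (leq_subr _ _) kN.
    rewrite mulr_sumr; apply: eq_bigr => j _; rewrite mul1r /fourier_term w0 mul0r; congr (_ * _).
    by rewrite -{1}(subnK (ltnW lk)) exprD mulfK // expf_neq0 // omega_neq0.
  by rewrite nr0.
apply/ler_addgt0Pr => e e0.
have [a da] := Hd 0; have [d d0 Hdd] := has_deriv_lip da.
pose c := nr (mono k l w); have c0 : 0 <= c := nr_ge0 _.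
pose B := nr (f 0) + (nr a + 1); have B0 : 0 < B.
  by rewrite /B; have := nr_ge0 (f 0); have := nr_ge0 a; lra.
pose t := Num.min (Num.min (d / 2) 1) (e / 2 / ((c + 1) * B)).
have cB : 0 < (c + 1) * B by rewrite mulr_gt0 //; lra.
have t0 : 0 < t by rewrite !lt_min ltr01 !divr_gt0.
have t1 : t <= 1 by rewrite /t !ge_min lexx !orbT.
have td : t < d by rewrite !gt_min; apply/orP; left; apply/orP; left; lra.
have te : (c + 1) * (B * t) <= e / 2.
  by rewrite mulrA [_ * t]mulrC -ler_pdivlMr // /t ge_min lexx orbT.
have tC0 : t%:C != 0 :> C by rewrite -nr_gt0 nr_real gtr0_norm.
have e'0 : 0 < e / 2 / (c + 1) by rewrite !divr_gt0 //; lra.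
pose chi x := f x * (x ^+ k * x ^- l).
have [x /andP[x0 _]|N0 HN0] := @cmean_indep R chi t%:C w tC0 w0 _ _ e'0.
  rewrite nr_gt0 in x0; have [b db] := Hd x; exact: has_deriv_laurent db.
have := HN0 (N + N0)%N (leq_addl _ _).
set X := cmean chi w _; set Y := cmean chi _ _ => XY.
have h1 := cmean1_osc N0 o1.
rewrite cmean_fourier_term // -/chi -/X in h1.
have hY : nr Y <= B * t.
  apply: cmean_bound => x x1.
  have n1 : nr (t%:C * x) = t by rewrite nrM nr_real x1 mulr1 gtr0_norm.
  have x0 : t%:C * x != 0 by rewrite -nr_gt0 n1.
  rewrite /chi nrM; have -> : (t%:C * x) ^+ k * (t%:C * x) ^- l = (t%:C * x) ^+ (k - l).
    by rewrite -{1}(subnK (ltnW lk)) exprD mulfK // expf_neq0.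
  rewrite nrX n1; apply: ler_pM; rewrite ?nr_ge0 ?exprn_ge0 ?(ltW t0) //.
    have := Hdd (t%:C * x); rewrite n1 add0r => /(_ td).
    have := nr_distl (f (t%:C * x)) (f 0); rewrite /B.
    have : (nr a + 1) * t <= (nr a + 1) by rewrite ler_piMr //; have := nr_ge0 a; lra.
    lra.
  have kl : (k - l)%N = (k - l).-1.+1 by rewrite prednK // subn_gt0.
  by rewrite kl exprS ler_piMr ?(ltW t0) // exprn_ile1 // ltW.
set A := cmean _ 1 N in h1 *.
have := nr_distl A (mono k l w * X); rewrite nrB [nr (mono k l w * X)]nrM -/c.
have hX : nr X <= e / 2 / (c + 1) + B * t.
  by have := nr_distl X Y; lra.
have := ler_wpM2l c0 hX; rewrite mulrDr.
have : c * (e / 2 / (c + 1)) <= e / 2.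
  by rewrite mulrA ler_pdivrMr ?mulrDr; lra.
have : c * (B * t) <= (c + 1) * (B * t).
  by rewrite ler_wpM2r ?mulr_ge0 ?(ltW B0) ?(ltW t0) //; lra.
lra.
Qed.

(** The degenerate circle [w = 0] of [fourier_term_indep], for functions holomorphic
    at the origin. *)
Lemma cmean_center f k l N eta : (k <= l)%N -> (l < 2 ^ N)%N ->
  (forall x, exists a, has_deriv f x a) ->
  osc_le (fourier_term f 1 k l) N eta ->
  nr (cmean (fourier_term f 0 k l) 1 N - mono k l 0 * cmean (fourier_term f 1 k l) 1 N) <= eta.
Proof.
move=> kl lN Hd o1; have eta0 : 0 <= eta.
  have := o1 1 1 (@nr1 R) (@nr1 R); rewrite !subrr nr0; apply.
  by rewrite mulr_ge0 // exprn_ge0.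
move: kl; rewrite leq_eqVlt => /orP[/eqP kl|kl]; last first.
  have -> : mono k l (0 : C) = 0.
    rewrite /mono; have -> : (l - k)%N = (l - k).-1.+1 by rewrite prednK // subn_gt0.
    by rewrite exprS !mul0r.
  rewrite mul0r subr0 /cmean.
  rewrite (_ : \sum_(j < _) _ = f 0 * \sum_(j < 2 ^ N) (omega N ^+ j) ^- (l - k)).
    rewrite sum_omegaV ?mulr0 ?mul0r ?nr0 // subn_gt0 kl /=.
    exact: leq_ltn_trans (leq_subr _ _) lN.
  rewrite mulr_sumr; apply: eq_bigr => j _; rewrite mul1r /fourier_term mul0r; congr (_ * _).
  have o0 := @omega_neq0 R N j.
  by rewrite -{1}(subnKC (ltnW kl)) exprD invfM mulrA mulfV ?mul1r // expf_neq0.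
subst l; have -> : mono k k (0 : C) = 1 by rewrite /mono subnn !expr0 mul1r invr1.
have ftE w N' : cmean (fourier_term f w k k) 1 N' = cmean f w N'.
  rewrite /cmean; congr (_ / _); apply: eq_bigr => j _.
  by rewrite mul1r /fourier_term mulfV ?mulr1 // expf_neq0 // omega_neq0.
rewrite mul1r; apply/ler_addgt0Pr => e e0; have e20 : 0 < e / 2 by rewrite divr_gt0.
have [a da] := Hd 0; have [d d0 Hdd] := has_deriv_lip da.
have a1 : 0 < nr a + 1 by have := nr_ge0 a; lra.
pose t := Num.min (d / 2) (e / 2 / (nr a + 1)).
have t0 : 0 < t by rewrite !lt_min !divr_gt0.
have td : t < d by rewrite !gt_min; apply/orP; left; lra.
have te : (nr a + 1) * t <= e / 2.
  by rewrite [_ * t]mulrC -ler_pdivlMr // /t ge_min lexx orbT.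
have tC0 : t%:C != 0 :> C by rewrite -nr_gt0 nr_real gtr0_norm.
have [x /andP[x0 _]|N0 HN0] := @cmean_indep R f t%:C 1 tC0 (oner_neq0 _) _ _ e20.
  exact: Hd.
have := HN0 (N + N0)%N (leq_addl _ _); have := cmean1_osc N0 o1.
rewrite !ftE; set X := cmean f 1 (N + N0); set Y := cmean f t%:C _; set A := cmean f 1 N => h1 h2.
have -> : cmean f 0 N = f 0.
  rewrite /cmean (_ : \sum_(j < _) _ = \sum_(j < 2 ^ N) f 0).
    by rewrite sumr_const card_ord -[_ *+ _]mulr_natr mulfK // pow2_neq0.
  by apply: eq_bigr => j _; rewrite mul0r.
have hY : nr (Y - f 0) <= e / 2.
  have -> : Y - f 0 = cmean (fun x => f x - f 0) t%:C (N + N0).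
    rewrite /Y /cmean sumrB mulrBl sumr_const card_ord -[f 0 *+ _]mulr_natr.
    rewrite mulfK ?pow2_neq0 //.
  apply: cmean_bound => x x1; apply: le_trans te.
  have n1 : nr (t%:C * x) = t by rewrite nrM nr_real x1 mulr1 gtr0_norm.
  by have := Hdd (t%:C * x); rewrite n1 add0r; apply.
have -> : f 0 - A = - (Y - f 0) - (X - Y) + (X - A) by ring.
apply: (le_trans (nrD _ _)); have := nrD (- (Y - f 0)) (- (X - Y)); rewrite !nrN.
lra.
Qed.
End FejerTerms.

Section Laurent.
Context {R : realType} {k : nat}.
Local Notation C := R[i].
Local Notation V := 'rV[C]_k.
Local Notation M := (C_times_Cstar R k).
Implicit Types (phi : V -> C) (z : V) (i : 'I_k).

Definition upd z i (c : C) : V := \row_j (if j == i then c else z 0 j).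

Lemma updE z i c : upd z i c 0 i = c.
Proof. by rewrite mxE eqxx. Qed.

Lemma upd_id z i : upd z i (z 0 i) = z.
Proof. by apply/rowP => j; rewrite mxE; case: eqP => [->|]. Qed.

Lemma upd_line z i c : upd z i c = upd z i 0 + c *: delta_mx 0 i.
Proof.
by apply/rowP => j; rewrite !mxE; case: eqP => _; rewrite ?mulr1 ?mulr0 ?add0r ?addr0.
Qed.

Lemma nr_updB z i c c' : nr (upd z i c - upd z i c') <= nr (c - c').
Proof.
apply: nr_rv_le => [|j]; first exact: nr_ge0.
by rewrite !mxE; case: eqP => _ //; rewrite subrr nr0 nr_ge0.
Qed.

Lemma upd_M z i c : M z -> ((i : nat) != 0%N -> c != 0) -> M (upd z i c).
Proof. by move=> Mz c0 j j0; rewrite mxE; case: (j =P i) => [ji|_]; [apply: c0; rewrite -ji|exact: Mz]. Qed.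

Lemma upd_polyann r z i c : polyann r z ->
  nr c <= r -> ((i : nat) != 0%N -> r^-1 <= nr c) -> polyann r (upd z i c).
Proof. by move=> Kz c1 c2 j; rewrite mxE; case: eqP => [->|_]; [split|exact: Kz]. Qed.

Lemma upd_diff (c : C) i z : differentiable (fun z => upd z i c) z.
Proof.
apply: diff_rv => j; under eq_fun do rewrite mxE.
case: eqP => _; first exact: differentiable_cst.
exact: differentiable_coord.
Qed.

Lemma slice_deriv phi z i c : differentiable phi (upd z i c) ->
  exists a, has_deriv (fun c => phi (upd z i c)) c a.
Proof.
move=> H; have -> : (fun c => phi (upd z i c)) = (fun t => phi (upd z i 0 + t *: delta_mx 0 i)).
  by apply/funext => t; rewrite -upd_line.
have [l Hl] := diff_gderiv H; rewrite upd_line in Hl.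
by eexists; exact: gderiv_line Hl.
Qed.

Definition fejer_coef phi i N (a b : nat) z : C :=
  if ((i : nat) != 0%N) || (a <= b)%N
  then mono a b (z 0 i) * cmean (fourier_term (fun c => phi (upd z i c)) 1 a b) 1 N else 0.

(** Fejer summation in one coordinate, with coefficients taken on the unit circle. The
    coordinate of index 0 ranges over the whole plane, so its negative powers are
    left out. *)
Definition laurent_mean phi i n N z : C :=
  (\sum_(a < n) \sum_(b < n) fejer_coef phi i N a b z) / n%:R.

Lemma nr_mono (r : R) a b n (w : C) : 1 <= r -> (a < n)%N -> (b < n)%N ->
  nr w <= r -> ((b < a)%N -> r^-1 <= nr w) -> nr (mono a b w) <= r ^+ n.
Proof.
move=> r1 an bn wr rw; rewrite /mono nrM nrV !nrX.
have r0 : 0 < r by lra.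
have le_n m : (m <= n)%N -> r ^+ m <= r ^+ n by move=> mn; rewrite ler_weXn2l.
have [ba|ab] := ltnP b a.
  have -> : (b - a = 0)%N by apply/eqP; rewrite subn_eq0 ltnW.
  rewrite expr0 mul1r; apply: (le_trans _ (le_n (a - b)%N _)); last first.
    by rewrite (leq_trans (leq_subr _ _)) // ltnW.
  have w0 : 0 < nr w by apply: lt_le_trans (rw ba); rewrite invr_gt0.
  rewrite -exprVn lerXn2r ?nnegrE ?invr_ge0 ?nr_ge0 ?(ltW r0) //.
  by rewrite -[leRHS]invrK lef_pV2 ?posrE ?invr_gt0 //; exact: rw.
have -> : (a - b = 0)%N by apply/eqP; rewrite subn_eq0.
rewrite expr0 invr1 mulr1; apply: (le_trans _ (le_n (b - a)%N _)); last first.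
  by rewrite (leq_trans (leq_subr _ _)) // ltnW.
by rewrite lerXn2r ?nnegrE ?nr_ge0 ?(ltW r0).
Qed.

(** Fejer sums converge uniformly because [phi] is uniformly continuous on
    [polyann r], which is stable under rotation of each coordinate; uniform
    continuity also bounds the oscillations that compare coefficients on different
    circles. *)
Lemma laurent_step phi (r : R) i (e : R) : 1 <= r ->
  (forall z, M z -> differentiable phi z) -> 0 < e ->
  exists n N, forall z, polyann r z -> nr (phi z - laurent_mean phi i n N z) <= e.
Proof.
move=> r1 dphi e0; have r0 : 0 < r by lra.
have dK z : polyann r z -> differentiable phi z by move=> Kz; apply: dphi; exact: polyann_sub r0 _ Kz.
have cK := @polyann_compact R k r.
have [B B0 HB] := compact_nr_bound cK dK.
have unif := compact_unif_cont cK dK.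
have e40 : 0 < e / 4 by rewrite divr_gt0.
have [d1 d10 Hd1] := unif _ e40.
(* a rotation by [x] moves a coordinate of modulus at most [r] by [r * nr (x - 1)] *)
pose d := d1 / r; have d0 : 0 < d by rewrite divr_gt0.
have [n n0 Hn] : exists2 n, (0 < n)%N & 8 * B / (n%:R * d ^+ 2) <= e / 4.
  have [n0 Hn0] := nat_large (8 * B / d ^+ 2 / (e / 4)).
  exists n0.+1 => //; have h := ltW (Hn0 _ (leqnn _)).
  have d20 : 0 < d ^+ 2 by exact: exprn_gt0.
  rewrite !ler_pdivrMr // in h.
  have nd : 0 < n0.+1%:R * d ^+ 2 by apply: mulr_gt0; [rewrite ltr0n|exact: exprn_gt0].
  rewrite (ler_pdivrMr _ _ nd) mulrA; apply: (le_trans h).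
  by rewrite [_ * (e / 4)]mulrC.
have nR0 : 0 < n%:R :> R by rewrite ltr0n.
pose c := r ^+ n; have c1 : 1 <= c by rewrite exprn_ege1.
pose eta := e / 2 / n%:R / (1 + c).
have eta0 : 0 < eta by rewrite !divr_gt0 //; lra.
have eta20 : 0 < eta / 2 by rewrite divr_gt0.
have [d2 d20 Hd2] := unif _ eta20.
have [N nN [HN1 HN2]] : exists2 N, (n <= 2 ^ N)%N &
    r * (8 * 2^-1 ^+ N) <= d2 /\ B * ((2 * n)%:R * (8 * 2^-1 ^+ N)) <= eta / 2.
  have [N1 HN1] := half_small (8 * r) d20.
  have [N2 HN2] := half_small (8 * (B * (2 * n)%:R)) eta20.
  exists (maxn n (maxn N1 N2)).
    by apply: ltnW; apply: (leq_ltn_trans (leq_maxl _ _)); exact: ltn_expl.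
  split.
    have -> : forall x : R, r * (8 * x) = x * (8 * r) by move=> x; ring.
    by apply: ltW; apply: HN1; rewrite leq_max leq_max leqnn orbT.
  have -> : forall x : R, B * ((2 * n)%:R * (8 * x)) = x * (8 * (B * (2 * n)%:R)) by move=> x; ring.
  by apply: ltW; apply: HN2; rewrite leq_max leq_max leqnn !orbT.
exists n, N => z Kz.
have Mz : M z := polyann_sub r0 Kz.
set w := z 0 i; have [wr rw] := Kz i; rewrite -/w in wr rw.
pose f x := phi (upd z i x).
have inK (v x : C) : nr v <= r -> ((i : nat) != 0%N -> r^-1 <= nr v) -> nr x = 1 ->
    polyann r (upd z i (v * x)).
  by move=> vr rv x1; apply: upd_polyann; rewrite ?nrM ?x1 ?mulr1.
have osc (v : C) a b : nr v <= r -> ((i : nat) != 0%N -> r^-1 <= nr v) -> (a < n)%N -> (b < n)%N ->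
    osc_le (fourier_term f v a b) N eta.
  move=> vr rv an bn x y x1 y1 xy.
  have x0 : x != 0 by rewrite -nr_gt0 x1.
  rewrite /fourier_term.
  have -> : f (v * x) * (x ^+ a * x ^- b) - f (v * y) * (y ^+ a * y ^- b) =
     (f (v * x) - f (v * y)) * (x ^+ a * x ^- b) +
     f (v * y) * ((x ^+ a - y ^+ a) * x ^- b + y ^+ a * (x ^- b - y ^- b)) by ring.
  apply: (le_trans (nrD _ _)); rewrite nrM [nr (f _ * _)]nrM.
  have -> : nr (x ^+ a * x ^- b) = 1 by rewrite nrM nrV !nrX x1 !expr1n invr1 mulr1.
  rewrite mulr1 [leRHS](_ : eta = eta / 2 + eta / 2); last by field.
  apply: lerD.
    apply: Hd2; [exact: inK|exact: inK|].
    apply: (le_trans (nr_updB _ _ _ _)); rewrite -mulrBr nrM.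
    by apply: le_trans HN1; apply: ler_pM; rewrite ?nr_ge0.
  apply: le_trans HN2; apply: ler_pM; rewrite ?nr_ge0 //; first by apply: HB; exact: inK.
  apply: (le_trans (nrD _ _)); rewrite nrM [nr (y ^+ a * _)]nrM nrV !nrX x1 y1.
  rewrite !expr1n invr1 mulr1 mul1r.
  have ha := unit_pow_lip a x1 y1; have hb := unit_powV_lip b x1 y1.
  apply: (le_trans (lerD ha hb)); rewrite -mulrDl; apply: ler_pM; rewrite ?nr_ge0 //.
  by rewrite -natrD ler_nat mul2n -addnn leq_add // ltnW.
have near_fejer : nr (fejer_sum f w n N - f w) <= e / 4 + 8 * B / (n%:R * d ^+ 2).
  apply: fejer => // [|x x1 xd|x x1]; first exact: ltW.
  - rewrite -{2}[w]mulr1 /f; apply: Hd1; [exact: inK|by apply: inK => //; exact: nr1|].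
    apply: (le_trans (nr_updB _ _ _ _)); rewrite -mulrBr nrM.
    have -> : d1 = r * d by rewrite /d mulrC divfK // gt_eqF.
    by apply: ler_pM; rewrite ?nr_ge0.
  - by apply: HB; exact: inK.
have fw : f w = phi z by rewrite /f /w upd_id.
have r_inv1 : r^-1 <= nr (1 : C) by rewrite nr1 invf_le1.
have r1' : nr (1 : C) <= r by rewrite nr1.
have term a b : (a < n)%N -> (b < n)%N ->
   nr (cmean (fourier_term f w a b) 1 N - fejer_coef phi i N a b z) <= e / 2 / n%:R.
  move=> an bn; have etaE : (1 + c) * eta = e / 2 / n%:R.
    by rewrite /eta mulrC divfK // gt_eqF //; lra.
  have eta_le : eta <= e / 2 / n%:R.
    rewrite -etaE ler_peMl ?(ltW eta0) //; lra.
  have o1 := osc _ _ _ wr rw an bn.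
  have o2 := osc 1 a b r1' (fun _ => r_inv1) an bn.
  have df (i0 : (i : nat) == 0%N) x : exists a, has_deriv f x a.
    by apply: slice_deriv; apply: dphi; apply: upd_M => //; rewrite i0.
  rewrite /fejer_coef -/w -/f; case: ifPn => [ab|]; last first.
    rewrite negb_or negbK -ltnNge => /andP[i0 ba]; rewrite subr0.
    apply: le_trans eta_le; apply: cmean_small_circle => //; first exact: df.
    exact: leq_trans an nN.
  have [w0|w0] := eqVneq w 0.
    have i0 : (i : nat) == 0%N.
      by apply: contraT => /rw; rewrite w0 nr0 leNgt invr_gt0 r0.
    rewrite i0 /= in ab; rewrite w0; apply: le_trans eta_le; apply: cmean_center => //.
      exact: leq_trans bn nN.
    exact: df.
  rewrite -etaE; apply: fourier_term_indep => //.
    apply: nr_mono => // ba; apply: rw; move: ab; by rewrite leqNgt ba orbF.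
  by move=> x x0; apply: slice_deriv; apply: dphi; apply: upd_M.
have mean_le : nr (fejer_sum f w n N - laurent_mean phi i n N z) <= e / 2.
  rewrite /fejer_sum /laurent_mean -mulrBl nrM nrV nr_nat ler_pdivrMr // -sumrB.
  apply: (le_trans (nr_sum _ _ _)).
  apply: (@le_trans _ _ (\sum_(a < n) e / 2)); last by rewrite sumr_const card_ord mulr_natr.
  apply: ler_sum => a _; rewrite -sumrB; apply: (le_trans (nr_sum _ _ _)).
  apply: (@le_trans _ _ (\sum_(b < n) e / 2 / n%:R)); last first.
    by rewrite sumr_const card_ord -[leLHS]mulr_natr divfK // gt_eqF.
  by apply: ler_sum => b _; exact: term.
rewrite fw in near_fejer.
have := nr_dist (phi z) (laurent_mean phi i n N z) (fejer_sum f w n N).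
rewrite [nr (phi z - fejer_sum _ _ _ _)]nrB; lra.
Qed.

(** [laurent_step] is used for one coordinate after the other. Each use replaces a
    coordinate by roots of unity, up to Laurent monomials, so that after [k] uses
    only constants are left. [App] stands for whatever Laurent polynomials and
    their uniform limits have to satisfy. *)
Theorem laurent_approx (App : (V -> C) -> Prop) (r : R) : 1 <= r ->
  (forall c, App (fun=> c)) ->
  (forall F G, App F -> App G -> App (fun z => F z + G z)) ->
  (forall F G, App F -> App G -> App (fun z => F z * G z)) ->
  (forall i, App (fun z => z 0 i)) ->
  (forall i, (i : nat) != 0%N -> App (fun z => (z 0 i)^-1)) ->
  (forall F, (forall e : R, 0 < e -> exists2 G, App G &
      forall z, polyann r z -> nr (F z - G z) <= e) -> App F) ->
  forall phi, (forall z, M z -> differentiable phi z) -> App phi.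
Proof.
move=> r1 Acst Aadd Amul Acoord Ainv Alim.
have Asum n (F : 'I_n -> V -> C) : (forall j, App (F j)) -> App (fun z => \sum_j F j z).
  elim: n F => [|n IH] F HF.
    by under eq_fun do rewrite big_ord0; exact: Acst.
  by under eq_fun do rewrite big_ord_recl; apply: (@Aadd) => //; apply: IH.
have AX F n : App F -> App (fun z => F z ^+ n).
  move=> AF; elim: n => [|n IH]; first by under eq_fun do rewrite expr0; exact: Acst.
  by under eq_fun do rewrite exprS; exact: Amul.
have main d : forall m, (k - m <= d)%N -> forall phi, (forall z, M z -> differentiable phi z) ->
    (forall z z' : V, (forall i : 'I_k, (m <= i)%N -> z 0 i = z' 0 i) -> phi z = phi z') -> App phi.
  elim: d => [|d IH] m.
    rewrite leqn0 subn_eq0 => km phi _ Hm.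
    rewrite (_ : phi = fun=> phi 0); first exact: Acst.
    apply/funext => z; apply: Hm => i mi.
    by have := leq_trans (leq_trans (ltn_ord i) km) mi; rewrite ltnn.
  move=> kmd phi dphi Hm; have [km|mk] := leqP k m.
    by apply: (IH m) => //; move: km; rewrite -subn_eq0 => /eqP ->.
  pose i := Ordinal mk; apply: Alim => e e0.
  have [n [N HnN]] := laurent_step i r1 dphi e0.
  exists (laurent_mean phi i n N) => //.
  apply: (@Amul); last exact: Acst.
  apply: (Asum n (fun a z => \sum_(b < n) fejer_coef phi i N a b z)) => a.
  apply: (Asum n (fun b z => fejer_coef phi i N a b z)) => b.
  rewrite /fejer_coef; case: (boolP (((i : nat) != 0%N) || (a <= b)%N)) => [ab|_]; last exact: Acst.
  apply: (@Amul).
    have [ba|ba] := ltnP b a.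
      have i0 : (i : nat) != 0%N by move: ab; rewrite leqNgt ba orbF.
      apply: (@Amul); first by apply: (@AX).
      by under eq_fun do rewrite -exprVn; apply: (@AX); exact: Ainv.
    rewrite /mono (_ : (a - b = 0)%N); last by apply/eqP; rewrite subn_eq0.
    by under eq_fun do rewrite expr0 invr1 mulr1; apply: (@AX).
  apply: (@Amul); last exact: Acst.
  apply: (Asum _ (fun j z => fourier_term (fun c => phi (upd z i c)) 1 a b (1 * omega N ^+ j))) => j; apply: (@Amul); last exact: Acst.
  set c := 1 * _; have c0 : c != 0 by rewrite /c !mul1r omega_neq0.
  apply: (IH m.+1).
  - by rewrite subnS; move: kmd; case: (k - m)%N.
  - move=> z Mz; apply: (differentiable_comp (upd_diff _ _ _)); apply: dphi.
    by apply: upd_M.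
  - move=> z z' zz'; apply: Hm => i' mi'; rewrite !mxE; case: eqP => // ii'.
    apply: zz'; rewrite ltn_neqAle mi' andbT; apply/eqP => mi.
    by apply: ii'; apply: val_inj.
move=> phi dphi; apply: (main k 0%N _ phi dphi); first by rewrite subn0.
by move=> z z' zz'; congr phi; apply/rowP => i; apply: zz'.
Qed.
End Laurent.

(** * A class of entire functions *)

Section Entire.
Context {R : realType} {k : nat}.
Local Notation C := R[i].
Local Notation V := 'rV[C]_k.
Implicit Types (F G : V -> C) (z : V) (i : 'I_k).

(** Differentiability, stability under substitution and approximation by polynomials
    are proved by induction on these expressions. *)
Inductive entire_expr : (V -> C) -> Prop :=
| Ecst c : entire_expr (fun=> c)
| Ecoord i : entire_expr (fun z => z 0 i)
| Eadd F G : entire_expr F -> entire_expr G -> entire_expr (fun z => F z + G z)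
| Emul F G : entire_expr F -> entire_expr G -> entire_expr (fun z => F z * G z)
| Eexp F : entire_expr F -> entire_expr (fun z => cexp (F z)).

Definition entire_map (Phi : V -> V) := forall j, entire_expr (fun z => Phi z 0 j).

Lemma cexp_diff (w : C) : differentiable (@cexp R) w.
Proof. exact: has_deriv_differentiable (has_deriv_cexp w). Qed.

Lemma differentiable_mul F G z : differentiable F z -> differentiable G z ->
  differentiable (fun z => F z * G z) z.
Proof. exact: differentiableM. Qed.

Lemma differentiable_inv F z : differentiable F z -> F z != 0 -> differentiable (fun z => (F z)^-1) z.
Proof. exact: differentiableV. Qed.

Lemma entire_diff F z : entire_expr F -> differentiable F z.
Proof.
elim=> [c|i|{}F G _ IF _ IG|{}F G _ IF _ IG|{}F _ IF].
- exact: differentiable_cst.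
- exact: differentiable_coord.
- exact: differentiableD.
- exact: differentiable_mul.
- exact: differentiable_comp IF (cexp_diff _).
Qed.

Lemma entire_comp F Phi : entire_expr F -> entire_map Phi -> entire_expr (fun z => F (Phi z)).
Proof.
move=> EF EP; elim: EF => [c|i|{}F G _ IF _ IG|{}F G _ IF _ IG|{}F _ IF].
- exact: Ecst.
- exact: EP.
- exact: Eadd.
- exact: Emul.
- exact: Eexp.
Qed.

Lemma entire_map_comp Phi Psi : entire_map Phi -> entire_map Psi -> entire_map (Phi \o Psi).
Proof. by move=> EP EQ j; apply: (entire_comp (EP j) EQ). Qed.

Lemma entire_map_id : entire_map id.
Proof. by move=> j; exact: Ecoord. Qed.

Lemma entire_map_diff Phi z : entire_map Phi -> differentiable Phi z.
Proof. by move=> EP; apply: diff_rv => j; exact: entire_diff. Qed.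

Lemma Ecst_mul c F : entire_expr F -> entire_expr (fun z => c * F z).
Proof. by move=> EF; apply: Emul => //; exact: Ecst. Qed.

Lemma Esub F G : entire_expr F -> entire_expr G -> entire_expr (fun z => F z - G z).
Proof.
move=> EF EG; have -> : (fun z => F z - G z) = (fun z => F z + (-1) * G z).
  by apply/funext => z; rewrite mulN1r.
by apply: Eadd => //; exact: Ecst_mul.
Qed.

Lemma EX F n : entire_expr F -> entire_expr (fun z => F z ^+ n).
Proof.
move=> EF; elim: n => [|n IH]; first by under eq_fun do rewrite expr0; exact: Ecst.
by under eq_fun do rewrite exprS; exact: Emul.
Qed.

Lemma Eprod (P : pred 'I_k) : entire_expr (fun z => \prod_(i | P i) z 0 i).
Proof.
have -> : (fun z : V => \prod_(i | P i) z 0 i) =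
    (fun z => \prod_(i <- [seq i <- index_enum 'I_k | P i]) z 0 i).
  by apply/funext => z; rewrite big_filter.
elim: [seq i <- index_enum 'I_k | P i] => [|i s IH]; first by under eq_fun do rewrite big_nil; exact: Ecst.
by under eq_fun do rewrite big_cons; apply: Emul => //; exact: Ecoord.
Qed.
End Entire.

(** * First-order expansions *)

Section Jets.
Context {R : realType}.
Local Notation C := R[i].
Variable T : Type.
Variable S : set T.
Implicit Types (F G : R -> T -> C) (a b : T -> C).

(** For [z] away from [0] the right-hand side has a positive lower bound. *)
Lemma cexp_quad_bounded (B : R) : exists2 c : R, 0 <= c & forall z : C, nr z <= B ->
  nr (cexp z - 1 - z) <= c * nr z ^+ 2.
Proof.
pose c := 4 * (expR B + 1 + B) + 5.
exists (Num.max c 5); first by rewrite le_max ler0n orbT.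
move=> z zB; have [z2|z2] := leP (nr z) 2^-1.
  apply: (le_trans (cexp_quad z2)); rewrite ler_wpM2r ?sqr_ge0 //.
  by rewrite le_max lexx orbT.
have z0 := nr_ge0 z.
apply: (@le_trans _ _ (expR B + 1 + B)).
  apply: (le_trans (nrD _ _)); rewrite nrN; apply: lerD => //.
  apply: (le_trans (nrD _ _)); rewrite nrN nr1 lerD2r nr_cexp ler_expR.
  by apply: le_trans zB; apply: le_trans (Re_le_nr z); exact: ler_norm.
have e0 := expR_gt0 B.
have : 4^-1 <= nr z ^+ 2 by have -> : 4^-1 = 2^-1 ^+ 2 :> R by [field]; rewrite lerXn2r ?nnegrE // ltW.
move=> h; apply: (@le_trans _ _ (c * nr z ^+ 2)).
  by rewrite /c; nra.
by rewrite ler_wpM2r ?sqr_ge0 // le_max lexx.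
Qed.

(** Uniform first-order expansions at [e = 0]. Their calculus reduces the expansion of
    a composite of explicit maps to an identity between polynomials. *)
Definition jet F a b := exists2 c : R, 0 <= c & forall (e : R) p, `|e| <= 1 -> S p ->
  [/\ nr (a p) <= c, nr (b p) <= c & nr (F e p - a p - e%:C * b p) <= c * e ^+ 2].

Lemma jet_eq F a b a' b' : jet F a b -> (forall p, S p -> a p = a' p) ->
  (forall p, S p -> b p = b' p) -> jet F a' b'.
Proof.
move=> [c c0 H] aa bb; exists c => // e p e1 Sp; rewrite -aa // -bb //; exact: H.
Qed.

Lemma jet_cst c : jet (fun _ _ => c) (fun=> c) (fun=> 0).
Proof.
exists (nr c) => [|e p _ _]; first exact: nr_ge0.
by rewrite mulr0 subr0 subrr nr0 mulr_ge0 ?sqr_ge0 ?nr_ge0.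
Qed.

Lemma jet_base a (B : R) : 0 <= B -> (forall p, S p -> nr (a p) <= B) ->
  jet (fun _ => a) a (fun=> 0).
Proof.
move=> B0 H; exists B => // e p _ Sp.
by rewrite mulr0 subr0 subrr nr0 mulr_ge0 ?sqr_ge0 // H.
Qed.

Lemma jet_eps : jet (fun e _ => e%:C) (fun=> 0) (fun=> 1).
Proof.
exists 1 => // e p _ _.
by rewrite nr0 nr1 mulr1 subr0 subrr nr0 mul1r sqr_ge0.
Qed.

Lemma jetD F G a b a' b' : jet F a b -> jet G a' b' ->
  jet (fun e p => F e p + G e p) (fun p => a p + a' p) (fun p => b p + b' p).
Proof.
move=> [c c0 H] [c' c'0 H']; exists (c + c') => [|e p e1 Sp]; first by rewrite addr_ge0.
have [h1 h2 h3] := H e p e1 Sp; have [h1' h2' h3'] := H' e p e1 Sp.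
split; [by apply: (le_trans (nrD _ _)); apply: lerD..|].
have -> : F e p + G e p - (a p + a' p) - e%:C * (b p + b' p) =
  (F e p - a p - e%:C * b p) + (G e p - a' p - e%:C * b' p) by ring.
by apply: (le_trans (nrD _ _)); rewrite mulrDl; apply: lerD.
Qed.

Lemma jetM F G a b a' b' : jet F a b -> jet G a' b' ->
  jet (fun e p => F e p * G e p) (fun p => a p * a' p) (fun p => a p * b' p + b p * a' p).
Proof.
move=> [c c0 H] [c' c'0 H']; pose d := 8 * (c + 1) * (c' + 1).
exists d => [|e p e1 Sp]; first by rewrite /d; nra.
have [h1 h2 h3] := H e p e1 Sp; have [h1' h2' h3'] := H' e p e1 Sp.
set r := F e p - a p - e%:C * b p in h3; set r' := G e p - a' p - e%:C * b' p in h3'.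
have n1 := nr_ge0 (a p); have n2 := nr_ge0 (b p); have n3 := nr_ge0 r.
have n1' := nr_ge0 (a' p); have n2' := nr_ge0 (b' p); have n3' := nr_ge0 r'.
have e0 := sqr_ge0 e; have e21 : e ^+ 2 <= 1 by rewrite -real_normK ?num_real // expr_le1.
have m1 := ler_pM n1 n1' h1 h1'; have m2 := ler_pM n1 n2' h1 h2'.
have m3 := ler_pM n2 n1' h2 h1'; have m4 := ler_pM n2 n2' h2 h2'.
have cc : 0 <= c * c' by rewrite mulr_ge0.
split.
- by rewrite nrM /d; nra.
- by apply: (le_trans (nrD _ _)); rewrite !nrM /d; nra.
have -> : F e p * G e p - a p * a' p - e%:C * (a p * b' p + b p * a' p) =
  e%:C ^+ 2 * (b p * b' p) + (a p * r' + r * a' p) + (e%:C * (b p * r' + r * b' p) + r * r').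
  by rewrite /r /r'; ring.
have q1 : nr (e%:C ^+ 2 * (b p * b' p)) <= c * c' * e ^+ 2.
  by rewrite nrM nrX nr_real real_normK ?num_real // mulrC ler_wpM2r // nrM.
have q2 : nr (a p * r' + r * a' p) <= 2 * (c * c') * e ^+ 2.
  apply: (le_trans (nrD _ _)); rewrite !nrM.
  have := ler_pM n1 n3' h1 h3'; have := ler_pM n3 n1' h3 h1'; lra.
have q3 : nr (e%:C * (b p * r' + r * b' p)) <= 2 * (c * c') * e ^+ 2.
  rewrite nrM nr_real; apply: (@le_trans _ _ (1 * nr (b p * r' + r * b' p))).
    by rewrite ler_wpM2r ?nr_ge0.
  rewrite mul1r; apply: (le_trans (nrD _ _)); rewrite !nrM.
  have := ler_pM n2 n3' h2 h3'; have := ler_pM n3 n2' h3 h2'; lra.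
have q4 : nr (r * r') <= c * c' * e ^+ 2.
  rewrite nrM; have := ler_pM n3 n3' h3 h3'.
  move=> /le_trans; apply; have -> : c * e ^+ 2 * (c' * e ^+ 2) = c * c' * e ^+ 2 * e ^+ 2 by ring.
  by rewrite ler_piMr // mulr_ge0.
apply: (le_trans (nrD _ _)).
have := nrD (e%:C ^+ 2 * (b p * b' p)) (a p * r' + r * a' p).
have := nrD (e%:C * (b p * r' + r * b' p)) (r * r').
have : 6 * (c * c') * e ^+ 2 <= d * e ^+ 2 by rewrite ler_wpM2r // /d; nra.
lra.
Qed.

Lemma jet_exp F b : jet F (fun=> 0) b -> jet (fun e p => cexp (F e p)) (fun=> 1) b.
Proof.
move=> [c c0 H]; have [d d0 Hd] := cexp_quad_bounded (2 * c).
exists (1 + c + d * (2 * c) ^+ 2) => [|e p e1 Sp].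
  by rewrite !addr_ge0 // mulr_ge0 // sqr_ge0.
have [_ h2 h3] := H e p e1 Sp; rewrite subr0 in h3.
have dc : 0 <= d * (2 * c) ^+ 2 by rewrite mulr_ge0 // sqr_ge0.
have n2 := nr_ge0 (b p); have ne := normr_ge0 e.
have hF : nr (F e p) <= 2 * c * `|e|.
  have := nr_distl (F e p) (e%:C * b p); rewrite nrM nr_real.
  have : e ^+ 2 <= `|e| by rewrite -real_normK ?num_real // expr2 ler_piMr.
  nra.
split; first by rewrite nr1; lra.
  lra.
have -> : cexp (F e p) - 1 - e%:C * b p = (cexp (F e p) - 1 - F e p) + (F e p - e%:C * b p).
  by ring.
apply: (le_trans (nrD _ _)).
have hF2 : nr (F e p) <= 2 * c by apply: (le_trans hF); rewrite ler_piMr // mulr_ge0.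
have := Hd _ hF2.
have : nr (F e p) ^+ 2 <= (2 * c * `|e|) ^+ 2 by rewrite lerXn2r ?nnegrE ?nr_ge0 ?mulr_ge0.
rewrite exprMn real_normK ?num_real // => h4 h5.
have := ler_wpM2l d0 h4; have := sqr_ge0 e; rewrite mulrA; nra.
Qed.
End Jets.

(** * Overshears and the approximate flow *)

Section PairMaps.
Context {R : realType}.
Local Notation C := R[i].
Implicit Types (t q : C) (p : C * C).

Definition shear_x t q p : C * C := (p.1, p.2 + t * q * p.1 ^+ 3).
Definition shear_y t q p : C * C := (p.1 + t * q * p.2 ^+ 3, p.2).

(** The flow for time [t] of [q (x + y)^2 (x - y) (d/dx - d/dy)] on [(y, x)]: it fixes
    [x + y] and multiplies [x - y] by an exponential. *)
Definition overshear_sub t q p : C * C :=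
  let w := (p.2 - p.1) / 2 * (cexp (2 * t * q * (p.2 + p.1) ^+ 2) - 1) in
  (p.1 - w, p.2 + w).

(** The flow for time [t] of [q (x - y)^2 (x + y) (d/dx + d/dy)]: the roles of [x + y]
    and [x - y] are exchanged. *)
Definition overshear_add t q p : C * C :=
  let w := (p.2 + p.1) / 2 * (cexp (2 * t * q * (p.2 - p.1) ^+ 2) - 1) in
  (p.1 + w, p.2 + w).

Definition dilation t (q : C) p : C * C := (cexp t * p.1, cexp t * p.2).

Lemma shear_xK t q : cancel (shear_x t q) (shear_x (- t) q).
Proof. by case=> y x; rewrite /shear_x /=; congr pair; ring. Qed.

Lemma shear_yK t q : cancel (shear_y t q) (shear_y (- t) q).
Proof. by case=> y x; rewrite /shear_y /=; congr pair; ring. Qed.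

Lemma dilationK t q : cancel (dilation t q) (dilation (- t) q).
Proof.
by case=> y x; rewrite /dilation /=; congr pair; rewrite mulrA -cexpD addNr cexp0 mul1r.
Qed.

Lemma overshear_subK t q : cancel (overshear_sub t q) (overshear_sub (- t) q).
Proof.
case=> y x; rewrite /overshear_sub /=.
set E := cexp (2 * t * q * _).
have -> : x + (x - y) / 2 * (E - 1) + (y - (x - y) / 2 * (E - 1)) = x + y by ring.
have -> : x + (x - y) / 2 * (E - 1) - (y - (x - y) / 2 * (E - 1)) = (x - y) * E by field.
have -> : 2 * - t * q * (x + y) ^+ 2 = - (2 * t * q * (x + y) ^+ 2) by ring.
rewrite cexpN -/E; have E0 : E != 0 := cexp_neq0 _.
by congr pair; field.
Qed.

Lemma overshear_addK t q : cancel (overshear_add t q) (overshear_add (- t) q).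
Proof.
case=> y x; rewrite /overshear_add /=.
set E := cexp (2 * t * q * _).
have -> : x + (x + y) / 2 * (E - 1) - (y + (x + y) / 2 * (E - 1)) = x - y by ring.
have -> : x + (x + y) / 2 * (E - 1) + (y + (x + y) / 2 * (E - 1)) = (x + y) * E by field.
have -> : 2 * - t * q * (x - y) ^+ 2 = - (2 * t * q * (x - y) ^+ 2) by ring.
rewrite cexpN -/E; have E0 : E != 0 := cexp_neq0 _.
by congr pair; field.
Qed.

(** The signs and the halves are those of the decomposition of the field
    [(1 - q x y) (x d/dx + y d/dy)] into complete fields. *)
Definition flow_step (e : R) q p : C * C :=
  dilation e%:C q (shear_x (- e%:C) q (shear_y (- e%:C) q
    (overshear_sub (- (e%:C / 2)) q (overshear_add (e%:C / 2) q p)))).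

Definition flow_step_inv (e : R) q p : C * C :=
  overshear_add (- (e%:C / 2)) q (overshear_sub (e%:C / 2) q
    (shear_y e%:C q (shear_x e%:C q (dilation (- e%:C) q p)))).

Lemma flow_stepK e q : cancel (flow_step e q) (flow_step_inv e q).
Proof.
move=> p; have := shear_xK (- e%:C) q; rewrite opprK => xK.
have := shear_yK (- e%:C) q; rewrite opprK => yK.
have := overshear_subK (- (e%:C / 2)) q; rewrite opprK => sK.
by rewrite /flow_step /flow_step_inv dilationK xK yK sK overshear_addK.
Qed.

Lemma flow_step_invK e q : cancel (flow_step_inv e q) (flow_step e q).
Proof.
move=> p; have := dilationK (- e%:C) q; rewrite opprK => dK.
have := overshear_addK (- (e%:C / 2)) q; rewrite opprK => aK.
by rewrite /flow_step /flow_step_inv aK overshear_subK shear_yK shear_xK dK.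
Qed.

Section PairJets.
Variable B : R.
Hypothesis B0 : 0 <= B.
Local Notation T := (C * (C * C))%type.
Definition box : set T := [set v | [/\ nr v.1 <= B, nr v.2.1 <= B & nr v.2.2 <= B]].
Implicit Types (F G : R -> T -> C) (a b : T -> C).
Let y (v : T) := v.2.1.
Let x (v : T) := v.2.2.
Let q (v : T) := v.1.

(** [P e] agrees to first order with the flow of the field with components [dy] and
    [dx]. Quantifying over the arguments of [P] makes composition additive in the
    fields. *)
Definition step_field (P : R -> C -> C * C -> C * C) (dy dx : T -> C) :=
  forall (Y X : R -> T -> C) by_ bx, jet box Y y by_ -> jet box X x bx ->
    jet box (fun e v => (P e v.1 (Y e v, X e v)).1) y (fun v => by_ v + dy v) /\
    jet box (fun e v => (P e v.1 (Y e v, X e v)).2) x (fun v => bx v + dx v).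

Lemma jet_ext F F' a b : jet box F a b -> (forall e v, F e v = F' e v) -> jet box F' a b.
Proof. by move=> j H; have <- : F = F' by apply/funext => e; apply/funext. Qed.

Lemma step_field_comp P P' dy dx dy' dx' :
  step_field P dy dx -> step_field P' dy' dx' ->
  step_field (fun e q p => P' e q (P e q p)) (fun v => dy v + dy' v) (fun v => dx v + dx' v).
Proof.
move=> H H' Y X by_ bx jy jx; have [j1 j2] := H _ _ _ _ jy jx.
have [k1 k2] := H' _ _ _ _ j1 j2; split.
  apply: jet_eq (_ : jet box _ y (fun v => by_ v + dy v + dy' v)) _ _ => [|//|v _].
    by move: k1; congr jet; apply/funext => e; apply/funext => v; rewrite -surjective_pairing.
  by rewrite addrA.
apply: jet_eq (_ : jet box _ x (fun v => bx v + dx v + dx' v)) _ _ => [|//|v _].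
  by move: k2; congr jet; apply/funext => e; apply/funext => v; rewrite -surjective_pairing.
by rewrite addrA.
Qed.

Lemma jet_q : jet box (fun (_ : R) v => v.1) q (fun=> 0).
Proof. by apply: (jet_base B0) => v []. Qed.

Lemma jet_ce (c : C) : jet box (fun (e : R) _ => c * e%:C) (fun=> 0) (fun=> c).
Proof.
apply: jet_eq (jetM (@jet_cst R _ box c) (@jet_eps R _ box)) _ _ => v _ /=; ring.
Qed.

Lemma jetX2 (F : R -> T -> C) a b : jet box F a b ->
  jet box (fun e v => F e v ^+ 2) (fun v => a v ^+ 2) (fun v => 2 * a v * b v).
Proof. by move=> j; apply: jet_eq (jetM j j) _ _ => v _; ring. Qed.

Lemma jetX3 (F : R -> T -> C) a b : jet box F a b ->
  jet box (fun e v => F e v ^+ 3) (fun v => a v ^+ 3) (fun v => 3 * a v ^+ 2 * b v).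
Proof.
by move=> j; apply: jet_eq (jetM j (jetX2 j)) _ _ => v _; ring.
Qed.

Lemma jetB (F G : R -> T -> C) a b a' b' : jet box F a b -> jet box G a' b' ->
  jet box (fun e v => F e v - G e v) (fun v => a v - a' v) (fun v => b v - b' v).
Proof.
move=> j j'; have E : (fun (e : R) (v : T) => F e v - G e v) = (fun e v => F e v + (-1) * G e v).
  by apply/funext => e; apply/funext => v; ring.
rewrite E; apply: jet_eq (jetD j (jetM (@jet_cst R _ box (-1)) j')) _ _ => v _ /=; ring.
Qed.

Lemma field_shear_x c : step_field (fun e => shear_x (c * e%:C)) (fun=> 0)
  (fun v => c * q v * y v ^+ 3).
Proof.
move=> Y X by_ bx jy jx; split; first by apply: jet_eq jy _ _ => v _ //; rewrite addr0.
apply: jet_eq (jetD jx (jetM (jetM (jet_ce c) jet_q) (jetX3 jy))) _ _ => v _ /=; ring.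
Qed.

Lemma field_shear_y c : step_field (fun e => shear_y (c * e%:C)) (fun v => c * q v * x v ^+ 3)
  (fun=> 0).
Proof.
move=> Y X by_ bx jy jx; split; last by apply: jet_eq jx _ _ => v _ //; rewrite addr0.
apply: jet_eq (jetD jy (jetM (jetM (jet_ce c) jet_q) (jetX3 jx))) _ _ => v _ /=; ring.
Qed.

Lemma field_dilation c : step_field (fun e => dilation (c * e%:C)) (fun v => c * y v)
  (fun v => c * x v).
Proof.
move=> Y X by_ bx jy jx; split.
  apply: jet_eq (jetM (jet_exp (jet_ce c)) jy) _ _ => v _ /=; ring.
apply: jet_eq (jetM (jet_exp (jet_ce c)) jx) _ _ => v _ /=; ring.
Qed.

Lemma jet_exponent c (F : R -> T -> C) a b : jet box F a b ->
  jet box (fun (e : R) v => cexp (2 * (c * e%:C) * v.1 * F e v ^+ 2) - 1) (fun=> 0)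
    (fun v => 2 * c * q v * a v ^+ 2).
Proof.
move=> j.
have j1 := jetM (jetM (jetM (@jet_cst R _ box 2) (jet_ce c)) jet_q) (jetX2 j).
have j2 : jet box (fun (e : R) v => 2 * (c * e%:C) * v.1 * F e v ^+ 2) (fun=> 0)
    (fun v => 2 * c * q v * a v ^+ 2).
  by apply: jet_eq j1 _ _ => v _ /=; ring.
apply: jet_eq (jetB (jet_exp j2) (@jet_cst R _ box 1)) _ _ => v _ /=; ring.
Qed.

Lemma field_overshear_sub c : step_field (fun e => overshear_sub (c * e%:C))
  (fun v => - (c * q v * (x v - y v) * (x v + y v) ^+ 2))
  (fun v => c * q v * (x v - y v) * (x v + y v) ^+ 2).
Proof.
move=> Y X by_ bx jy jx.
have jw := jetM (jetM (jetB jx jy) (@jet_cst R _ box 2^-1)) (jet_exponent c (jetD jx jy)).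
split; rewrite /overshear_sub /=.
  apply: jet_eq (jetB jy jw) _ _ => v _ /=; [ring|by field].
apply: jet_eq (jetD jx jw) _ _ => v _ /=; [ring|by field].
Qed.

Lemma field_overshear_add c : step_field (fun e => overshear_add (c * e%:C))
  (fun v => c * q v * (x v + y v) * (x v - y v) ^+ 2)
  (fun v => c * q v * (x v + y v) * (x v - y v) ^+ 2).
Proof.
move=> Y X by_ bx jy jx.
have jw := jetM (jetM (jetD jx jy) (@jet_cst R _ box 2^-1)) (jet_exponent c (jetB jx jy)).
split; rewrite /overshear_add /=.
  apply: jet_eq (jetD jy jw) _ _ => v _ /=; [ring|by field].
apply: jet_eq (jetD jx jw) _ _ => v _ /=; [ring|by field].
Qed.

Lemma jet_yx : jet box (fun _ : R => y) y (fun=> 0) /\ jet box (fun _ : R => x) x (fun=> 0).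
Proof. by split; apply: (jet_base B0) => v []. Qed.

(** The fields of the five factors add up to the field to be approximated; this sum
    is the identity that makes the construction work. *)
Lemma flow_step_jet :
  jet box (fun (e : R) v => (flow_step e v.1 v.2).1) y (fun v => (1 - q v * y v * x v) * y v) /\
  jet box (fun (e : R) v => (flow_step e v.1 v.2).2) x (fun v => (1 - q v * y v * x v) * x v).
Proof.
have H := step_field_comp (step_field_comp (step_field_comp (step_field_comp
  (field_overshear_add 2^-1) (field_overshear_sub (- 2^-1))) (field_shear_y (-1)))
  (field_shear_x (-1))) (field_dilation 1).
have [jy jx] := jet_yx; have [k1 k2] := H _ _ _ _ jy jx.
have E (v : T) e : flow_step e v.1 v.2 = dilation (1 * e%:C) v.1 (shear_x (-1 * e%:C) v.1
  (shear_y (-1 * e%:C) v.1 (overshear_sub (- 2^-1 * e%:C) v.1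
   (overshear_add (2^-1 * e%:C) v.1 (y v, x v))))).
  rewrite /flow_step -surjective_pairing mul1r mulN1r.
  by have -> : - 2^-1 * e%:C = - (e%:C / 2) by [ring]; rewrite [2^-1 * _]mulrC.
split.
  apply: jet_eq (jet_ext k1 (fun e v => esym (congr1 fst (E v e)))) _ _ => v _ //=; by field.
apply: jet_eq (jet_ext k2 (fun e v => esym (congr1 snd (E v e)))) _ _ => v _ //=; by field.
Qed.

Lemma flow_step_inv_jet :
  jet box (fun (e : R) v => (flow_step_inv e v.1 v.2).1) y (fun v => - ((1 - q v * y v * x v) * y v)) /\
  jet box (fun (e : R) v => (flow_step_inv e v.1 v.2).2) x (fun v => - ((1 - q v * y v * x v) * x v)).
Proof.
have H := step_field_comp (step_field_comp (step_field_comp (step_field_comp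
  (field_dilation (-1)) (field_shear_x 1)) (field_shear_y 1))
  (field_overshear_sub 2^-1)) (field_overshear_add (- 2^-1)).
have [jy jx] := jet_yx; have [k1 k2] := H _ _ _ _ jy jx.
have E (v : T) e : flow_step_inv e v.1 v.2 = overshear_add (- 2^-1 * e%:C) v.1
  (overshear_sub (2^-1 * e%:C) v.1 (shear_y (1 * e%:C) v.1 (shear_x (1 * e%:C) v.1
   (dilation (-1 * e%:C) v.1 (y v, x v))))).
  rewrite /flow_step_inv -surjective_pairing mul1r mulN1r.
  by have -> : - 2^-1 * e%:C = - (e%:C / 2) by [ring]; rewrite [2^-1 * _]mulrC.
split.
  apply: jet_eq (jet_ext k1 (fun e v => esym (congr1 fst (E v e)))) _ _ => v _ //=; by field.
apply: jet_eq (jet_ext k2 (fun e v => esym (congr1 snd (E v e)))) _ _ => v _ //=; by field.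
Qed.

End PairJets.
End PairMaps.

Arguments flow_step : simpl never.
Arguments flow_step_inv : simpl never.

(** * The rates of the steps *)

Section Scales.
Context {R : realType}.

(** The factor by which [1 - pi] has shrunk after [n] steps. With errors [rate n ^ 2]
    in each step, magnified by [scale n], the square root is small enough for the sum
    to converge. *)
Definition scale (n : nat) : R := Num.sqrt n.+1%:R.
(** Chosen so that the change of scale compensates the contraction factor
    [1 - 2 * rate n] of a step exactly, see [scale_rate]. *)
Definition rate (n : nat) : R := (scale n.+1 - scale n) / (2 * scale n.+1).
Definition tail (n : nat) : R := (scale n)^-1.

Lemma scale_ge1 n : 1 <= scale n.
Proof. by rewrite -sqrtr1 ler_sqrt ?ler1n. Qed.

Lemma scale_sqrS n : scale n.+1 ^+ 2 = scale n ^+ 2 + 1.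
Proof. by rewrite !sqr_sqrtr ?ler0n // natr1. Qed.

Lemma scale_gt0 n : 0 < scale n.
Proof. exact: lt_le_trans ltr01 (scale_ge1 n). Qed.

Lemma scale_leS n : scale n <= scale n.+1.
Proof. by rewrite ler_sqrt ?ler0n // ler_nat. Qed.

Lemma tail_gt0 n : 0 < tail n.
Proof. by rewrite invr_gt0 scale_gt0. Qed.

Lemma tail_small (e : R) : 0 < e -> exists n0, forall n, (n0 <= n)%N -> tail n <= e.
Proof.
move=> e0; have [n0 Hn0] := nat_large (e^-1 ^+ 2); exists n0 => n /Hn0 /ltW h.
rewrite /tail invf_ple ?posrE ?scale_gt0 // -(@ler_pXn2r _ 2) ?nnegrE ?invr_ge0 ?(ltW e0) //.
  by rewrite /scale sqr_sqrtr ?ler0n.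
exact: ltW (scale_gt0 n).
Qed.

Lemma rate_itv n : 0 <= rate n <= 1.
Proof.
have h0 := scale_gt0 n; have h1 := scale_gt0 n.+1; have h2 := scale_leS n.
rewrite /rate divr_ge0 //=; [|lra..].
by rewrite ler_pdivrMr; lra.
Qed.

Lemma scale_rate n : scale n.+1 * (1 - 2 * rate n) = scale n.
Proof. by rewrite /rate; have h := scale_gt0 n.+1; field; rewrite gt_eqF. Qed.

Lemma scale_rateC n : (scale n.+1)%:C * (1 - 2 * (rate n)%:C) = (scale n)%:C :> R[i].
Proof.
have := scale_rate n; move: (rate n) => x <-.
have two : (2 : R)%:C = 2 :> R[i] by exact: rmorph_nat.
by rewrite RCM -two -[1 in LHS](rmorph1 (@real_complex R)) -RCM rmorphB.
Qed.

Lemma tailB n : tail n - tail n.+1 = (scale n.+1 - scale n) / (scale n * scale n.+1).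
Proof.
by rewrite /tail; have h := scale_gt0 n; have h' := scale_gt0 n.+1; field; rewrite !gt_eqF.
Qed.

Lemma scale_diff n : scale n * (scale n.+1 - scale n) <= 1.
Proof. have := scale_sqrS n; have := scale_leS n; have := scale_gt0 n; nra. Qed.

Lemma tailB_ge0 n : 0 <= tail n - tail n.+1.
Proof.
rewrite tailB; apply: divr_ge0; first by rewrite subr_ge0 scale_leS.
by apply: mulr_ge0; apply: ltW; exact: scale_gt0.
Qed.

Lemma rate_tail1 n : rate n / scale n <= tail n - tail n.+1.
Proof.
have h := scale_gt0 n; have h' := scale_gt0 n.+1.
have -> : rate n / scale n = (tail n - tail n.+1) / 2.
  by rewrite tailB /rate; field; rewrite !gt_eqF.
by have := tailB_ge0 n; lra.
Qed.

(** The magnified second-order errors are bounded by the increments of a convergent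
    sequence. *)
Lemma rate_tail2 n : scale n.+1 * rate n ^+ 2 <= tail n - tail n.+1.
Proof.
have h := scale_gt0 n; have h' := scale_gt0 n.+1.
have -> : scale n.+1 * rate n ^+ 2 = (tail n - tail n.+1) * (scale n * (scale n.+1 - scale n)) / 4.
  by rewrite tailB /rate; field; rewrite !gt_eqF.
have := ler_wpM2l (tailB_ge0 n) (scale_diff n); have := tailB_ge0 n; lra.
Qed.

Lemma rate_tail3 n : rate n ^+ 2 <= (tail n - tail n.+1) / 4.
Proof.
have h := scale_gt0 n; have h' := scale_gt0 n.+1.
have E : scale n.+1 * rate n ^+ 2 = (tail n - tail n.+1) * (scale n * (scale n.+1 - scale n)) / 4.
  by rewrite tailB /rate; field; rewrite !gt_eqF.
have := ler_wpM2l (tailB_ge0 n) (scale_diff n).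
have : rate n ^+ 2 <= scale n.+1 * rate n ^+ 2.
  by rewrite ler_peMl ?sqr_ge0 // scale_ge1.
lra.
Qed.

Lemma rate_tail4 n : scale n.+1 * rate n / scale n ^+ 2 <= tail n - tail n.+1.
Proof.
have h := scale_gt0 n; have h' := scale_gt0 n.+1.
have -> : scale n.+1 * rate n / scale n ^+ 2 = (tail n - tail n.+1) * (scale n.+1 / (2 * scale n)).
  by rewrite tailB /rate; field; rewrite !gt_eqF.
rewrite ler_piMr ?tailB_ge0 // ler_pdivrMr; last by lra.
rewrite mul1r -(@ler_pXn2r _ 2) ?nnegrE //; [|lra..].
rewrite scale_sqrS; have := scale_ge1 n; nra.
Qed.

End Scales.

(** * The steps in the charts *)

Section Lift.
Context {R : realType} {k : nat}.
Local Notation C := R[i].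
Local Notation V := 'rV[C]_k.
Local Notation M := (C_times_Cstar R k).
Variables (i0 i1 : 'I_k).
Hypothesis i0E : (i0 : nat) = 0%N.
Hypothesis i10 : i1 != i0.
Implicit Types (z : V) (P : C -> C * C -> C * C).

Definition coord_prod_but01 z : C := \prod_(i | (i != i0) && (i != i1)) z 0 i.
(** A map of the two coordinates [i0] (for [y]) and [i1] (for [x]), with the product of
    the others as a parameter. That product is invariant, so composites of lifts are
    lifts. *)
Definition lift_pair P z : V := \row_j
  if j == i0 then (P (coord_prod_but01 z) (z 0 i0, z 0 i1)).1
  else if j == i1 then (P (coord_prod_but01 z) (z 0 i0, z 0 i1)).2 else z 0 j.

Lemma lift0 P z : lift_pair P z 0 i0 = (P (coord_prod_but01 z) (z 0 i0, z 0 i1)).1.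
Proof. by rewrite mxE eqxx. Qed.
Lemma lift1 P z : lift_pair P z 0 i1 = (P (coord_prod_but01 z) (z 0 i0, z 0 i1)).2.
Proof. by rewrite mxE (negbTE i10) eqxx. Qed.
Lemma lift_other P z j : j != i0 -> j != i1 -> lift_pair P z 0 j = z 0 j.
Proof. by move=> /negbTE j0 /negbTE j1; rewrite mxE j0 j1. Qed.
Lemma coord_prod_but01_lift P z : coord_prod_but01 (lift_pair P z) = coord_prod_but01 z.
Proof. by apply: eq_bigr => j /andP[j0 j1]; rewrite lift_other. Qed.

Lemma lift_comp P P' z : lift_pair P (lift_pair P' z) = lift_pair (fun q p => P q (P' q p)) z.
Proof.
apply/rowP => j; rewrite [LHS]mxE [RHS]mxE coord_prod_but01_lift lift0 lift1 -surjective_pairing.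
by case: ifP => // /negbT j0; case: ifP => // /negbT j1; rewrite lift_other.
Qed.

Lemma lift_id P z : (forall q p, P q p = p) -> lift_pair P z = z.
Proof.
move=> H; apply/rowP => j; rewrite mxE H /=.
by case: eqP => [->//|_]; case: eqP => [->|].
Qed.

Lemma entire_lift P : entire_expr (fun z => (P (coord_prod_but01 z) (z 0 i0, z 0 i1)).1) ->
  entire_expr (fun z => (P (coord_prod_but01 z) (z 0 i0, z 0 i1)).2) -> entire_map (lift_pair P).
Proof.
move=> H1 H2 j; under eq_fun do rewrite mxE.
by case: eqP => // _; case: eqP => // _; exact: Ecoord.
Qed.

Lemma entire_shear_x t : entire_map (lift_pair (shear_x t)).
Proof.
apply: entire_lift => /=; first exact: Ecoord.
apply: Eadd; first exact: Ecoord.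
apply: Emul; last by apply: EX; exact: Ecoord.
by apply: Ecst_mul; exact: Eprod.
Qed.

Lemma entire_shear_y t : entire_map (lift_pair (shear_y t)).
Proof.
apply: entire_lift => /=; last exact: Ecoord.
apply: Eadd; first exact: Ecoord.
apply: Emul; last by apply: EX; exact: Ecoord.
by apply: Ecst_mul; exact: Eprod.
Qed.

Lemma entire_dilation t : entire_map (lift_pair (dilation t)).
Proof. by apply: entire_lift => /=; apply: Ecst_mul; exact: Ecoord. Qed.

Lemma entire_overshear_sub t : entire_map (lift_pair (overshear_sub t)).
Proof.
have H : entire_expr (fun z => (z 0 i1 - z 0 i0) / 2 *
    (cexp (2 * t * coord_prod_but01 z * (z 0 i1 + z 0 i0) ^+ 2) - 1)).
  apply: Emul.
    by apply: Emul; [apply: Esub; exact: Ecoord|exact: Ecst].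
  apply: Esub; last exact: Ecst.
  apply: Eexp; apply: Emul; first by apply: Ecst_mul; exact: Eprod.
  by apply: EX; apply: Eadd; exact: Ecoord.
by apply: entire_lift => /=; [apply: Esub|apply: Eadd] => //; exact: Ecoord.
Qed.

Lemma entire_overshear_add t : entire_map (lift_pair (overshear_add t)).
Proof.
have H : entire_expr (fun z => (z 0 i1 + z 0 i0) / 2 *
    (cexp (2 * t * coord_prod_but01 z * (z 0 i1 - z 0 i0) ^+ 2) - 1)).
  apply: Emul.
    by apply: Emul; [apply: Eadd; exact: Ecoord|exact: Ecst].
  apply: Esub; last exact: Ecst.
  apply: Eexp; apply: Emul; first by apply: Ecst_mul; exact: Eprod.
  by apply: EX; apply: Esub; exact: Ecoord.
by apply: entire_lift => /=; apply: Eadd => //; exact: Ecoord.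
Qed.

Definition Phi (e : R) : V -> V := lift_pair (flow_step e).
Definition Phi_inv (e : R) : V -> V := lift_pair (flow_step_inv e).

Lemma PhiK e : cancel (Phi e) (Phi_inv e).
Proof. by move=> z; rewrite /Phi /Phi_inv lift_comp lift_id // => q p; exact: flow_stepK. Qed.

Lemma Phi_invK e : cancel (Phi_inv e) (Phi e).
Proof. by move=> z; rewrite /Phi /Phi_inv lift_comp lift_id // => q p; exact: flow_step_invK. Qed.

Lemma entire_Phi e : entire_map (Phi e).
Proof.
have -> : Phi e = lift_pair (dilation e%:C) \o (lift_pair (shear_x (- e%:C)) \o (lift_pair (shear_y (- e%:C)) \o
   (lift_pair (overshear_sub (- (e%:C / 2))) \o lift_pair (overshear_add (e%:C / 2))))).
  by apply/funext => z; rewrite /= !lift_comp.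
apply: entire_map_comp; first exact: entire_dilation.
apply: entire_map_comp; first exact: entire_shear_x.
apply: entire_map_comp; first exact: entire_shear_y.
apply: entire_map_comp; [exact: entire_overshear_sub|exact: entire_overshear_add].
Qed.

Lemma entire_Phi_inv e : entire_map (Phi_inv e).
Proof.
have -> : Phi_inv e = lift_pair (overshear_add (- (e%:C / 2))) \o (lift_pair (overshear_sub (e%:C / 2)) \o
   (lift_pair (shear_y e%:C) \o (lift_pair (shear_x e%:C) \o lift_pair (dilation (- e%:C))))).
  by apply/funext => z; rewrite /= !lift_comp.
apply: entire_map_comp; first exact: entire_overshear_add.
apply: entire_map_comp; first exact: entire_overshear_sub.
apply: entire_map_comp; first exact: entire_shear_y.
apply: entire_map_comp; [exact: entire_shear_x|exact: entire_dilation].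
Qed.

Definition coord_prod z : C := \prod_i z 0 i.
Definition coord_prod_but0 z : C := \prod_(i | i != i0) z 0 i.

Lemma coord_prodE z : coord_prod z = z 0 i0 * coord_prod_but0 z.
Proof. exact: bigD1. Qed.

Lemma coord_prod_but0E z : coord_prod_but0 z = z 0 i1 * coord_prod_but01 z.
Proof. exact: (bigD1 i1). Qed.

Lemma M_neq0 z i : M z -> i != i0 -> z 0 i != 0.
Proof.
move=> Mz ii; apply: Mz; apply: contra ii => /eqP h; apply/eqP/val_inj.
by rewrite /= h i0E.
Qed.

Lemma coord_prod_but0_neq0 z : M z -> coord_prod_but0 z != 0.
Proof. by move=> Mz; apply/prodf_neq0 => i ii; exact: M_neq0. Qed.

Lemma coord_prod_but0_upd z c : coord_prod_but0 (upd z i0 c) = coord_prod_but0 z.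
Proof. by apply: eq_bigr => i /negbTE ii; rewrite mxE ii. Qed.

(** On the [n]-th chart the hypersurface [pi = 1] is [z_0 = 0], and its neighbourhoods
    are magnified by [scale n]. *)
Definition chart n z : V := upd z i0 ((scale n)%:C * (1 - coord_prod z)).
Definition unchart n z : V := upd z i0 ((1 - z 0 i0 / (scale n)%:C) / coord_prod_but0 z).

Lemma upd_i0_M z c : M z <-> M (upd z i0 c).
Proof.
by split=> Mz i ii; have := Mz i ii; rewrite mxE; case: (i =P i0) => // E; rewrite E i0E in ii.
Qed.

Lemma scaleC_neq0 n : (scale n)%:C != 0 :> C.
Proof. by rewrite -nr_gt0 nr_real normr_gt0 gt_eqF // scale_gt0. Qed.

Lemma upd_upd z c c' : upd (upd z i0 c) i0 c' = upd z i0 c'.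
Proof. by apply/rowP => j; rewrite !mxE; case: eqP. Qed.

Lemma coord_prod_unchart n z : M z -> coord_prod (unchart n z) = 1 - z 0 i0 / (scale n)%:C.
Proof. by move=> Mz; rewrite coord_prodE coord_prod_but0_upd updE divfK // coord_prod_but0_neq0. Qed.

Lemma unchartK n z : M z -> chart n (unchart n z) = z.
Proof.
move=> Mz; rewrite /chart coord_prod_unchart // upd_upd opprB addrC subrK.
by rewrite mulrC divfK ?scaleC_neq0 // upd_id.
Qed.

Lemma chartK n z : M z -> unchart n (chart n z) = z.
Proof.
move=> Mz; rewrite /unchart coord_prod_but0_upd upd_upd updE [_ * (1 - _)]mulrC mulfK ?scaleC_neq0 //.
by rewrite opprB addrC subrK coord_prodE mulfK ?coord_prod_but0_neq0 // upd_id.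
Qed.

Lemma chart_M n z : M z <-> M (chart n z).
Proof. exact: upd_i0_M. Qed.

Lemma nr_prod_le (r : R) (P : pred 'I_k) z : 1 <= r -> (forall i, P i -> nr (z 0 i) <= r) ->
  nr (\prod_(i | P i) z 0 i) <= r ^+ k.
Proof.
move=> r1 H; apply: (@le_trans _ _ (\prod_(i | P i) r)); last first.
  by rewrite prodr_const ler_weXn2l // -[leqRHS]card_ord max_card.
elim/big_ind2: _ => [|a x b y ha hb|i Pi]; [by rewrite nr1| |exact: H].
by rewrite nrM; apply: ler_pM; rewrite ?nr_ge0.
Qed.

Lemma nr_coord_prod_but0V (r : R) z : 1 <= r -> polyann r z -> nr (coord_prod_but0 z)^-1 <= r ^+ k.
Proof.
move=> r1 Kz; rewrite /coord_prod_but0 -prodfV.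
have := @nr_prod_le r (fun i => i != i0) (\row_i (z 0 i)^-1) r1.
under eq_bigr do rewrite mxE; apply => i ii; rewrite mxE nrV.
have r0 : 0 < r by lra.
have := (Kz i).2; have -> : (i : nat) != 0%N.
  by apply: contra ii => /eqP h; apply/eqP/val_inj; rewrite /= h i0E.
move=> /(_ isT) h; rewrite -[leRHS]invrK lef_pV2 ?posrE ?invr_gt0 //.
by apply: lt_le_trans h; rewrite invr_gt0.
Qed.

Lemma unchart_box (r : R) n z : 1 <= r -> polyann r z ->
  box ((1 + r) * r ^+ k) (coord_prod_but01 (unchart n z), (unchart n z 0 i0, unchart n z 0 i1)).
Proof.
move=> r1 Kz; have rk : 1 <= r ^+ k by rewrite exprn_ege1.
have coord_le : nr (coord_prod_but01 (unchart n z)) <= r ^+ k.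
  by apply: nr_prod_le => // i /andP[/negbTE ii _]; rewrite mxE ii; exact: (Kz i).1.
have k0 : (0 < k)%N by case: (k) i0 => [[]|].
have rrk : r <= r ^+ k by rewrite -[leLHS]expr1 ler_weXn2l.
split=> /=; first by nra.
- rewrite updE nrM; apply: ler_pM; rewrite ?nr_ge0 //; last exact: nr_coord_prod_but0V.
  apply: (le_trans (nrD _ _)); rewrite nr1 nrN lerD2l nrM nrV nr_real.
  rewrite gtr0_norm ?scale_gt0 // ler_pdivrMr ?scale_gt0 //.
  apply: (le_trans (Kz i0).1); rewrite ler_peMr ?scale_ge1 //; lra.
- by rewrite mxE (negbTE i10); apply: (le_trans (Kz i1).1); nra.
Qed.

Definition chart_step n z := chart n.+1 (Phi (rate n) (unchart n z)).
Definition chart_step_inv n z := chart n (Phi_inv (rate n) (unchart n.+1 z)).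

Lemma coord_prod_lift P z : coord_prod (lift_pair P z) =
  coord_prod_but01 z * (P (coord_prod_but01 z) (z 0 i0, z 0 i1)).1 * (P (coord_prod_but01 z) (z 0 i0, z 0 i1)).2.
Proof. by rewrite coord_prodE coord_prod_but0E lift0 lift1 coord_prod_but01_lift mulrA mulrC mulrA. Qed.

Lemma chart_lift_dist P n z (w : V) (d : R) : 0 <= d -> (forall j, j != i0 -> w 0 j = z 0 j) ->
  nr ((scale n)%:C * (1 - coord_prod (lift_pair P w)) - z 0 i0) <= d ->
  nr (lift_pair P w 0 i1 - z 0 i1) <= d ->
  nr (chart n (lift_pair P w) - z) <= d.
Proof.
move=> d0 wz h0 h1; apply: nr_rv_le => // j; rewrite !mxE.
have [->|j0] := eqVneq j i0; first by [].
have [E|j1] := eqVneq j i1; first by move: h1; rewrite !mxE E (negbTE i10) eqxx.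
by rewrite -wz // subrr nr0.
Qed.

(** The expansions of [x] and of the product [q y x] determine a step in the charts. *)
Lemma flow_step_jets (B : R) : 0 <= B -> exists2 c : R, 0 <= c &
  forall (e : R) (v : C * (C * C)), `|e| <= 1 -> box B v ->
  let p := v.1 * v.2.1 * v.2.2 in let w := flow_step e v.1 v.2 in
  let p' := v.1 * w.1 * w.2 in
  nr (w.2 - v.2.2 - e%:C * ((1 - p) * v.2.2)) <= c * e ^+ 2 /\
  nr (p' - p - e%:C * (2 * (1 - p) * p)) <= c * e ^+ 2.
Proof.
move=> B0; have [jy jx] := flow_step_jet B0.
have [c1 c10 H1] := jx; have [c2 c20 H2] := jetM (jetM (jet_q B0) jy) jx.
exists (c1 + c2) => [|e v e1 Sv]; first by rewrite addr_ge0.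
have [_ _ h1] := H1 e v e1 Sv; have [_ _ h2] := H2 e v e1 Sv.
have e2 := sqr_ge0 e; split.
  by apply: (le_trans h1); rewrite [leRHS]mulrDl lerDl mulr_ge0.
rewrite [leRHS]mulrDl; apply: (@le_trans _ _ (c2 * e ^+ 2)); last by rewrite lerDr mulr_ge0.
move: h2 => /= /(le_trans _); apply; rewrite le_eqVlt; apply/orP; left; apply/eqP.
by congr nr; ring.
Qed.

Lemma flow_step_inv_jets (B : R) : 0 <= B -> exists2 c : R, 0 <= c &
  forall (e : R) (v : C * (C * C)), `|e| <= 1 -> box B v ->
  let p := v.1 * v.2.1 * v.2.2 in let w := flow_step_inv e v.1 v.2 in
  let p' := v.1 * w.1 * w.2 in
  nr (w.2 - v.2.2 + e%:C * ((1 - p) * v.2.2)) <= c * e ^+ 2 /\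
  nr (p' - p + e%:C * (2 * (1 - p) * p)) <= c * e ^+ 2.
Proof.
move=> B0; have [jy jx] := flow_step_inv_jet B0.
have [c1 c10 H1] := jx; have [c2 c20 H2] := jetM (jetM (jet_q B0) jy) jx.
exists (c1 + c2) => [|e v e1 Sv]; first by rewrite addr_ge0.
have [_ _ h1] := H1 e v e1 Sv; have [_ _ h2] := H2 e v e1 Sv.
have e2 := sqr_ge0 e; split.
  rewrite [leRHS]mulrDl; apply: (@le_trans _ _ (c1 * e ^+ 2)); last by rewrite lerDl mulr_ge0.
  by move: h1; rewrite mulrN opprK.
rewrite [leRHS]mulrDl; apply: (@le_trans _ _ (c2 * e ^+ 2)); last by rewrite lerDr mulr_ge0.
move: h2 => /= /(le_trans _); apply; rewrite le_eqVlt; apply/orP; left; apply/eqP.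
by congr nr; ring.
Qed.

(** In the chart the linear part of the contraction is undone by the change of scale;
    what remains is quadratic in [z_0 / scale n] or in [rate n]. *)
Lemma chart_step_est (r : R) : 1 <= r -> exists2 K : R, 0 <= K & forall n z, polyann r z ->
  nr (chart_step n z - z) <= K * (tail n - tail n.+1).
Proof.
move=> r1; have r0 : 0 < r by lra.
pose B := (1 + r) * r ^+ k.
have B0 : 0 <= B by rewrite mulr_ge0 ?exprn_ge0 //; lra.
have [c c0 H] := flow_step_jets B0.
exists (2 * r ^+ 2 + c) => [|n z Kz]; first by rewrite !addr_ge0 // mulr_ge0 // sqr_ge0.
have Mz : M z := polyann_sub r0 Kz.
have Sv := unchart_box n r1 Kz.
set w := unchart n z in Sv *; set v := (coord_prod_but01 w, _) in Sv.
have /andP[e0 e1] := @rate_itv R n; set e := rate n in e0 e1 *.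
have ne : `|e| <= 1 by rewrite ger0_norm.
have {H} /= := H e v ne Sv.
have vx : w 0 i1 = z 0 i1 by rewrite mxE (negbTE i10).
have -> : coord_prod_but01 w * w 0 i0 * w 0 i1 = 1 - z 0 i0 / (scale n)%:C.
  by rewrite -(coord_prod_unchart n Mz) coord_prodE coord_prod_but0E -/w; ring.
rewrite vx.
set sg := z 0 i0 / (scale n)%:C; move=> [h1 h2].
have t0 := @tailB_ge0 R n; set dl := tail n - tail n.+1 in t0 *.
have s0 := @scale_gt0 R n; have s1 := @scale_gt0 R n.+1.
have nsg : nr sg <= r / scale n.
  by rewrite /sg nrM nrV nr_real gtr0_norm // ler_pM2r ?invr_gt0 //; exact: (Kz i0).1.
have e2 := rate_tail3 (R := R) n; rewrite -/e -/dl in e2.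
have t1 := rate_tail1 (R := R) n; rewrite -/e -/dl in t1.
have t2 := rate_tail2 (R := R) n; rewrite -/e -/dl in t2.
have t4 := rate_tail4 (R := R) n; rewrite -/e -/dl in t4.
have eC : nr e%:C = e by rewrite nr_real ger0_norm.
have r20 := sqr_ge0 r.
apply: chart_lift_dist.
- by rewrite mulr_ge0 // !addr_ge0 // mulr_ge0.
- by move=> j jj; rewrite mxE (negbTE jj).
- rewrite coord_prod_lift.
  move: h2; rewrite -/e /= vx; set X := coord_prod_but01 w * _ * _ => h2.
  set rho := X - _ - _ in h2.
  have -> : (scale n.+1)%:C * (1 - X) - z 0 i0 =
    (scale n.+1)%:C * (2 * e%:C * sg ^+ 2 - rho).
    have zE : z 0 i0 = (scale n.+1)%:C * (1 - 2 * e%:C) * sg.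
      have -> : (scale n.+1)%:C * (1 - 2 * e%:C) = (scale n)%:C :> C.
        exact: scale_rateC.
      by rewrite /sg mulrC divfK // scaleC_neq0.
    by rewrite zE /rho; ring.
  rewrite nrM nr_real gtr0_norm //.
  have q1 : nr (2 * e%:C * sg ^+ 2 - rho) <= 2 * e * (r / scale n) ^+ 2 + c * e ^+ 2.
    apply: (le_trans (nrD _ _)); rewrite nrN; apply: lerD => //.
    rewrite nrM [nr (2 * e%:C)]nrM nr_nat eC nrX ler_wpM2l //; first by rewrite mulr_ge0.
    by rewrite lerXn2r ?nnegrE ?nr_ge0 // divr_ge0 // ltW.
  apply: (le_trans (ler_wpM2l (ltW s1) q1)).
  have -> : scale n.+1 * (2 * e * (r / scale n) ^+ 2 + c * e ^+ 2) =
     2 * r ^+ 2 * (scale n.+1 * e / scale n ^+ 2) + c * (scale n.+1 * e ^+ 2).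
    by field; rewrite gt_eqF.
  have := ler_wpM2l c0 t2; have := ler_wpM2l (mulr_ge0 (ler0n _ 2) r20) t4.
  lra.
- rewrite lift1 -/e vx.
  set X := (flow_step _ _ _).2 in h1 *.
  have -> : X - z 0 i1 = (X - z 0 i1 - e%:C * ((1 - (1 - sg)) * z 0 i1)) + e%:C * sg * z 0 i1 by ring.
  apply: (le_trans (nrD _ _)).
  have q : nr (e%:C * sg * z 0 i1) <= r ^+ 2 * (e / scale n).
    rewrite nrM [nr (e%:C * _)]nrM eC.
    have -> : r ^+ 2 * (e / scale n) = e * (r / scale n) * r by ring.
    apply: ler_pM; [|exact: nr_ge0| |exact: (Kz i1).1].
      by apply: mulr_ge0 => //; exact: nr_ge0.
    by apply: ler_wpM2l.
  have := ler_wpM2l r20 t1; have := ler_wpM2l c0 e2.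
  have := mulr_ge0 c0 t0; have := mulr_ge0 r20 t0; lra.
Qed.
Lemma chart_step_inv_est (r : R) : 1 <= r -> exists2 K : R, 0 <= K & forall n z, polyann r z ->
  nr (chart_step_inv n z - z) <= K * (tail n - tail n.+1).
Proof.
move=> r1; have r0 : 0 < r by lra.
pose B := (1 + r) * r ^+ k.
have B0 : 0 <= B by rewrite mulr_ge0 ?exprn_ge0 //; lra.
have [c c0 H] := flow_step_inv_jets B0.
exists (r + 2 * r ^+ 2 + c) => [|n z Kz].
  by have := sqr_ge0 r; lra.
have Mz : M z := polyann_sub r0 Kz.
have Sv := unchart_box n.+1 r1 Kz.
set w := unchart n.+1 z in Sv *; set v := (coord_prod_but01 w, _) in Sv.
have /andP[e0 e1] := @rate_itv R n; set e := rate n in e0 e1 *.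
have ne : `|e| <= 1 by rewrite ger0_norm.
have {H} /= := H e v ne Sv.
have vx : w 0 i1 = z 0 i1 by rewrite mxE (negbTE i10).
have -> : coord_prod_but01 w * w 0 i0 * w 0 i1 = 1 - z 0 i0 / (scale n.+1)%:C.
  by rewrite -(coord_prod_unchart n.+1 Mz) coord_prodE coord_prod_but0E -/w; ring.
rewrite vx.
set sg := z 0 i0 / (scale n.+1)%:C; move=> [h1 h2].
have t0 := @tailB_ge0 R n; set dl := tail n - tail n.+1 in t0 *.
have s0 := @scale_gt0 R n; have s1 := @scale_gt0 R n.+1; have ss := @scale_leS R n.
have nsg : nr sg <= r / scale n.
  apply: (@le_trans _ _ (r / scale n.+1)).
    by rewrite /sg nrM nrV nr_real gtr0_norm // ler_pM2r ?invr_gt0 //; exact: (Kz i0).1.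
  by rewrite ler_pM2l // lef_pV2.
have e2 := rate_tail3 (R := R) n; rewrite -/e -/dl in e2.
have t1 := rate_tail1 (R := R) n; rewrite -/e -/dl in t1.
have t2 := rate_tail2 (R := R) n; rewrite -/e -/dl in t2.
have t4 := rate_tail4 (R := R) n; rewrite -/e -/dl in t4.
have eC : nr e%:C = e by rewrite nr_real ger0_norm.
have r20 := sqr_ge0 r; have e20 := sqr_ge0 e.
apply: chart_lift_dist.
- by rewrite mulr_ge0 //; lra.
- by move=> j jj; rewrite mxE (negbTE jj).
- rewrite coord_prod_lift.
  move: h2; rewrite -/e /= vx; set X := coord_prod_but01 w * _ * _ => h2.
  set rho := X - _ + _ in h2.
  have -> : (scale n)%:C * (1 - X) - z 0 i0 =
    - (4 * e%:C ^+ 2 * z 0 i0) - (scale n)%:C * (2 * e%:C * sg ^+ 2 + rho).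
    have zE : (scale n)%:C * sg = (1 - 2 * e%:C) * z 0 i0.
      by rewrite /sg -(scale_rateC n) -/e; field; rewrite scaleC_neq0.
    have -> : (scale n)%:C * (1 - X) - z 0 i0 = (scale n)%:C * sg * (1 + 2 * e%:C) - z 0 i0
       - (scale n)%:C * (2 * e%:C * sg ^+ 2 + rho) by rewrite /rho; ring.
    by rewrite zE; ring.
  apply: (le_trans (nrD _ _)); rewrite !nrN [nr ((scale n)%:C * _)]nrM nr_real gtr0_norm //.
  have q0 : nr (4 * e%:C ^+ 2 * z 0 i0) <= r * dl.
    rewrite nrM [nr (4 * e%:C ^+ 2)]nrM nr_nat nrX eC mulrC.
    apply: ler_pM; [exact: nr_ge0|by rewrite mulr_ge0|exact: (Kz i0).1|lra].
  have q1 : nr (2 * e%:C * sg ^+ 2 + rho) <= 2 * e * (r / scale n) ^+ 2 + c * e ^+ 2.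
    apply: (le_trans (nrD _ _)); apply: lerD => //.
    rewrite nrM [nr (2 * e%:C)]nrM nr_nat eC nrX ler_wpM2l //; first by rewrite mulr_ge0.
    by rewrite lerXn2r ?nnegrE ?nr_ge0 // divr_ge0 // ltW.
  have q2 := ler_wpM2l (ltW s0) q1.
  have q3 : scale n * (2 * e * (r / scale n) ^+ 2 + c * e ^+ 2) <=
     scale n.+1 * (2 * e * (r / scale n) ^+ 2 + c * e ^+ 2).
    apply: ler_wpM2r => //; apply: addr_ge0; last exact: mulr_ge0.
    by apply: mulr_ge0; [exact: mulr_ge0|exact: sqr_ge0].
  have E : scale n.+1 * (2 * e * (r / scale n) ^+ 2 + c * e ^+ 2) =
     2 * r ^+ 2 * (scale n.+1 * e / scale n ^+ 2) + c * (scale n.+1 * e ^+ 2).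
    by field; rewrite gt_eqF.
  have := ler_wpM2l c0 t2; have := ler_wpM2l (mulr_ge0 (ler0n _ 2) r20) t4.
  rewrite E in q3; lra.
- rewrite lift1 -/e vx.
  set X := (flow_step_inv _ _ _).2 in h1 *.
  have -> : X - z 0 i1 = (X - z 0 i1 + e%:C * ((1 - (1 - sg)) * z 0 i1)) - e%:C * sg * z 0 i1 by ring.
  apply: (le_trans (nrD _ _)); rewrite nrN.
  have q : nr (e%:C * sg * z 0 i1) <= r ^+ 2 * (e / scale n).
    rewrite nrM [nr (e%:C * _)]nrM eC.
    have -> : r ^+ 2 * (e / scale n) = e * (r / scale n) * r by ring.
    apply: ler_pM; [|exact: nr_ge0| |exact: (Kz i1).1].
      by apply: mulr_ge0 => //; exact: nr_ge0.
    by apply: ler_wpM2l.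
  have := ler_wpM2l r20 t1; have := ler_wpM2l c0 e2.
  have := mulr_ge0 c0 t0; have := mulr_ge0 r20 t0; have := mulr_ge0 (ltW r0) t0; lra.
Qed.
End Lift.

(** * Limits of non-autonomous systems *)

Section VectorLimits.
Context {R : realType} {k : nat}.
Local Notation C := R[i].
Local Notation V := 'rV[C]_k.

Definition lim_to (u : nat -> V) (L : V) := forall e : R, 0 < e ->
  exists n0, forall n, (n0 <= n)%N -> nr (u n - L) <= e.

Lemma cauchy_vec (u : nat -> V) :
  (forall e : R, 0 < e -> exists n0, forall n m, (n0 <= n)%N -> (n0 <= m)%N -> nr (u n - u m) <= e) ->
  exists L, lim_to u L.
Proof.
move=> H.
have /choice[L HL] (j : 'I_k) : exists L : C, forall e : R, 0 < e ->
    exists n0, forall n, (n0 <= n)%N -> nr (u n 0 j - L) <= e.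
  apply: cauchy_complex => e /H[n0 H0]; exists n0 => n m nn mm.
  by have := nr_coord (u n - u m) j; rewrite !mxE => /le_trans; apply; exact: H0.
exists (\row_j L j) => e e0.
have /choice[n0 Hn0] j := HL j e e0.
exists (\max_j n0 j)%N => n nn; apply: nr_rv_le => [|j]; first exact: ltW.
by rewrite !mxE; apply: Hn0; apply: leq_trans nn; exact: leq_bigmax.
Qed.

Lemma lim_to_le (u : nat -> V) L a (B : R) n0 : lim_to u L ->
  (forall n, (n0 <= n)%N -> nr (u n - a) <= B) -> nr (L - a) <= B.
Proof.
move=> uL H; apply/ler_addgt0Pr => e e0; have [n1 H1] := uL e e0.
have h1 := H1 _ (leq_maxr n0 n1); have h2 := H _ (leq_maxl n0 n1).
by have := nr_dist L a (u (maxn n0 n1)); rewrite [nr (L - u _)]nrB; lra.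
Qed.

Lemma weierstrass_vec (F_ : nat -> V -> V) F a (r : R) : 0 < r ->
  (forall n x, nr (x - a) < r -> differentiable (F_ n) x) ->
  (forall e : R, 0 < e -> exists n0, forall n, (n0 <= n)%N ->
     forall x, nr (x - a) < r -> nr (F_ n x - F x) <= e) ->
  differentiable F a.
Proof.
move=> r0 Hd Hc; apply: diff_rv => j.
apply: (@weierstrass _ _ (fun n z => F_ n z 0 j) _ a r) => //.
  by move=> n x xa; apply: diff_coord; exact: Hd.
move=> e /Hc[n0 Hn0]; exists n0 => n nn x xa.
by have := nr_coord (F_ n x - F x) j; rewrite !mxE => /le_trans; apply; exact: Hn0.
Qed.
End VectorLimits.

Section NonautonomousLimit.
Context {R : realType} {k : nat}.
Local Notation C := R[i].
Local Notation V := 'rV[C]_k.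
Local Notation M := (C_times_Cstar R k).
Local Notation tail := (@tail R).
Variables g f t h : nat -> V -> V.
Hypothesis gS : forall n p, M (g n p) -> g n.+1 p = t n (g n p).
Hypothesis fS : forall n z, M z -> M (h n z) -> f n.+1 z = f n (h n z).
Hypothesis gfK : forall n z, M z -> g n (f n z) = z.
Hypothesis fgK : forall n p, M (g n p) -> f n (g n p) = p.
Hypothesis t_est : forall r : R, 1 <= r -> exists2 K : R, 0 <= K & forall n z, polyann r z ->
  nr (t n z - z) <= K * (tail n - tail n.+1).
Hypothesis h_est : forall r : R, 1 <= r -> exists2 K : R, 0 <= K & forall n z, polyann r z ->
  nr (h n z - z) <= K * (tail n - tail n.+1).
Hypothesis g_diff : forall n p, differentiable (g n) p.
Hypothesis f_diff : forall n z, M z -> differentiable (f n) z.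

Lemma Ktail_small (K e : R) : 0 <= K -> 0 < e ->
  exists n0, forall n, (n0 <= n)%N -> K * tail n <= e.
Proof.
move=> K0 e0; have K1 : 0 < K + 1 by lra.
have [|n0 Hn0] := @tail_small R (e / (K + 1)); first by rewrite divr_gt0.
exists n0 => n /Hn0; rewrite ler_pdivlMr // mulrDr mulr1 mulrC => h1.
by have := tail_gt0 (R := R) n; lra.
Qed.

Lemma M_polyann (r : R) z : 1 <= r -> polyann r z -> M z.
Proof. by move=> r1; apply: polyann_sub; lra. Qed.

(** The errors of the steps from [m] on sum to at most [K * tail m], too little to leave
    [polyann (2 * r)]. *)
Lemma forward (r : R) : 1 <= r -> exists m0, exists2 K : R, 0 <= K &
  forall m p, (m0 <= m)%N -> polyann r (g m p) -> forall n, (m <= n)%N ->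
    polyann (2 * r) (g n p) /\
    forall n', (n <= n')%N -> nr (g n' p - g n p) <= K * (tail n - tail n').
Proof.
move=> r1; have r2 : 1 <= 2 * r by lra.
have [K K0 HK] := t_est r2.
have [|m0 Hm0] := @Ktail_small K (2 * r)^-1 K0; first by rewrite invr_gt0; lra.
exists m0, K => // m p mm pm.
have step n : polyann (2 * r) (g n p) -> nr (g n.+1 p - g n p) <= K * (tail n - tail n.+1).
  by move=> pn; rewrite gS; [exact: HK|exact: M_polyann pn].
have inK d : polyann (2 * r) (g (m + d)%N p) /\
    nr (g (m + d)%N p - g m p) <= K * (tail m - tail (m + d)).
  elim: d => [|d [IH1 IH2]].
    rewrite addn0 !subrr nr0 mulr0; split=> //.
    by apply: polyann_mono pm; lra.
  have H : nr (g (m + d.+1)%N p - g m p) <= K * (tail m - tail (m + d.+1)).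
    apply: (le_trans (nr_dist _ _ (g (m + d)%N p))).
    by rewrite addnS; have := step _ IH1; lra.
  split=> //; apply: polyann_thick r1 pm _; apply: (le_trans H).
  by apply: le_trans (Hm0 m mm); rewrite ler_wpM2l //; have := tail_gt0 (R := R) (m + d.+1); lra.
move=> n mn; split; first by rewrite -(subnKC mn); exact: (inK _).1.
move=> n' /subnKC <-; elim: (n' - n)%N => [|d IH].
  by rewrite addn0 !subrr nr0 mulr0.
apply: (le_trans (nr_dist _ _ (g (n + d)%N p))); rewrite addnS.
have := step (n + d)%N; rewrite -{1}(subnKC mn) -addnA => /(_ (inK _).1).
by lra.
Qed.

(** For [m <= n] the map [z |-> g m (f n z)] is the composite of the inverse steps from
    [n] down to [m]; written in this way it needs no definition. *)
Lemma backward (r : R) : 1 <= r -> exists m0, exists2 K : R, 0 <= K &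
  forall m n z, (m0 <= m)%N -> (m <= n)%N -> polyann r z ->
    polyann (2 * r) (g m (f n z)) /\ nr (g m (f n z) - z) <= K * (tail m - tail n).
Proof.
move=> r1; have r2 : 1 <= 2 * r by lra.
have [K K0 HK] := h_est r2.
have [|m0 Hm0] := @Ktail_small K (2 * r)^-1 K0; first by rewrite invr_gt0; lra.
exists m0, K => // m n z mm mn pz.
rewrite -(subnKC mn); move: (n - m)%N => d {mn}; elim: d m mm => [|d IH] m mm.
  have Mz := M_polyann r1 pz; rewrite addn0 gfK // !subrr nr0 mulr0; split=> //.
  by apply: polyann_mono pz; lra.
have [] := IH m.+1 (leqW mm); rewrite addSnnS; set l := (m + d.+1)%N; set y := g m.+1 _ => py yz.
have yE : f l z = f m.+1 y by rewrite /y fgK //; exact: M_polyann py.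
have H : nr (h m y - z) <= K * (tail m - tail l).
  by apply: (le_trans (nr_dist _ _ y)); have := HK m y py; lra.
have ph : polyann (2 * r) (h m y).
  apply: polyann_thick r1 pz _; apply: (le_trans H).
  by apply: le_trans (Hm0 m mm); rewrite ler_wpM2l //; have := tail_gt0 (R := R) l; lra.
have My := M_polyann r2 py; have Mh := M_polyann r2 ph.
by rewrite yE fS // gfK.
Qed.

Definition basin : set V := [set p | exists r : R, exists2 m, 1 <= r &
  forall n, (m <= n)%N -> polyann r (g n p)].

Lemma basin_local p : basin p -> exists2 d : R, 0 < d & exists (r : R) m, exists2 K : R,
  1 <= r /\ 0 <= K & forall x, nr (x - p) < d -> forall n, (m <= n)%N ->
    polyann r (g n x) /\ forall n', (n <= n')%N -> nr (g n' x - g n x) <= K * (tail n - tail n').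
Proof.
move=> [r [m1 r1 Hm1]]; have r2 : 1 <= 2 * r by lra.
have [m0 [K K0 Hf]] := forward r2; pose m := maxn m0 m1.
have d0 : 0 < (2 * r)^-1 by rewrite invr_gt0; lra.
have [d dd Hd] := diff_cont_eps (g_diff m p) d0.
exists d => //; exists (2 * (2 * r)), m, K => [|x xp n mn]; first by split=> //; lra.
apply: Hf mn; first exact: leq_maxl.
by apply: polyann_thick r1 (Hm1 m (leq_maxr _ _)) _; apply: ltW; exact: Hd.
Qed.

Lemma g_lim_exists : exists G, forall p, basin p -> lim_to (g ^~ p) (G p).
Proof.
have /choice[G HG] p : exists L, basin p -> lim_to (g ^~ p) L.
  have [Bp|nB] := pselect (basin p); last by exists 0.
  have [d d0 [r [m [K [r1 K0] H]]]] := basin_local Bp.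
  have [|L HL] := @cauchy_vec R k (g ^~ p); last by exists L.
  move=> e e0; have [n1 Hn1] := Ktail_small K0 e0.
  have pp : nr (p - p) < d by rewrite subrr nr0.
  exists (maxn m n1) => n n'; rewrite !geq_max => /andP[mn n1n] /andP[mn' n1n'].
  wlog nn : n n' mn n1n mn' n1n' / (n <= n')%N.
    by move=> W; have [nn|/ltnW nn] := leqP n n'; [|rewrite nrB]; apply: W.
  rewrite nrB; apply: (le_trans ((H p pp n mn).2 n' nn)); apply: le_trans (Hn1 n n1n).
  by rewrite ler_wpM2l //; have := tail_gt0 (R := R) n'; lra.
by exists G.
Qed.

(** The next inverse step is applied to the innermost argument, so its error passes
    through all the others; Cauchy's estimate bounds their composite in the Lipschitz
    norm. *)
Lemma backward_lipschitz (r : R) : 1 <= r -> exists m, exists2 L : R, 0 <= L &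
  forall n z, (m <= n)%N -> polyann r z ->
    polyann (2 * (2 * r)) (g m (f n z)) /\
    nr (g m (f n.+1 z) - g m (f n z)) <= L * (tail n - tail n.+1).
Proof.
move=> r1; have r2 : 1 <= 2 * r by lra.
have [m0 [K K0 Hb]] := backward r2; have [Kh Kh0 Hh] := h_est r1.
pose rho := (2 * r)^-1; have rho0 : 0 < rho by rewrite invr_gt0; lra.
have [|m1 Hm1] := @Ktail_small Kh (rho / 4) Kh0; first by rewrite divr_gt0.
pose m := maxn m0 m1; pose L := 4 * (2 * (2 * r)) / rho * Kh.
exists m, L => [|n z mn pz].
  by rewrite /L; apply: mulr_ge0 => //; apply: divr_ge0; [lra|exact: ltW].
have m0m : (m0 <= m)%N by exact: leq_maxl.
have inb x : nr (x - z) < rho -> polyann (2 * r) x.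
  by move=> xz; apply: polyann_thick r1 pz _; exact: ltW.
have zz : nr (z - z) < rho / 2 by rewrite subrr nr0 divr_gt0.
split; first by apply: (Hb _ _ _ m0m mn _).1; apply: inb; rewrite subrr nr0.
have hz : nr (h n z - z) < rho / 2.
  have h1 := Hh n z pz; have := Hm1 n (leq_trans (leq_maxr _ _) mn).
  have : Kh * (tail n - tail n.+1) <= Kh * tail n.
    by rewrite ler_wpM2l //; have := tail_gt0 (R := R) n.+1; lra.
  lra.
have hz' : nr (h n z - z) < rho by apply: (lt_trans hz); lra.
rewrite fS; last first.
- exact: M_polyann (inb _ hz').
- exact: M_polyann pz.
apply: nr_rv_le => [|j].
  by rewrite mulr_ge0 ?tailB_ge0 // /L mulr_ge0 // divr_ge0 ?(ltW rho0) //; lra.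
rewrite !mxE.
have := @lipschitz_rv R k (fun w => g m (f n w) 0 j) z rho (2 * (2 * r)) z (h n z) rho0.
have D1 x : nr (x - z) < rho -> differentiable (fun w => g m (f n w) 0 j) x.
  move=> /inb px; apply: diff_coord; apply: differentiable_comp => //.
  by apply: f_diff; exact: M_polyann px.
have D2 x : nr (x - z) < rho -> nr (g m (f n x) 0 j) <= 2 * (2 * r).
  by move=> /inb px; have [+ _] := Hb m n x m0m mn px; case/(_ j).
move=> /(_ D1 D2 zz hz) H; apply: (le_trans H); rewrite /L -[leRHS]mulrA.
by apply: ler_wpM2l; [apply: divr_ge0; [lra|exact: ltW]|exact: Hh].
Qed.

(** [f n] factors through the fixed map [f m], which is uniformly continuous on a
    polyannulus. *)
Lemma f_cauchy (r : R) : 1 <= r -> forall e : R, 0 < e -> exists n0, forall n n',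
  (n0 <= n)%N -> (n0 <= n')%N -> forall z, polyann r z -> nr (f n z - f n' z) <= e.
Proof.
move=> r1 e e0; have [m [L L0 HL]] := backward_lipschitz r1.
have r4 : 1 <= 2 * (2 * r) by lra.
have dK z : polyann (2 * (2 * r)) z -> differentiable (f m) z.
  by move=> pz; apply: f_diff; exact: M_polyann pz.
have [d d0 Hd] := compact_unif_cont (@polyann_compact R k _) dK e0.
have [n1 Hn1] := Ktail_small L0 d0.
exists (maxn m n1) => n n'; rewrite !geq_max => /andP[mn n1n] /andP[mn' n1n'] z pz.
wlog nn : n n' mn n1n mn' n1n' / (n <= n')%N.
  by move=> W; have [nn|/ltnW nn] := leqP n n'; [|rewrite nrB]; apply: W.
have fE l : (m <= l)%N -> f l z = f m (g m (f l z)).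
  by move=> ml; rewrite fgK //; exact: M_polyann (HL _ _ ml pz).1.
rewrite (fE n) // (fE n') //; apply: Hd; [exact: (HL _ _ mn pz).1|exact: (HL _ _ mn' pz).1|].
rewrite nrB; apply: le_trans (Hn1 n n1n).
apply: (@le_trans _ _ (L * (tail n - tail n'))); last first.
  by rewrite ler_wpM2l //; have := tail_gt0 (R := R) n'; lra.
move: nn => /subnKC <-; elim: (n' - n)%N => [|i IH].
  by rewrite addn0 !subrr nr0 mulr0.
apply: (le_trans (nr_dist _ _ (g m (f (n + i)%N z)))); rewrite addnS.
by have [_] := HL (n + i)%N z (leq_trans mn (leq_addr _ _)) pz; lra.
Qed.

Lemma f_lim_exists : exists F, forall r : R, 1 <= r -> forall e : R, 0 < e ->
  exists n0, forall n, (n0 <= n)%N -> forall z, polyann r z -> nr (f n z - F z) <= e.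
Proof.
have /choice[F HF] z : exists L, M z -> lim_to (f ^~ z) L.
  have [Mz|nM] := pselect (M z); last by exists 0.
  have [r r1 pz] := in_polyann Mz.
  have [|L HL] := @cauchy_vec R k (f ^~ z); last by exists L.
  by move=> e /(f_cauchy r1)[n0 Hn0]; exists n0 => n n' nn nn'; exact: Hn0.
exists F => r r1 e /(f_cauchy r1)[n0 Hn0]; exists n0 => n nn z pz.
rewrite nrB; apply: (lim_to_le (HF z (M_polyann r1 pz)) (n0 := n0)) => n' nn'.
exact: Hn0.
Qed.

(** Both [g] and [f] converge locally uniformly, to holomorphic maps [G] and [F] by
    [weierstrass]. That [F] takes values in [basin] follows from [backward] and
    [forward], and the identities between [g n] and [f n] pass to the limit. The
    last clause keeps the rate of convergence for the proof of the Runge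
    property. *)
Lemma basin_biholomorphic : exists F G : V -> V,
  [/\ open basin,
      forall p, basin p -> differentiable G p /\ M (G p),
      forall z, M z -> differentiable F z /\ basin (F z),
      (forall p, basin p -> F (G p) = p) /\ (forall z, M z -> G (F z) = z)
    & forall p, basin p -> exists2 d : R, 0 < d & exists (r : R) m, exists2 K : R,
        1 <= r /\ 0 <= K & forall x, nr (x - p) < d -> forall n, (m <= n)%N ->
        [/\ polyann r (g n x), polyann r (G x) & nr (g n x - G x) <= K * tail n]].
Proof.
have [G HG] := g_lim_exists; have [F HF] := f_lim_exists.
have basinP p d (r : R) m (K : R) : 1 <= r -> (forall x, nr (x - p) < d -> forall n, (m <= n)%N ->
    polyann r (g n x) /\ forall n', (n <= n')%N -> nr (g n' x - g n x) <= K * (tail n - tail n')) ->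
    forall x, nr (x - p) < d -> basin x.
  by move=> r1 H x xp; exists r, m => // n mn; exact: (H x xp n mn).1.
have loc p : basin p -> exists2 d : R, 0 < d & exists (r : R) m, exists2 K : R,
    1 <= r /\ 0 <= K & forall x, nr (x - p) < d -> forall n, (m <= n)%N ->
    [/\ polyann r (g n x), polyann r (G x) & nr (g n x - G x) <= K * tail n].
  move=> Bp; have [d d0 [r [m [K [r1 K0] H]]]] := basin_local Bp.
  have Gest x : nr (x - p) < d -> forall n, (m <= n)%N -> nr (g n x - G x) <= K * tail n.
    move=> xp n mn; rewrite nrB.
    apply: (lim_to_le (HG x (basinP _ _ _ _ _ r1 H x xp)) (n0 := n)) => n' nn'.
    apply: (le_trans ((H x xp n mn).2 n' nn')).
    by rewrite ler_wpM2l //; have := tail_gt0 (R := R) n'; lra.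
  exists d => //; exists (2 * r), m, K => [|x xp n mn]; first by split=> //; lra.
  split; [| |exact: Gest].
    by apply: polyann_mono (H x xp n mn).1; lra.
  have [|n1 Hn1] := @Ktail_small K (2 * r)^-1 K0; first by rewrite invr_gt0; lra.
  have mn1 := leq_maxl m n1; have h1 := Gest x xp _ mn1.
  apply: polyann_thick r1 (H x xp _ mn1).1 _; rewrite nrB; apply: (le_trans h1).
  by apply: Hn1; exact: leq_maxr.
have FM z : M z -> forall m0 e, 0 < e -> exists2 m, (m0 <= m)%N & nr (g m (F z) - z) <= e.
  move=> Mz m0 e e0; have [r r1 pz] := in_polyann Mz.
  have [m1 [K K0 Hb]] := backward r1.
  have e20 : 0 < e / 2 by rewrite divr_gt0.
  have [m2 Hm2] := Ktail_small K0 e20.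
  pose m := maxn m0 (maxn m1 m2).
  have m1m : (m1 <= m)%N by rewrite !leq_max leqnn orbT.
  have m2m : (m2 <= m)%N by rewrite !leq_max leqnn !orbT.
  exists m; first exact: leq_maxl.
  have [d d0 Hd] := diff_cont_eps (g_diff m (F z)) e20.
  have d20 : 0 < d / 2 by rewrite divr_gt0.
  have [n0 Hn0] := HF r r1 _ d20.
  pose n := maxn m n0.
  have [_ h1] := Hb m n z m1m (leq_maxl _ _) pz.
  have h2 : nr (g m (f n z) - g m (F z)) < e / 2.
    by apply: Hd; have := Hn0 n (leq_maxr _ _) z pz; lra.
  have h3 : K * (tail m - tail n) <= K * tail m.
    by rewrite ler_wpM2l //; have := tail_gt0 (R := R) n; lra.
  have h4 := Hm2 m m2m.
  by have := nr_dist (g m (F z)) z (g m (f n z)); rewrite [nr (_ - g m (f n z))]nrB; lra.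
have FB z : M z -> basin (F z).
  move=> Mz; have [r r1 pz] := in_polyann Mz.
  have r2 : 1 <= 2 * r by lra.
  have [m0 [K K0 Hf]] := forward r2.
  have [|m mm hm] := FM z Mz m0 (2 * r)^-1; first by rewrite invr_gt0; lra.
  exists (2 * (2 * r)), m; first lra.
  by move=> n mn; apply: (Hf m (F z) mm _ n mn).1; exact: polyann_thick r1 pz hm.
have GM p : basin p -> M (G p).
  move=> Bp; have [d d0 [r [m [K [r1 K0] H]]]] := loc p Bp.
  by have [|_ + _] := H p _ m (leqnn _); [rewrite subrr nr0|exact: M_polyann].
have dF z : M z -> differentiable F z.
  move=> Mz; have [r r1 pz] := in_polyann Mz.
  have rho0 : 0 < (2 * r)^-1 by rewrite invr_gt0; lra.
  have inb x : nr (x - z) < (2 * r)^-1 -> polyann (2 * r) x.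
    by move=> xz; apply: polyann_thick r1 pz _; exact: ltW.
  have r2 : 1 <= 2 * r by lra.
  apply: (@weierstrass_vec R k f F z _ rho0) => [n x /inb px|e e0].
    by apply: f_diff; exact: M_polyann px.
  by have [n0 Hn0] := HF _ r2 e e0; exists n0 => n nn x /inb; exact: Hn0.
exists F, G; split => //.
- rewrite openE => p Bp; have [d d0 [r [m [K [r1 K0] H]]]] := basin_local Bp.
  by apply/nbhs_nr; exists d => // x xp; exact: basinP H x xp.
- move=> p Bp; have [d d0 [r [m [K [r1 K0] H]]]] := loc p Bp; split; last exact: GM.
  apply: (@weierstrass_vec R k g G p d d0) => // e e0.
  have [n1 Hn1] := Ktail_small K0 e0.
  exists (maxn m n1) => n; rewrite geq_max => /andP[mn n1n] x xp.
  by have [_ _ /le_trans] := H x xp n mn; apply; exact: Hn1.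
- by move=> z Mz; split; [exact: dF|exact: FB].
split=> [p Bp|z Mz]; apply/eqP; rewrite -subr_eq0 -nr_eq0 eq_le nr_ge0 andbT;
    apply/ler_addgt0Pr => e e0; rewrite add0r.
  have [d d0 [r [m [K [r1 K0] H]]]] := loc p Bp.
  have e20 : 0 < e / 2 by rewrite divr_gt0.
  have [d' d'0 Hd'] := diff_cont_eps (dF _ (GM p Bp)) e20.
  have d'20 : 0 < d' / 2 by rewrite divr_gt0.
  have [n1 Hn1] := Ktail_small K0 d'20.
  have [n2 Hn2] := HF r r1 _ e20.
  pose n := maxn m (maxn n1 n2).
  have n1n : (n1 <= n)%N by rewrite !leq_max leqnn orbT.
  have n2n : (n2 <= n)%N by rewrite !leq_max leqnn !orbT.
  have pp : nr (p - p) < d by rewrite subrr nr0.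
  have [pn _ h1] := H p pp n (leq_maxl _ _).
  have h2 : nr (F (g n p) - F (G p)) < e / 2.
    by apply: Hd'; have := Hn1 n n1n; lra.
  have h3 := Hn2 n n2n _ pn; rewrite fgK in h3; last exact: M_polyann pn.
  rewrite nrB in h2; rewrite nrB in h3.
  by have := nr_dist (F (G p)) p (F (g n p)); lra.
have Bz := FB z Mz.
have e20 : 0 < e / 2 by rewrite divr_gt0.
have [n0 Hn0] := HG _ Bz _ e20.
have [m mm hm] := FM z Mz n0 _ e20.
have h1 := Hn0 m mm; rewrite nrB in h1.
by have := nr_dist (G (F z)) z (g m (F z)); lra.
Qed.

End NonautonomousLimit.

(** * Polynomial approximation of entire functions *)

Section PolynomialApproximation.
Context {R : realType} {k : nat}.
Local Notation C := R[i].
Local Notation V := 'rV[C]_k.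
Variable K : set V.
Hypothesis cK : compact K.
Implicit Types (F G : V -> C).

Definition peval (p : mpoly.mpoly k C) (z : V) : C := mpoly.meval (fun i => z 0 i) p.

Definition poly_approx F := forall e : R, 0 < e -> exists p, forall z, K z ->
  nr (F z - peval p z) <= e.

Lemma Esum (I : Type) (s : seq I) (F : I -> V -> C) : (forall i, entire_expr (F i)) ->
  entire_expr (fun z => \sum_(i <- s) F i z).
Proof.
move=> HF; elim: s => [|i s IH]; first by under eq_fun do rewrite big_nil; exact: Ecst.
by under eq_fun do rewrite big_cons; exact: Eadd.
Qed.

Lemma Ebigprod (I : Type) (s : seq I) (F : I -> V -> C) : (forall i, entire_expr (F i)) ->
  entire_expr (fun z => \prod_(i <- s) F i z).
Proof.
move=> HF; elim: s => [|i s IH]; first by under eq_fun do rewrite big_nil; exact: Ecst.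
by under eq_fun do rewrite big_cons; exact: Emul.
Qed.

Lemma peval_entire p : entire_expr (peval p).
Proof.
rewrite (_ : peval p = fun z => mpoly.meval (fun i => z 0 i) p) //.
under eq_fun do rewrite mpoly.mevalE.
apply: Esum => m; apply: Emul; first exact: Ecst.
by apply: Ebigprod => i; apply: EX; exact: Ecoord.
Qed.

(** Sums and products of polynomials are handled through their values only. *)
Lemma pevalD p q : exists r, forall z, peval r z = peval p z + peval q z.
Proof. by eexists => z; exact: mpoly.mevalD. Qed.

Lemma pevalM p q : exists r, forall z, peval r z = peval p z * peval q z.
Proof. by eexists => z; exact: mpoly.mevalM. Qed.

Lemma poly_approx_bounded F : poly_approx F ->
  exists2 B : R, 0 <= B & forall z, K z -> nr (F z) <= B.
Proof.
move=> /(_ 1 ltr01)[p Hp].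
have [B B0 HB] := compact_nr_bound cK (fun z _ => entire_diff z (peval_entire p)).
exists (B + 1) => [|z Kz]; first by rewrite addr_ge0.
by have := nr_distl (F z) (peval p z); have := Hp z Kz; have := HB z Kz; lra.
Qed.

Lemma poly_approx_cst c : poly_approx (fun=> c).
Proof.
by move=> e e0; exists (mpoly.mpolyC k c) => z _; rewrite /peval mpoly.mevalC subrr nr0 ltW.
Qed.

Lemma poly_approx_coord i : poly_approx (fun z => z 0 i).
Proof.
move=> e e0; exists (mpoly.mpolyX C (mpoly.mnm1 i)) => z _.
by rewrite /peval mpoly.mevalXU subrr nr0 ltW.
Qed.

Lemma poly_approx_lim F : (forall e : R, 0 < e -> exists2 G, poly_approx G &
    forall z, K z -> nr (F z - G z) <= e) -> poly_approx F.
Proof.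
move=> H e e0; have e20 : 0 < e / 2 by rewrite divr_gt0.
have [G PG HG] := H _ e20; have [p Hp] := PG _ e20; exists p => z Kz.
by have := nr_dist (F z) (peval p z) (G z); have := Hp z Kz; have := HG z Kz; lra.
Qed.

Lemma poly_approxD F G : poly_approx F -> poly_approx G -> poly_approx (fun z => F z + G z).
Proof.
move=> PF PG e e0; have e20 : 0 < e / 2 by rewrite divr_gt0.
have [p Hp] := PF _ e20; have [q Hq] := PG _ e20; have [s Hs] := pevalD p q.
exists s => z Kz; rewrite Hs.
have -> : F z + G z - (peval p z + peval q z) = (F z - peval p z) + (G z - peval q z) by ring.
by apply: (le_trans (nrD _ _)); have := Hp z Kz; have := Hq z Kz; lra.
Qed.

Lemma poly_approxM F G : poly_approx F -> poly_approx G -> poly_approx (fun z => F z * G z).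
Proof.
move=> PF PG e e0.
have [B B0 HB] := poly_approx_bounded PF; have [B' B'0 HB'] := poly_approx_bounded PG.
pose d := Num.min 1 (e / (B + B' + 1)).
have den : 0 < B + B' + 1 by lra.
have d0 : 0 < d by rewrite lt_min ltr01 divr_gt0.
have d1 : d <= 1 by rewrite ge_min lexx.
have de : (B + B' + 1) * d <= e by rewrite mulrC -ler_pdivlMr // ge_min lexx orbT.
have [p Hp] := PF _ d0; have [q Hq] := PG _ d0; have [s Hs] := pevalM p q.
exists s => z Kz; rewrite Hs.
have -> : F z * G z - peval p z * peval q z =
  F z * (G z - peval q z) + (F z - peval p z) * G z - (F z - peval p z) * (G z - peval q z) by ring.
have h1 := Hp z Kz; have h2 := Hq z Kz; have h3 := HB z Kz; have h4 := HB' z Kz.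
apply: (le_trans (nrD _ _)); rewrite nrN [nr ((F z - _) * (G z - _))]nrM.
have := nrD (F z * (G z - peval q z)) ((F z - peval p z) * G z).
rewrite [nr (F z * (G z - _))]nrM [nr ((F z - _) * G z)]nrM.
have k1 := ler_pM (nr_ge0 _) (nr_ge0 _) h3 h2.
have k2 := ler_pM (nr_ge0 _) (nr_ge0 _) h1 h4.
have k3 := ler_pM (nr_ge0 _) (nr_ge0 _) h1 h2.
have : d * d <= d by rewrite ler_piMl // ltW.
lra.
Qed.

Lemma poly_approxX F n : poly_approx F -> poly_approx (fun z => F z ^+ n).
Proof.
move=> PF; elim: n => [|n IH]; first by under eq_fun do rewrite expr0; exact: poly_approx_cst.
by under eq_fun do rewrite exprS; exact: poly_approxM.
Qed.

(** With [a = cexp (w / N)] and [b = 1 + w / N], the difference [a ^ N - b ^ N] is at most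
    a bounded multiple of [N] times [a - b], which is quadratic in [1 / N]. *)
Lemma cexp_pow (B e : R) : 0 <= B -> 0 < e -> exists N, forall w : C, nr w <= B ->
  nr (cexp w - (1 + w / N.+1%:R) ^+ N.+1) <= e.
Proof.
move=> B0 e0.
have [n1 Hn1] := nat_large (2 * B); have [n2 Hn2] := nat_large (5 * B ^+ 2 * expR B / e).
pose N := maxn n1 n2; exists N => w wB.
have h1 := Hn1 N (leq_maxl _ _); have h2 := Hn2 N (leq_maxr _ _).
set P := N.+1%:R in h1 h2.
have P0 : 0 < P :> R by rewrite ltr0n.
have PC : N.+1%:R != 0 :> C by rewrite pnatr_eq0.
pose v : C := w / N.+1%:R.
have vn : nr v = nr w / P by rewrite nrM nrV nr_nat.
have v2 : nr v <= 2^-1 by rewrite vn ler_pdivrMr //; lra.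
have -> : cexp w = cexp v ^+ N.+1 by rewrite -cexpMn /v mulrC divfK.
rewrite -/v.
pose m := expR (nr v).
have m1 : 1 <= m by rewrite -expR0 ler_expR nr_ge0.
have a_m : nr (cexp v) <= m.
  by rewrite nr_cexp ler_expR; apply: le_trans (Re_le_nr v); exact: ler_norm.
have b_m : nr (1 + v) <= m.
  by apply: (le_trans (nrD _ _)); rewrite nr1; exact: expR_ge1Dx.
have pow_diff n (a b : C) : nr a <= m -> nr b <= m ->
    nr (a ^+ n - b ^+ n) <= n%:R * m ^+ n * nr (a - b).
  move=> am bm; elim: n => [|n IH]; first by rewrite !expr0 subrr nr0 !mul0r.
  have -> : a ^+ n.+1 - b ^+ n.+1 = a * (a ^+ n - b ^+ n) + (a - b) * b ^+ n.
    by rewrite !exprS; ring.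
  apply: (le_trans (nrD _ _)); rewrite [nr (a * _)]nrM [nr ((a - b) * _)]nrM nrX.
  have k1 := ler_pM (nr_ge0 _) (nr_ge0 _) am IH.
  have k2 : nr (a - b) * nr b ^+ n <= m ^+ n.+1 * nr (a - b).
    rewrite mulrC ler_wpM2r ?nr_ge0 //; apply: (@le_trans _ _ (m ^+ n)).
      by rewrite lerXn2r ?nnegrE ?nr_ge0 //; lra.
    by rewrite exprS ler_peMl // exprn_ge0 //; lra.
  apply: (le_trans (lerD k1 k2)); rewrite -natr1 exprS le_eqVlt.
  by apply/orP; left; apply/eqP; ring.
apply: (le_trans (pow_diff _ _ _ a_m b_m)).
have q : nr (cexp v - (1 + v)) <= 5 * nr v ^+ 2.
  by rewrite opprD addrA; exact: cexp_quad.
have mN : m ^+ N.+1 <= expR B.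
  by rewrite /m -expRM_natl ler_expR vn -/P mulrC divfK ?gt_eqF.
apply: (@le_trans _ _ (P * expR B * (5 * (B / P) ^+ 2))).
  apply: ler_pM; rewrite ?nr_ge0 ?mulr_ge0 ?exprn_ge0 //; first lra.
    by rewrite ler_wpM2l // ltW.
  apply: (le_trans q); rewrite ler_wpM2l // lerXn2r ?nnegrE ?nr_ge0 ?divr_ge0 ?(ltW P0) //.
  by rewrite vn ler_pM2r ?invr_gt0.
have -> : P * expR B * (5 * (B / P) ^+ 2) = 5 * B ^+ 2 * expR B / P by field; rewrite gt_eqF.
rewrite ler_pdivrMr // [e * P]mulrC -ler_pdivrMr //; exact: ltW.
Qed.

Lemma poly_approx_cexp F : poly_approx F -> poly_approx (fun z => cexp (F z)).
Proof.
move=> PF; apply: poly_approx_lim => e e0.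
have [B B0 HB] := poly_approx_bounded PF; have [N HN] := cexp_pow B0 e0.
exists (fun z => (1 + F z / N.+1%:R) ^+ N.+1); last by move=> z Kz; apply: HN; exact: HB.
apply: poly_approxX; apply: poly_approxD; first exact: poly_approx_cst.
by apply: poly_approxM => //; exact: poly_approx_cst.
Qed.

Lemma entire_poly_approx F : entire_expr F -> poly_approx F.
Proof.
elim=> [c|i|{}F G _ IF _ IG|{}F G _ IF _ IG|{}F _ IF].
- exact: poly_approx_cst.
- exact: poly_approx_coord.
- exact: poly_approxD.
- exact: poly_approxM.
- exact: poly_approx_cexp.
Qed.
End PolynomialApproximation.

(** * The basin *)

Section Dynamics.
Context {R : realType} {k : nat}.
Local Notation C := R[i].
Local Notation V := 'rV[C]_k.
Local Notation M := (C_times_Cstar R k).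
Variables (i0 i1 : 'I_k).
Hypothesis i0E : (i0 : nat) = 0%N.
Hypothesis i10 : i1 != i0.

Fixpoint orbit n (p : V) : V := if n is m.+1 then Phi i0 i1 (rate m) (orbit m p) else p.
Fixpoint orbit_inv n (z : V) : V := if n is m.+1 then orbit_inv m (Phi_inv i0 i1 (rate m) z) else z.

Lemma orbitK n : cancel (orbit n) (orbit_inv n).
Proof. by elim: n => [//|n IH] p /=; rewrite PhiK // IH. Qed.

Lemma orbit_invK n : cancel (orbit_inv n) (orbit n).
Proof. by elim: n => [//|n IH] z /=; rewrite IH Phi_invK. Qed.

Lemma entire_orbit n : entire_map (orbit n).
Proof.
elim: n => [|n IH]; first exact: entire_map_id.
exact: entire_map_comp (entire_Phi i10 _) IH.
Qed.

Lemma entire_orbit_inv n : entire_map (orbit_inv n).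
Proof.
elim: n => [|n IH]; first exact: entire_map_id.
exact: entire_map_comp IH (entire_Phi_inv i10 _).
Qed.

Definition chart_orbit n (p : V) : V := chart i0 n (orbit n p).
Definition chart_orbit_inv n (z : V) : V := orbit_inv n (unchart i0 n z).

Lemma entire_chart n : entire_map (chart i0 n : V -> V).
Proof.
move=> j; under eq_fun do rewrite mxE.
case: eqP => _; last exact: Ecoord.
by apply: Ecst_mul; apply: Esub; [exact: Ecst|exact: Eprod].
Qed.

Lemma entire_chart_orbit n : entire_map (chart_orbit n).
Proof. exact: entire_map_comp (entire_chart n) (entire_orbit n). Qed.

Lemma unchart_diff n z : M z -> differentiable (unchart i0 n : V -> V) z.
Proof.
move=> Mz; apply: diff_rv => j; under eq_fun do rewrite mxE.
case: eqP => _; last exact: differentiable_coord.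
apply: differentiable_mul.
  apply: entire_diff; apply: Esub; first exact: Ecst.
  by apply: Emul; [exact: Ecoord|exact: Ecst].
apply: differentiable_inv; last exact: coord_prod_but0_neq0.
by apply: entire_diff; exact: Eprod.
Qed.

Lemma chart_orbit_inv_diff n z : M z -> differentiable (chart_orbit_inv n) z.
Proof.
move=> Mz; apply: differentiable_comp; first exact: unchart_diff.
exact: entire_map_diff (entire_orbit_inv n).
Qed.

Lemma chart_orbitS n p : M (chart_orbit n p) -> chart_orbit n.+1 p = chart_step i0 i1 n (chart_orbit n p).
Proof. by move=> Mg; rewrite /chart_step /chart_orbit (chartK i0E) //; exact: (chart_M i0E n _).2 Mg. Qed.

Lemma chart_orbit_invS n z : M z -> M (chart_step_inv i0 i1 n z) -> chart_orbit_inv n.+1 z = chart_orbit_inv n (chart_step_inv i0 i1 n z).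
Proof.
by move=> Mz Mh; rewrite /chart_orbit_inv /chart_step_inv (chartK i0E) //; exact: (chart_M i0E n _).2 Mh.
Qed.

Lemma chart_orbit_invK n z : M z -> chart_orbit n (chart_orbit_inv n z) = z.
Proof. by move=> Mz; rewrite /chart_orbit /chart_orbit_inv orbit_invK unchartK. Qed.

Lemma chart_orbitK n p : M (chart_orbit n p) -> chart_orbit_inv n (chart_orbit n p) = p.
Proof.
by move=> Mg; rewrite /chart_orbit_inv /chart_orbit (chartK i0E) ?orbitK //; exact: (chart_M i0E n _).2 Mg.
Qed.

(** [C_times_Cstar] is the image of a vector space under exponentials, hence a union of
    arcs issued from one point. *)
Definition exp_map (u : V) : V := \row_j if j == i0 then u 0 j else cexp (u 0 j).

Lemma exp_map_M u : M (exp_map u).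
Proof.
move=> i ii; rewrite mxE; case: (i =P i0) => [E|_]; last exact: cexp_neq0.
by rewrite E i0E in ii.
Qed.

Lemma exp_map_surj z : M z -> exists u, exp_map u = z.
Proof.
move=> Mz.
have /choice[u Hu] j : exists c, (if j == i0 then c else cexp c) = z 0 j.
  case: eqP => [_|/eqP j0]; first by exists (z 0 j).
  by have [w wE] := cexp_surj (M_neq0 i0E Mz j0); exists w.
by exists (\row_j u j); apply/rowP => j; rewrite !mxE Hu.
Qed.

Lemma exp_map_diff u : differentiable exp_map u.
Proof.
apply: entire_map_diff => j; under eq_fun do rewrite mxE.
by case: eqP => _; [exact: Ecoord|apply: Eexp; exact: Ecoord].
Qed.

Lemma connected_image (F : V -> V) : (forall z, M z -> differentiable F z) ->
  connected (F @` M).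
Proof.
move=> dF; pose A (u : V) : set V := (fun t : R => F (exp_map (t%:C *: u))) @` `[0, 1]%classic.
have -> : F @` M = \bigcup_(u in setT) A u.
  apply/seteqP; split=> [_ [z Mz <-]|_ [u _ [t _ <-]]].
    have [u <-] := exp_map_surj Mz; exists u => //.
    by exists 1; [rewrite /= in_itv /= lexx ler01|rewrite scale1r].
  by exists (exp_map (t%:C *: u)) => //; exact: exp_map_M.
apply: bigcup_connected.
  exists (F (exp_map 0)) => u _; exists 0; first by rewrite /= in_itv /= lexx ler01.
  by rewrite scale0r.
move=> u _; apply: connected_continuous_connected; first exact: segment_connected.
apply: continuous_subspaceT => t.
have c1 : {for t, continuous (fun t : R => t%:C *: u)}.
  move=> B /nbhs_nr[d d0 Hd].
  have u1 : 0 < nr u + 1 by have := nr_ge0 u; lra.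
  exists (d / (nr u + 1)) => /=; first by rewrite divr_gt0.
  move=> t' /=; rewrite ltr_pdivlMr // distrC => tt; apply: Hd.
  rewrite -scalerBl nrZ -rmorphB nr_real; apply: le_lt_trans tt.
  by rewrite ler_wpM2l //; lra.
apply: (@continuous_comp _ _ _ (fun t : R => t%:C *: u) (F \o exp_map) t c1).
apply: (@continuous_comp _ _ _ exp_map F).
  exact: differentiable_continuous (exp_map_diff _).
by apply: differentiable_continuous; apply: dF; exact: exp_map_M.
Qed.

Lemma rv_coordB (x y : V) i : (x - y) 0 i = x 0 i - y 0 i.
Proof. by rewrite !mxE. Qed.

(** The functions on the product whose composite with [G] is a limit of polynomials on
    [K] form a class to which [laurent_approx] applies: [G] and the inverses of its
    nonvanishing coordinates are limits of entire functions. *)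
Lemma runge_basin (F G : V -> V) (D : set V) :
  (forall z, M z -> differentiable F z /\ D (F z)) ->
  (forall p, D p -> F (G p) = p) ->
  (forall p, D p -> exists2 d : R, 0 < d & exists (r : R) m, exists2 K : R,
        1 <= r /\ 0 <= K & forall x, nr (x - p) < d -> forall n, (m <= n)%N ->
        [/\ polyann r (chart_orbit n x), polyann r (G x) & nr (chart_orbit n x - G x) <= K * tail n]) ->
  runge D.
Proof.
move=> FD FGK loc f df K cK KD.
pose PA := poly_approx K.
have unif (e : R) : 0 < e -> exists n0, forall n, (n0 <= n)%N -> forall x, K x ->
    nr (chart_orbit n x - G x) <= e.
  move=> e0; apply: (@compact_eventually R V K (fun n x => nr (chart_orbit n x - G x) <= e)) cK _ => x Kx.
  have [d d0 [r [m [B [r1 B0] H]]]] := loc x (KD _ Kx).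
  exists d => //; have [n1 Hn1] := Ktail_small B0 e0; exists (maxn m n1) => y _ yx n.
  rewrite geq_max => /andP[mn n1n]; have [_ _ /le_trans] := H y yx n mn; apply.
  exact: Hn1.
have [r r1 Kr] : exists2 r : R, 1 <= r & forall x, K x -> polyann r (G x).
  have [|n0 Hn0] := @compact_eventually R V K (fun n x => polyann n.+1%:R (G x)) cK; last first.
    by exists n0.+1%:R; [rewrite ler1n|exact: Hn0].
  move=> x Kx; have [d d0 [r [m [B [r1 B0] H]]]] := loc x (KD _ Kx).
  exists d => //; have [n0 Hn0] := nat_large r; exists n0 => y _ yx n /Hn0 rn.
  have [_ Gy _] := H y yx m (leqnn _).
  by apply: polyann_mono Gy; [lra|exact: ltW].
have r0 : 0 < 2 * r by lra.
have near_g : exists n0, forall n, (n0 <= n)%N -> forall x, K x -> polyann (2 * r) (chart_orbit n x).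
  have [|n0 Hn0] := unif (2 * r)^-1; first by rewrite invr_gt0.
  by exists n0 => n nn x Kx; apply: polyann_thick r1 (Kr x Kx) _; exact: Hn0.
have PAcoord i : PA (fun x => G x 0 i).
  apply: poly_approx_lim => e /unif[n0 Hn0]; exists (fun x => chart_orbit n0 x 0 i).
    by apply: entire_poly_approx => //; exact: entire_chart_orbit.
  move=> x Kx; rewrite nrB; have := nr_coord (chart_orbit n0 x - G x) i; rewrite !mxE.
  by move=> /le_trans; apply; exact: Hn0.
have PAinv (i : 'I_k) : (i : nat) != 0%N -> PA (fun x => (G x 0 i)^-1).
  move=> ii; have ii0 : i != i0.
    by apply: contra ii => /eqP ->; rewrite i0E.
  apply: poly_approx_lim => e e0; have e20 : 0 < e / 2 by rewrite divr_gt0.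
  pose c := (2 * r) ^+ 2; have c0 : 0 < c by rewrite exprn_gt0.
  have [|n1 Hn1] := unif (e / 2 / c); first by rewrite divr_gt0.
  have [n2 Hn2] := near_g; have [n3 Hn3] := Ktail_small (ltW c0) e20.
  pose n := maxn n1 (maxn n2 n3).
  have n1n : (n1 <= n)%N by rewrite leq_maxl.
  have n2n : (n2 <= n)%N by rewrite !leq_max leqnn orbT.
  have n3n : (n3 <= n)%N by rewrite !leq_max leqnn !orbT.
  exists (fun x => \prod_(l | l != i) orbit n x 0 l).
    apply: entire_poly_approx => //.
    exact: (entire_comp (Eprod (fun l => l != i)) (entire_orbit n)).
  move=> x Kx.
  have [_ ha] := Kr x Kx i; have [hb' hb] := Hn2 n n2n x Kx i.
  have [hu _] := Hn2 n n2n x Kx i0.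
  have hab := Hn1 n n1n x Kx; have ht := Hn3 n n3n.
  have {}ha := ha ii; have {}hb := hb ii.
  set a := G x 0 i in ha *; set b := chart_orbit n x 0 i in hb hb'; set u := chart_orbit n x 0 i0 in hu.
  have na : 0 < nr a by apply: lt_le_trans ha; rewrite invr_gt0; lra.
  have nb : 0 < nr b by apply: lt_le_trans hb; rewrite invr_gt0.
  have a0 : a != 0 by rewrite -nr_gt0.
  have b0 : b != 0 by rewrite -nr_gt0.
  have s0 := @scaleC_neq0 R n.
  have -> : \prod_(l | l != i) orbit n x 0 l = (1 - u / (scale n)%:C) / b.
    have uE : 1 - u / (scale n)%:C = coord_prod (orbit n x).
      by rewrite /u /chart_orbit /chart updE; field.
    have bE : b = orbit n x 0 i by rewrite /b /chart_orbit /chart mxE (negbTE ii0).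
    by rewrite uE /coord_prod [X in X / b](bigD1 i) //= -bE mulrC mulKf.
  have -> : a^-1 - (1 - u / (scale n)%:C) / b = (b - a) * (a^-1 * b^-1) + u / (scale n)%:C / b.
    by field; rewrite s0 b0 a0.
  have iA : (nr a)^-1 <= 2 * r.
    rewrite -[leRHS]invrK lef_pV2 ?posrE ?invr_gt0 //; apply: le_trans ha.
    by rewrite lef_pV2 ?posrE; lra.
  have iB : (nr b)^-1 <= 2 * r by rewrite -[leRHS]invrK lef_pV2 ?posrE ?invr_gt0.
  apply: (le_trans (nrD _ _)).
  have k1 : nr ((b - a) * (a^-1 * b^-1)) <= e / 2.
    rewrite nrM [nr (a^-1 * _)]nrM !nrV.
    have hba : nr (b - a) <= e / 2 / c.
      have E : b - a = (chart_orbit n x - G x) 0 i by apply: esym; exact: rv_coordB.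
      by rewrite E; apply: (le_trans (nr_coord _ i)).
    have ab_c : (nr a)^-1 * (nr b)^-1 <= c.
      by rewrite /c expr2; apply: ler_pM; rewrite ?invr_ge0 ?nr_ge0.
    have i0' : 0 <= (nr a)^-1 * (nr b)^-1 by rewrite mulr_ge0 ?invr_ge0 ?nr_ge0.
    apply: (le_trans (ler_pM (nr_ge0 _) i0' hba ab_c)).
    by rewrite divfK // gt_eqF.
  have k2 : nr (u / (scale n)%:C / b) <= e / 2.
    rewrite nrM [nr (u / _)]nrM !nrV nr_real gtr0_norm ?scale_gt0 //.
    apply: le_trans ht; rewrite /c expr2 mulrAC.
    apply: ler_pM; rewrite ?invr_ge0 ?mulr_ge0 ?invr_ge0 ?nr_ge0 ?(ltW (scale_gt0 _)) //.
    by apply: ler_pM; rewrite ?invr_ge0 ?nr_ge0.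
  lra.
have PAf : PA (fun x => f (F (G x))).
  apply: (@laurent_approx R k (fun w => PA (fun x => w (G x))) r r1 _ _ _ _ _ _ (fun z => f (F z))).
  - by move=> c; exact: poly_approx_cst.
  - by move=> w w' H H'; exact: poly_approxD.
  - by move=> w w' H H'; exact: poly_approxM.
  - exact: PAcoord.
  - exact: PAinv.
  - move=> w H; apply: poly_approx_lim => e /H[w' Hw' ww']; exists (fun x => w' (G x)) => // x Kx.
    by apply: ww'; exact: Kr.
  - move=> z Mz; have [dFz DF] := FD z Mz.
    by apply: (differentiable_comp dFz); exact: df.
move=> e e0; have [|p Hp] := PAf (e / 2); first by rewrite divr_gt0.
exists p => z Kz; rewrite nr_ltP; have := Hp z Kz; rewrite FGK; last exact: KD.
by rewrite /peval; lra.
Qed.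
End Dynamics.

Theorem corollary0p2 (R : realType) (k : nat) (hk : (2 <= k)%N) :
  exists D : set 'rV[R[i]]_k,
    [/\ domain D, biholomorphic D (C_times_Cstar R k) & runge D].
Proof.
case: k hk => [//|[//|k] hk].
pose i0 : 'I_k.+2 := ord0; pose i1 : 'I_k.+2 := lift ord0 ord0.
have i0E : (i0 : nat) = 0%N by [].
have i10 : i1 != i0 by [].
pose D := basin (chart_orbit i0 i1 (R := R)).
have [F [G [openD GD FD [FGK GFK] loc]]] := @basin_biholomorphic R k.+2
  (chart_orbit i0 i1) (chart_orbit_inv i0 i1) (chart_step i0 i1) (chart_step_inv i0 i1)
  (chart_orbitS i0E) (chart_orbit_invS i0E) (chart_orbit_invK i0E i10) (chart_orbitK i0E i10)
  (chart_step_est i0E i10) (chart_step_inv_est i0E i10)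
  (fun n p => entire_map_diff p (entire_chart_orbit i10 n)) (chart_orbit_inv_diff i0E i10).
exists D; split; last exact: runge_basin FD FGK loc.
- split=> //.
    have -> : D = F @` C_times_Cstar R k.+2.
      apply/seteqP; split=> [p Dp|_ [z Mz <-]]; last exact: (FD z Mz).2.
      by exists (G p); [exact: (GD p Dp).2|exact: FGK].
    by apply: connected_image i0E _ _ => z /FD[].
  exists (F (const_mx 1)); apply: (FD _ _).2 => i _; rewrite mxE.
  exact: oner_neq0.
exists G, F; split.
- by move=> p /GD[].
- by move=> z /FD[].
- by move=> _ [p /GD[_ ?] <-].
- by move=> _ [z /FD[_ ?] <-].
- by split=> [p /set_mem|z /set_mem]; [exact: FGK|exact: GFK].
Qed.
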